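(* Let $B$ be the unit ball of $\mathbb{R}^N$ and let $\lambda^*_\alpha(N)$ and $u^*_\alpha$ be the extremal parameter and the extremal solution of the MEMS model with power-law permittivity profile $|x|^\alpha$, that is, of $-\Delta u=\frac{\lambda|x|^\alpha}{(1-u)^2}$ in $B$, $u=0$ on $\partial B$. Put $\alpha_N:=\frac{3N-14-4\sqrt6}{4+2\sqrt6}$. Then the following estimates hold. 1. For any dimension $N\ge1$, we have for $\alpha\gg1$ $$\lambda^*_\alpha(N)\sim 0.789\,\Big(1+\frac\alpha2\Big)^2.$$ 2. If $N=2$, then $$\lambda^*_\alpha(2)=0.789\,\Big(1+\frac\alpha2\Big)^2\quad\text{and}\quad\|u^*_\alpha\|_{L^\infty}=0.445\quad\text{for all }\alpha>-2.$$ 3. If $1\le N\le7$, or if $N\ge8$ and $\alpha>\alpha_N$, then the extremal solution $u^*_\alpha$ is classical and the pull-in distance satisfies $\|u^*_\alpha\|_{L^\infty}<1$. 4. If $N\ge8$ and $0\le\alpha\le\alpha_N$, then the extremal solution is exactly $u^*_\alpha(x)=1-|x|^{\frac{2+\alpha}{3}}$, which means that $$\lambda^*_\alpha(N)=\frac{(2+\alpha)(3N+\alpha-4)}{9}\quad\text{and}\quad\|u^*_\alpha\|_{L^\infty}=1.$$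
   Context: A solution of $-\Delta u=\frac{\lambda|x|^\alpha}{(1-u)^2}$ in $B$, $u=0$ on $\partial B$, is classical if $\|u\|_{L^\infty}<1$. The extremal parameter (pull-in voltage) $\lambda^*_\alpha(N)$ is the supremum of the $\lambda>0$ for which a classical solution exists; for $0<\lambda<\lambda^*_\alpha(N)$ there is a minimal classical solution $u_\lambda$ (any other solution $v$ satisfies $v\ge u_\lambda$ a.e.), increasing in $\lambda$, and the extremal solution is $u^*_\alpha(x):=\lim_{\lambda\nearrow\lambda^*_\alpha(N)}u_\lambda(x)$, the unique weak solution at $\lambda=\lambda^*_\alpha(N)$. The pull-in distance is $\|u^*_\alpha\|_{L^\infty}$. The decimals $0.789$ and $0.445$ are the values taken for $\lambda^*_0(2)$ and $\|u^*_0\|_{L^\infty}$ (constant profile $\alpha=0$, dimension $2$).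
   Formalization: The decimals 0.789 and 0.445 are read as the exact constants λ*_0(2) and ‖u*_0‖ in dimension 2, asserted to equal those decimals within 1/1000 (literal equality fails); in item 3, α ≥ 0 is required for 1 ≤ N ≤ 7 (the claim fails e.g. for N = 7, α = −1). *)

(* Defs.v *)
From mathcomp Require Import all_boot all_order all_algebra.
From mathcomp Require Import all_classical all_reals all_analysis.
Import Order.TTheory GRing.Theory Num.Theory numFieldNormedType.Exports.

Set Implicit Arguments.
Unset Strict Implicit.
Unset Printing Implicit Defensive.

Local Open Scope classical_set_scope.
Local Open Scope ring_scope.

Section MEMS.
Context {R : realType}.

Section Ball.
Variable N : nat.
Implicit Types (u v : 'rV[R]_N -> R) (x : 'rV[R]_N) (U : set 'rV[R]_N).

(* The library's norm on 'rV[R]_N is the sup norm; it induces the same topology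
   as the Euclidean norm, but the unit ball and |x|^alpha need the latter. *)
Definition enorm x : R := Num.sqrt (\sum_(i < N) x 0 i ^+ 2).

Definition uball : set 'rV[R]_N := [set x | enorm x < 1].
Definition cuball : set 'rV[R]_N := [set x | enorm x <= 1].
Definition usphere : set 'rV[R]_N := [set x | enorm x = 1].

Definition partial (i : 'I_N) u : 'rV[R]_N -> R :=
  fun x => 'D_(delta_mx 0 i) u x.

Definition laplacian u x : R := \sum_(i < N) partial i (partial i u) x.

(* Meant for open U. *)
Definition C2_on U u : Prop := forall x, U x ->
  [/\ {for x, continuous u},
      forall i, derivable u x (delta_mx 0 i) /\ {for x, continuous (partial i u)}
    & forall i j, derivable (partial i u) x (delta_mx 0 j) /\
        {for x, continuous (partial j (partial i u))}].

(* The L^oo norm on the ball.  It is only used for functions continuous on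
   the ball (or their pointwise limits), and is the supremum of the values;
   it is +oo for an unbounded function. *)
Definition Linfty u : \bar R := ereal_sup [set `|u x|%:E | x in uball].

(* Where |x|^alpha is finite: the ball, minus the origin if alpha < 0. *)
Definition mems_domain (alpha : R) : set 'rV[R]_N :=
  [set x | uball x /\ (alpha < 0 -> x != 0)].

(* For alpha < 0 the right-hand side blows up at the origin, where no solution
   is C^2; the equation is then read in the punctured ball.  As u is continuous
   on the whole ball, the origin is a removable singularity for the equation in
   the sense of distributions as soon as N >= 2.
   Recall that 0 `^ 0 = 1, so that |x|^0 is the constant profile 1. *)
Definition classical_solution (alpha lambda : R) u : Prop :=
  [/\ C2_on (mems_domain alpha) u,
      {within cuball, continuous u},
      forall x, mems_domain alpha x ->
        - laplacian u x = lambda * enorm x `^ alpha / (1 - u x) ^+ 2,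
      forall x, usphere x -> u x = 0
    & (Linfty u < 1)%E].

Definition minimal_solution (alpha lambda : R) u : Prop :=
  classical_solution alpha lambda u /\
  forall v, classical_solution alpha lambda v ->
    forall x, uball x -> u x <= v x.

End Ball.

Definition lambda_star (N : nat) (alpha : R) : R :=
  sup [set lambda | 0 < lambda /\
         exists u : 'rV[R]_N -> R, classical_solution alpha lambda u].

(* A minimal solution is unique on the closed ball, so that the choice made
   by get only concerns the irrelevant values outside of it. *)
Definition u_min (N : nat) (alpha lambda : R) : 'rV[R]_N -> R :=
  get [set u : 'rV[R]_N -> R | minimal_solution alpha lambda u].

Definition u_star (N : nat) (alpha : R) : 'rV[R]_N -> R :=
  fun x => lim (u_min alpha lambda x @[lambda --> (lambda_star N alpha)^'-]).

Definition pull_in_distance (N : nat) (alpha : R) : \bar R :=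
  Linfty (u_star (N := N) alpha).

Definition alpha_crit (N : nat) : R :=
  (3 * N%:R - 14 - 4 * Num.sqrt 6) / (4 + 2 * Num.sqrt 6).

End MEMS.

(* Main.v *)
Require Import Defs.
From mathcomp Require Import all_boot all_order all_algebra.
From mathcomp Require Import all_classical all_reals all_analysis.
From mathcomp Require Import ring lra.
Import Order.TTheory GRing.Theory Num.Theory numFieldNormedType.Exports.

(** The radial problem has a one-parameter family of explicit candidates.  Put
    mu := (N - 2) / (2 + alpha) and let H solve x H'' + (1 + mu) H' = H^-2 with
    H 0 = 1.  For b > 0, the function
      u_b(x) := 1 - H (b |x|^(2 + alpha)) / H b
    is a classical solution for lambda = (2 + alpha)^2 z b, where z x := x / H x^3
    ([rad_sol_classical]).  Thus N and alpha act on the problem only through mu,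
    up to the factor (2 + alpha)^2 and the change of variable |x|^(2 + alpha).

    No other solution matters.  A classical solution v for lambda lies above u_b
    as soon as (2 + alpha)^2 z < lambda on [0, b]: b is raised from 0 in small
    steps, and at each step the maximum principle restores a fixed gap between
    v and a slightly lowered u_b ([sliding], [rad_sol_le]).  Since H is
    unbounded, u_b 0 = 1 - 1 / H b tends to 1, so that lambda cannot exceed
    (2 + alpha)^2 sup z; this proves lambda_star = (2 + alpha)^2 sup z
    ([lambda_starE]).  The same comparison shows that u_b is the minimal
    solution as long as z increases on [0, b], and u_star is the limit of u_b
    along the increasing part of z ([rad_sol_minimal], [u_star_limit]).

    The shape of z is read off an autonomous planar system.  With p := x H' / H,
      x z' = z (1 - 3 p),   x p' = z - p^2 - mu p,
    and the trajectory leaves the origin towards the equilibrium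
    p = 1 / 3, z = (mu + 1 / 3) / 3.  The discriminant of the linearization there
    is (mu + 2 / 3)^2 - 4 (mu + 1 / 3), with largest root (4 + 2 sqrt 6) / 3;
    for alpha this is the value alpha_crit N.
    - Below that value p reaches 1 / 3 at a finite b ([crossing_exists]),
      typically because the trajectory winds around the equilibrium; a
      decreasing energy shows that z b is the maximum of z
      ([zz_le_crossing]).  Then
      u_star = u_b is classical, and its maximum is 1 - 1 / H b < 1.
    - From that value on a line through the equilibrium confines the trajectory
      ([no_crossing]): z increases to (mu + 1 / 3) / 3 without reaching it.
      Then b tends to infinity, and the relation between H and z gives
      H (b t) / H b -> t^(1 / 3), that is u_star = 1 - |x|^((2 + alpha) / 3)
      ([profile_scaling], [u_star_no_crossing]).

    In dimension 2 one has mu = 0 for every alpha, which is the exact scaling of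
    the second item; for fixed N, mu tends to 0 as alpha grows, and the first
    item is the continuity of sup z at mu = 0 ([zmax_continuous]).  The decimals
    come from polynomial barriers for the trajectory with mu = 0
    ([planar_bounds]). *)

Set Implicit Arguments.
Unset Strict Implicit.
Unset Printing Implicit Defensive.

Local Open Scope classical_set_scope.
Local Open Scope ring_scope.

(** * Calculus of one real variable *)

Section calculus.
Context {R : realType}.
Implicit Types (f g F : R -> R) (x y a b c d e : R).

Lemma is_deriveDf f g x a b : is_derive x 1 f a -> is_derive x 1 g b ->
  is_derive x 1 (fun t => f t + g t) (a + b).
Proof. by move=> fa gb; exact: is_deriveD. Qed.

Lemma is_deriveNf f x a : is_derive x 1 f a ->
  is_derive x 1 (fun t => - f t) (- a).
Proof. by move=> fa; exact: is_deriveN. Qed.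

Lemma is_deriveMf f g x a b : is_derive x 1 f a -> is_derive x 1 g b ->
  is_derive x 1 (fun t => f t * g t) (a * g x + f x * b).
Proof.
move=> fa gb; apply: (is_derive_eq (is_deriveM fa gb)).
by rewrite addrC mulrC.
Qed.

Lemma is_deriveVf f x a : f x != 0 -> is_derive x 1 f a ->
  is_derive x 1 (fun t => (f t)^-1) (- a / f x ^+ 2).
Proof.
move=> fx fa; apply: (is_derive_eq (is_deriveV fx fa)).
by rewrite scaleNr mulNr [_ *: _]mulrC.
Qed.

Lemma is_deriveXf f x a n : is_derive x 1 f a ->
  is_derive x 1 (fun t => f t ^+ n.+1) (n.+1%:R * f x ^+ n * a).
Proof.
by move=> fa; have := is_deriveX n.+1 fa; rewrite exprfctE.
Qed.

Lemma is_derive_compf f g x a b : is_derive (g x) 1 f a -> is_derive x 1 g b ->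
  is_derive x 1 (fun t => f (g t)) (a * b).
Proof. by move=> fa gb; exact: is_derive1_comp. Qed.

Lemma is_derive_cstf c x : is_derive x 1 (fun=> c) 0.
Proof. exact: is_derive_cst. Qed.

Lemma is_derive_idf x : is_derive x 1 (fun t => t) 1.
Proof. exact: is_derive_id. Qed.

Lemma is_derive_continuous f x a : is_derive x 1 f a -> continuous_at x f.
Proof.
by move=> [fd _]; apply: differentiable_continuous; exact/derivable1_diffP.
Qed.

Lemma is_derive_within f df a b :
  (forall x, a <= x <= b -> is_derive x 1 f (df x)) ->
  {within `[a, b], continuous f}.
Proof.
move=> fd; apply: derivable_within_continuous => x.
by rewrite in_itv /= => /fd[].
Qed.

Section continuity.
Variables (T : topologicalType) (u v : T -> R) (t : T).
Hypotheses (cu : continuous_at t u) (cv : continuous_at t v).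

Lemma cont_add : continuous_at t (fun s => u s + v s).
Proof. exact: cvgD. Qed.

Lemma cont_mul : continuous_at t (fun s => u s * v s).
Proof. exact: cvgM. Qed.

Lemma cont_opp : continuous_at t (fun s => - u s).
Proof. exact: cvgN. Qed.

Lemma cont_inv : u t != 0 -> continuous_at t (fun s => (u s)^-1).
Proof. by move=> ut; exact: cvgV. Qed.

Lemma cont_cst c : continuous_at t (fun=> c : R).
Proof. exact: cvg_cst. Qed.

Lemma cont_exp n : continuous_at t (fun s => u s ^+ n).
Proof.
elim: n => [|n IH].
  by have -> : (fun s => u s ^+ 0) = (fun=> 1) by []; exact: cvg_cst.
have -> : (fun s => u s ^+ n.+1) = (fun s => u s * u s ^+ n).
  by apply/funext => s; rewrite exprS.
exact: cvgM.
Qed.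

Lemma cont_comp f : continuous_at (u t) f ->
  continuous_at t (fun s => f (u s)).
Proof. by move=> cf; apply: continuous_comp. Qed.
End continuity.

Lemma derive_ge0_le f df a b : a <= b ->
  {within `[a, b], continuous f} ->
  (forall x, a < x < b -> is_derive x 1 f (df x)) ->
  (forall x, a < x < b -> 0 <= df x) -> f a <= f b.
Proof.
move=> ab cf fd df0; apply: (@ger0_derive1_ndecr _ f a b) => //.
- by move=> x; rewrite in_itv /= => /fd[].
- move=> x; rewrite in_itv /= => xab; rewrite derive1E.
  by have [_ ->] := fd _ xab; exact: df0.
Qed.

Lemma derive_le0_le f df a b : a <= b ->
  {within `[a, b], continuous f} ->
  (forall x, a < x < b -> is_derive x 1 f (df x)) ->
  (forall x, a < x < b -> df x <= 0) -> f b <= f a.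
Proof.
move=> ab cf fd df0; rewrite -lerN2.
apply: (@derive_ge0_le (fun t => - f t) (fun t => - df t)) => //.
- by move=> x; apply: continuousN; exact: cf.
- by move=> x /fd ?; exact: is_deriveNf.
- by move=> x /df0; rewrite oppr_ge0.
Qed.

Lemma derive_gt0_lt f df a b : a < b ->
  {within `[a, b], continuous f} ->
  (forall x, a < x < b -> is_derive x 1 f (df x)) ->
  (forall x, a < x < b -> 0 < df x) -> f a < f b.
Proof.
move=> ab cf fd df0.
have [c] := MVT ab (fun x (h : x \in `]a, b[) => fd x h) cf.
rewrite in_itv /= => cab /eqP.
by rewrite subr_eq => /eqP ->; rewrite ltrDr mulr_gt0 ?subr_gt0 ?df0.
Qed.

Lemma derive_itv_ge0_le f df a b : a <= b ->
  (forall x, a <= x <= b -> is_derive x 1 f (df x)) ->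
  (forall x, a < x < b -> 0 <= df x) -> f a <= f b.
Proof.
move=> ab fd; apply: derive_ge0_le => //; first exact: is_derive_within fd.
by move=> x /andP[/ltW ax /ltW xb]; apply: fd; rewrite ax.
Qed.

Lemma derive_itv_le0_le f df a b : a <= b ->
  (forall x, a <= x <= b -> is_derive x 1 f (df x)) ->
  (forall x, a < x < b -> df x <= 0) -> f b <= f a.
Proof.
move=> ab fd; apply: derive_le0_le => //; first exact: is_derive_within fd.
by move=> x /andP[/ltW ax /ltW xb]; apply: fd; rewrite ax.
Qed.

Lemma derive_itv_gt0_lt f df a b : a < b ->
  (forall x, a <= x <= b -> is_derive x 1 f (df x)) ->
  (forall x, a < x < b -> 0 < df x) -> f a < f b.
Proof.
move=> ab fd; apply: derive_gt0_lt => //; first exact: is_derive_within fd.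
by move=> x /andP[/ltW ax /ltW xb]; apply: fd; rewrite ax.
Qed.

(** Used with e x = C x for Lipschitz bounds and with e an exponential for
    Gronwall estimates. *)
Lemma derive_norm_le f df (e de : R -> R) a b : a <= b ->
  (forall x, a <= x <= b -> is_derive x 1 f (df x)) ->
  (forall x, a <= x <= b -> is_derive x 1 e (de x)) ->
  (forall x, a < x < b -> `|df x| <= de x) -> `|f b - f a| <= e b - e a.
Proof.
move=> ab fd ed dfe.
have l1 : f a + e a <= f b + e b.
  apply: (@derive_itv_ge0_le (fun t => f t + e t) (fun t => df t + de t)) => //.
  - by move=> x xab; apply: is_deriveDf; [exact: fd|exact: ed].
  - by move=> x /dfe; rewrite ler_norml => /andP[]; lra.
have l2 : e a - f a <= e b - f b.
  apply: (@derive_itv_ge0_le (fun t => e t - f t) (fun t => de t - df t)) => //.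
  - move=> x xab; apply: is_deriveDf; first exact: ed.
    by apply: is_deriveNf; exact: fd.
  - by move=> x /dfe; rewrite ler_norml => /andP[]; lra.
by rewrite ler_norml; apply/andP; split; lra.
Qed.

(** The differentiability at 0 is two-sided, because the integral starts
    at -1. *)
Lemma antiderivative f : continuous f ->
  exists2 F, F 0 = 0 & forall x, 0 <= x -> is_derive x 1 F (f x).
Proof.
move=> cf; pose mu := @lebesgue_measure R.
pose I y := (\int[mu]_(t in `[(-1)%R, y]) (f t))%R.
exists (fun y => I y - I 0) => [|x x0]; first by rewrite subrr.
have xu : x < x + 1 by rewrite ltrDl.
have intf : mu.-integrable `[(-1), (x + 1)] (EFin \o f).
  apply: continuous_compact_integrable; first exact: segment_compact.
  exact: continuous_subspaceT.
have ax : -1 < x by rewrite (lt_le_trans _ x0) ?ltrN10.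
have [dI Ix] := continuous_FTC1_closed xu intf ax (cf x).
have h : is_derive x 1 I (f x) by rewrite -Ix derive1E; exact: derivableP.
by rewrite -(addr0 (f x)); apply: is_deriveDf => //; exact: is_derive_cst.
Qed.

Lemma cont_eps f x e : continuous_at x f -> 0 < e ->
  exists2 d, 0 < d & forall y, `|x - y| < d -> `|f x - f y| < e.
Proof.
move=> /cvgrPdist_lt /(_ e) + e0 => /(_ e0) /nbhs_ballP[d /= d0 h].
by exists d => // y xy; exact: h.
Qed.

Lemma first_zero f a b : a <= b ->
  (forall x, a <= x <= b -> continuous_at x f) -> 0 < f a -> f b <= 0 ->
  exists2 c, a < c <= b & f c = 0 /\ forall x, a <= x < c -> 0 < f x.
Proof.
move=> ab cf fa fb; pose S := [set x | a <= x <= b /\ f x <= 0].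
have Sb : S b by split => //; rewrite ab lexx.
have Sinf : has_inf S.
  by split; [exists b|exists a => x [/andP[]]].
have lbS x : S x -> inf S <= x by apply: ge_inf; case: Sinf.
have cb : inf S <= b by exact: lbS.
have ac : a <= inf S by apply: lb_le_inf => [|x [/andP[]]//]; exists b.
set c := inf S in lbS cb ac *.
have pos x : a <= x < c -> 0 < f x.
  move=> /andP[ax xc]; rewrite ltNge; apply/negP => fx0.
  have : S x by split=> //; rewrite ax (le_trans (ltW xc)).
  by move=> /lbS; rewrite leNgt xc.
have cc : a <= c <= b by rewrite ac cb.
have fc0 : f c <= 0.
  rewrite leNgt; apply/negP => fc.
  have [d d0 hd] := cont_eps (cf _ cc) fc.
  have [x Sx xc] := inf_adherent d0 Sinf.
  have cx := lbS _ Sx.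
  have : `|c - x| < d by rewrite distrC ger0_norm ?subr_ge0 // ltrBlDl.
  by move=> /hd; case: Sx => _; rewrite ltr_norml => ? /andP[]; lra.
have {}ac : a < c.
  by rewrite lt_neqAle ac andbT; apply: contraTneq fa => ->; rewrite -leNgt.
exists c; first by rewrite ac cb.
split => //; apply/eqP; rewrite eq_le fc0 /= leNgt; apply/negP => fc.
have nfc : 0 < - f c by rewrite oppr_gt0.
have [d d0 hd] := cont_eps (cf _ cc) nfc.
pose x := Num.max a (c - d / 2).
have xc : x < c by rewrite /x gt_max ac ltrBlDr ltrDl divr_gt0.
have ax : a <= x by rewrite /x le_max lexx.
have : 0 < f x by apply: pos; rewrite ax xc.
have : `|c - x| < d.
  rewrite gtr0_norm ?subr_gt0// ltrBlDr -ltrBlDl /x lt_max; apply/orP; right.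
  by lra.
by move=> /hd; rewrite ltr_norml => /andP[]; lra.
Qed.

Lemma left_max_derive_ge0 f a b d : a < b ->
  (forall x, a <= x < b -> f x <= f b) -> is_derive b 1 f d -> 0 <= d.
Proof.
move=> ab fmax /is_derive1_caratheodory[g [fg cg <-]].
rewrite leNgt; apply/negP => gb.
have ngb : 0 < - g b by rewrite oppr_gt0.
have [e e0 he] := cont_eps cg ngb.
pose x := Num.max a (b - e / 2).
have xb : x < b by rewrite /x gt_max ab ltrBlDr ltrDl divr_gt0.
have ax : a <= x by rewrite /x le_max lexx.
have : `|b - x| < e.
  rewrite gtr0_norm ?subr_gt0// ltrBlDr -ltrBlDl /x lt_max; apply/orP; right.
  by lra.
move=> /he; rewrite ltr_norml => /andP[+ _].
have := fg x; have := fmax x; rewrite ax xb => /(_ isT).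
rewrite -subr_le0 => + e1; rewrite e1 => le1 lt2.
have gx : g x < 0 by lra.
by move: le1; rewrite leNgt nmulr_rgt0// subr_lt0 xb.
Qed.

(** At its first zero a function that was positive has a nonpositive
    derivative: it stays positive if its derivative is positive at each zero. *)
Lemma barrier f df a b : a <= b ->
  (forall x, a <= x <= b -> is_derive x 1 f (df x)) -> 0 < f a ->
  (forall x, a < x <= b -> f x = 0 -> (forall y, a <= y < x -> 0 < f y) ->
     0 < df x) -> 0 < f b.
Proof.
move=> ab fd fa hb; rewrite ltNge; apply/negP => fb.
have [c [/andP[ac cb] [fc0 fpos]]] :
    exists c, a < c <= b /\ f c = 0 /\ forall x, a <= x < c -> 0 < f x.
  have [c cab hc] := first_zero ab
    (fun x h => is_derive_continuous (fd x h)) fa fb.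
  by exists c.
have acb : a < c <= b by rewrite ac cb.
have := hb c acb fc0 fpos.
have dc : is_derive c 1 (fun t => - f t) (- df c).
  by apply: is_deriveNf; apply: fd; rewrite (ltW ac).
have := left_max_derive_ge0 ac _ dc; rewrite oppr_ge0 ltNge => -> //.
by move=> x /fpos; rewrite fc0 oppr0 oppr_le0; exact: ltW.
Qed.

End calculus.

(** Differentiates an expression down to its non-algebraic leaves. *)
Ltac deriv_rec :=
  cbv beta;
  lazymatch goal with
  | |- is_derive _ _ (fun _ => ?c) _ => notypeclasses refine (is_derive_cstf _ _)
  | |- is_derive _ _ (fun t => t) _ => notypeclasses refine (is_derive_idf _)
  | |- is_derive _ _ (fun t => @?f t + @?g t) _ =>
      notypeclasses refine (@is_deriveDf _ f g _ _ _ _ _); deriv_rec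
  | |- is_derive _ _ (fun t => - @?f t) _ =>
      notypeclasses refine (@is_deriveNf _ f _ _ _); deriv_rec
  | |- is_derive _ _ (fun t => @?f t * @?g t) _ =>
      notypeclasses refine (@is_deriveMf _ f g _ _ _ _ _); deriv_rec
  | |- is_derive _ _ (fun t => (@?f t)^-1) _ =>
      notypeclasses refine (@is_deriveVf _ f _ _ _ _); [|deriv_rec]
  | |- is_derive _ _ (fun t => @?f t ^+ _.+1) _ =>
      notypeclasses refine (@is_deriveXf _ f _ _ _ _); deriv_rec
  | |- _ => idtac
  end.
Ltac deriv := notypeclasses refine (is_derive_eq _ _); [deriv_rec|cbv beta].

(** Proves the continuity of an expression down to its non-algebraic
    leaves. *)
Ltac cont_rec :=
  cbv beta;
  lazymatch goal with
  | |- continuous_at _ (fun _ => ?c) => notypeclasses refine (@cont_cst _ _ _ c)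
  | |- continuous_at _ (fun t => @?f t + @?g t) =>
      notypeclasses refine (@cont_add _ _ f g _ _ _); cont_rec
  | |- continuous_at _ (fun t => - @?f t) =>
      notypeclasses refine (@cont_opp _ _ f _ _); cont_rec
  | |- continuous_at _ (fun t => @?f t * @?g t) =>
      notypeclasses refine (@cont_mul _ _ f g _ _ _); cont_rec
  | |- continuous_at _ (fun t => (@?f t)^-1) =>
      notypeclasses refine (@cont_inv _ _ f _ _ _); [cont_rec|]
  | |- continuous_at _ (fun t => @?f t ^+ _) =>
      notypeclasses refine (@cont_exp _ _ f _ _ _); cont_rec
  | |- _ => idtac
  end.

Section powers_and_averages.
Context {R : realType}.
Implicit Types (f g F G H : R -> R) (x y a b c d mu m M X p e C k : R).

Lemma powR_continuous_gt0 p x : 0 < x -> continuous_at x (@powR R ^~ p).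
Proof. by move=> x0; apply: is_derive_continuous; exact: is_derive1_powR. Qed.

Lemma norm_powR_continuous p : 0 < p -> continuous (fun x : R => `|x| `^ p).
Proof.
move=> p0 x; have [->|x0] := eqVneq x 0.
  apply/cvgrPdist_lt => e e0; rewrite normr0 powR0 ?gt_eqF//.
  apply/nbhs_ballP; exists (e `^ p^-1) => /=; first exact: powR_gt0.
  move=> y; rewrite /ball /= sub0r normrN => ye.
  rewrite sub0r normrN ger0_norm ?powR_ge0//.
  have -> : e = (e `^ p^-1) `^ p.
    by rewrite -powRrM mulVf ?gt_eqF// powRr1 // ltW.
  by apply: gt0_ltr_powR; rewrite ?nnegrE ?normr_ge0 ?powR_ge0.
apply: (@continuous_comp _ _ _ (fun x : R => `|x|) (@powR R ^~ p)).
  exact: norm_continuous.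
by apply: powR_continuous_gt0; rewrite normr_gt0.
Qed.

Lemma is_derive_powRf p x : 0 < x ->
  is_derive x 1 (fun t => t `^ p) (p * x `^ p / x).
Proof.
move=> x0; apply: (is_derive_eq (is_derive1_powR p x0)).
by rewrite powRB ?powRr1 ?ltW// ?mulrA// (gt_eqF x0) implybT.
Qed.

Lemma near_gt0_eq (f g : R -> R) x : 0 < x -> (forall t, 0 < t -> f t = g t) ->
  \near x, f x = g x.
Proof.
move=> x0 fg; near=> t; apply: fg; near: t; exact: lt_nbhsr.
Unshelve. all: by end_near. Qed.

(** The equation x f' + m f = psi says that m f is a weighted average of
    psi over [0, x], since (x^m (m f - M))' = m x^(m - 1) (psi - M). *)
Lemma average_le f psi m M X : 0 < m -> continuous_at 0 f ->
  (forall x, 0 < x <= X -> is_derive x 1 f ((psi x - m * f x) / x)) ->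
  (forall x, 0 < x <= X -> psi x <= M) -> 0 < X -> m * f X <= M.
Proof.
move=> m0 cf df psiM X0.
pose k x := `|x| `^ m * (m * f x - M).
have k0 : k 0 = 0 by rewrite /k normr0 powR0 ?gt_eqF// mul0r.
have dk x : 0 < x <= X ->
    is_derive x 1 k (m * x `^ m / x * (psi x - M)).
  move=> /[dup] xX /andP[x0 _].
  apply: (@near_eq_is_derive _ _ _ (fun t => t `^ m * (m * f t - M))).
    apply: near_gt0_eq => // t t0; by rewrite /k gtr0_norm.
  deriv; [exact: is_derive_powRf|exact: df|].
  by field; rewrite gt_eqF.
have := @derive_le0_le R k (fun x => m * x `^ m / x * (psi x - M)) 0 X (ltW X0).
have ck : {within `[0, X], continuous k}.
  apply: continuous_in_subspaceT => x; rewrite inE /= in_itv /= => /andP[x0 xX].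
  have [->|xn0] := eqVneq x 0.
    apply: cvgM; first exact: norm_powR_continuous.
    apply: cvgB; last exact: cvg_cst.
    by apply: cvgM; [exact: cvg_cst|exact: cf].
  by apply: is_derive_continuous; apply: dk; rewrite lt_neqAle eq_sym xn0 x0.
move=> /(_ ck); rewrite k0 /k => h.
have : `|X| `^ m * (m * f X - M) <= 0.
  apply: h => x /andP[x0 xX]; first by apply: dk; rewrite x0 ltW.
  apply: mulr_ge0_le0; last by rewrite subr_le0; apply: psiM; rewrite x0 ltW.
  by apply: divr_ge0; [apply: mulr_ge0; [exact: ltW|exact: powR_ge0]|exact: ltW].
by rewrite pmulr_rle0 ?powR_gt0 ?normr_gt0 ?gt_eqF// subr_le0.
Qed.

Lemma average_ge f psi m M X : 0 < m -> continuous_at 0 f ->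
  (forall x, 0 < x <= X -> is_derive x 1 f ((psi x - m * f x) / x)) ->
  (forall x, 0 < x <= X -> M <= psi x) -> 0 < X -> M <= m * f X.
Proof.
move=> m0 cf df psiM X0; rewrite -lerN2 -mulrN.
apply: (@average_le (fun t => - f t) (fun t => - psi t)) => //.
- by apply: cvgN; exact: cf.
- move=> x xX; apply: (is_derive_eq (is_deriveNf (df _ xX))).
  by rewrite -mulNr opprB mulrN opprK addrC.
- by move=> x /psiM; rewrite lerN2.
Qed.

(** The substitution t = x^m turns x G' + m G = phi into
    (t G)' = phi / m, which is integrated directly.  As G x is a difference
    quotient at 0 of this primitive, it is continuous up to x = 0. *)
Lemma linear_solution (phi : R -> R) m : 0 < m ->
  continuous (fun x => phi `|x|) ->
  exists G, [/\ continuous G, G 0 = phi 0 / m &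
    forall x, 0 < x -> is_derive x 1 G ((phi x - m * G x) / x)].
Proof.
move=> m0 cphi; pose p := m^-1.
have p0 : 0 < p by rewrite invr_gt0.
have cf : continuous (fun s : R => phi (`|s| `^ p) / m).
  move=> s. apply: cont_mul; last exact: cont_cst.
  have -> : (fun s : R => phi (`|s| `^ p)) = (fun x : R => phi `|x|) \o (fun s : R => `|s| `^ p).
    by apply/funext => t /=; rewrite (ger0_norm (powR_ge0 _ _)).
  by apply: continuous_comp; [exact: norm_powR_continuous|exact: cphi].
have [K K0 dK] := antiderivative cf.
have /is_derive1_caratheodory [h [hK ch h0]] := dK 0 (lexx 0).
have {}hK (z : R) : K z = h z * z by have := hK z; rewrite K0 !subr0.
have {}h0 : h 0 = phi 0 / m by rewrite h0 normr0 powR0 // gt_eqF.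
have ch' (z : R) : 0 <= z -> continuous_at z h.
  rewrite le_eqVlt => /orP[/eqP <-//|z0].
  have -> : continuous_at z h = continuous_at z (fun t => K t / t).
    rewrite /continuous_at.
    have -> : h z = K z / z by rewrite hK mulfK ?gt_eqF.
    apply/propext; split; apply: cvg_trans; apply: near_eq_cvg;
      apply: near_gt0_eq => // t t0; by rewrite hK mulfK ?gt_eqF.
  apply: cvgM.
    by apply: (is_derive_continuous (dK z _)); exact: ltW.
  by apply: cvgV; [rewrite gt_eqF|exact: cvg_id].
pose G x := h (`|Num.max x 0| `^ m).
have GE x : 0 < x -> G x = K (x `^ m) / (x `^ m).
  move=> x0; rewrite /G max_l ?ltW// gtr0_norm// hK mulfK//.
  by rewrite gt_eqF ?powR_gt0.
exists G; split.
- move=> x; apply: (@continuous_comp _ _ _ (fun x : R => `|Num.max x 0| `^ m) h).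
    apply: (@continuous_comp _ _ _ (fun x : R => Num.max x 0) (fun x : R => `|x| `^ m)).
      by apply: continuous_max; [exact: cvg_id|exact: cvg_cst].
    exact: norm_powR_continuous.
  by apply: ch'; exact: powR_ge0.
- by rewrite /G maxxx normr0 powR0 ?gt_eqF.
move=> x x0.
have xm0 : 0 < x `^ m by exact: powR_gt0.
rewrite GE //.
apply: (@near_eq_is_derive _ _ _ (fun x => K (x `^ m) * (x `^ m)^-1)).
  by apply: near_gt0_eq => // t /GE.
have dm := is_derive_powRf m x0.
have dKm := @is_derive_compf R K (@powR R ^~ m) x _ _ (dK _ (ltW xm0)) dm.
deriv; [exact: dKm|by rewrite gt_eqF|exact: dm|].
rewrite (ger0_norm (powR_ge0 _ _)) -powRrM mulfV ?gt_eqF// powRr1 ?ltW//.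
by field; rewrite !gt_eqF.
Qed.

(** The corrected sequences u n - 2 C / 2^n and u n + 2 C / 2^n are
    monotone and squeeze the limit; the explicit rate serves to pass to the
    limit in inequalities, by [le_geometric]. *)
Lemma geometric_limit (u : nat -> R) C :
  (forall n, `|u n.+1 - u n| <= C / 2 ^+ n) ->
  exists L, forall n, `|L - u n| <= 2 * C / 2 ^+ n.
Proof.
move=> du.
have e2 n : C / 2 ^+ n = 2 * C / 2 ^+ n - 2 * C / 2 ^+ n.+1.
  by rewrite exprS; field; rewrite expf_neq0.
have C0 n : 0 <= 2 * C / 2 ^+ n.
  rewrite divr_ge0 ?exprn_ge0// mulr_ge0//.
  by have := le_trans (normr_ge0 _) (du 0%N); rewrite expr0 divr1.
pose a n := u n - 2 * C / 2 ^+ n; pose b n := u n + 2 * C / 2 ^+ n.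
have amono n : a n <= a n.+1.
  by have := du n; rewrite ler_norml /a => /andP[]; have := e2 n; lra.
have bmono n : b n.+1 <= b n.
  by have := du n; rewrite ler_norml /b => /andP[_]; have := e2 n; lra.
have ahomo (m n : nat) : (m <= n)%N -> a m <= a n.
  by move=> mn; apply: (homo_leq (@lexx _ _) (@le_trans _ _)) mn.
have bhomo (m n : nat) : (m <= n)%N -> b n <= b m.
  move=> mn; apply: (homo_leq (r := fun x y => y <= x)) mn => //.
  by move=> x y z yx zy; exact: le_trans yx.
have ab (m n : nat) : a m <= b n.
  apply: (le_trans (ahomo _ _ (leq_maxl m n))).
  apply: le_trans (bhomo _ _ (leq_maxr m n)).
  by rewrite /a /b; have := C0 (maxn m n); lra.
have Asup : has_sup (range a).
  by split; [exists (a 0%N), 0%N|exists (b 0%N) => _ [n _ <-]].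
exists (sup (range a)) => n.
have l1 : a n <= sup (range a) by apply: sup_upper_bound => //; exists n.
have l2 : sup (range a) <= b n.
  by apply: ge_sup => [|_ [k _ <-]//]; case: Asup.
by rewrite ler_norml; apply/andP; split; move: l1 l2; rewrite /a /b; lra.
Qed.

Lemma le_geometric a b C : (forall n, a <= b + C / 2 ^+ n) -> a <= b.
Proof.
move=> h; apply/ler_addgt0Pr => e e0.
have C1 : 0 < `|C| + 1 by rewrite ltr_wpDl.
have [n _ hn] := near_infty_natSinv_expn_lt (PosNum (divr_gt0 e0 C1)).
have /= := hn n (leqnn n); rewrite div1r ltr_pdivlMr// => {}hn.
apply: (le_trans (h n)); rewrite lerD2l.
have i0 : 0 < (2 ^+ n)^-1 :> R by rewrite invr_gt0 exprn_gt0.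
have := ler_norm C; rewrite -(ler_pM2r i0) => Cn.
by move: hn; rewrite mulrDr mulr1 [_ * `|C|]mulrC; lra.
Qed.

End powers_and_averages.

(** * The profile of the radial problem *)

Section picard.
Context {R : realType}.
Implicit Types (f g F G H : R -> R) (x y a b c d mu m M X p e C k : R).

(** The initial value problem x H'' + (1 + mu) H' = H^-2, H 0 = 1, with H' =
    G.  The slope at 0 is the only one compatible with a bounded G. *)
Record profile mu H G : Prop := Profile {
  profile0 : H 0 = 1;
  profile_derive : forall x, 0 <= x -> is_derive x 1 H (G x);
  profile_cont : continuous G;
  profile_slope0 : G 0 = (1 + mu)^-1;
  profile_eq : forall x, 0 < x ->
    is_derive x 1 G ((H x ^- 2 - (1 + mu) * G x) / x) }.

Let admissible f :=
  [/\ f 0 = 1, continuous (fun x => f `|x|) & forall x, 0 <= x -> 1 <= f x].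

Let solves m f (FG : (R -> R) * (R -> R)) :=
  [/\ FG.1 0 = 1, forall x, 0 <= x -> is_derive x 1 FG.1 (FG.2 x),
    continuous FG.2, FG.2 0 = m^-1 &
    forall x, 0 < x -> is_derive x 1 FG.2 ((f x ^- 2 - m * FG.2 x) / x)].

Lemma invsq_le1 a : 1 <= a -> a ^- 2 <= 1.
Proof. by move=> a1; rewrite invf_le1 ?exprn_ege1// exprn_gt0// (lt_le_trans _ a1). Qed.

Lemma invsq_le a b : 0 < a -> a <= b -> b ^- 2 <= a ^- 2.
Proof.
move=> a0 ab; have b0 := lt_le_trans a0 ab.
by rewrite lef_pV2 ?posrE ?exprn_gt0// lerXn2r ?nnegrE ?(ltW a0) ?(ltW b0).
Qed.

Lemma invsq_lip a b : 1 <= a -> 1 <= b -> `|a ^- 2 - b ^- 2| <= 2 * `|a - b|.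
Proof.
move=> a1 b1.
have a0 : 0 < a by rewrite (lt_le_trans _ a1).
have b0 : 0 < b by rewrite (lt_le_trans _ b1).
have -> : a ^- 2 - b ^- 2 = (a^-1 * b ^- 2 + a ^- 2 * b^-1) * (b - a).
  by field; rewrite !gt_eqF.
rewrite normrM (distrC b) ler_wpM2r// ger0_norm; last first.
  by rewrite addr_ge0 // mulr_ge0 // invr_ge0 ?exprn_ge0 // ltW.
have ia : a^-1 <= 1 by rewrite invf_le1.
have ib : b^-1 <= 1 by rewrite invf_le1.
have ia0 : 0 <= a^-1 by rewrite invr_ge0 ltW.
have ib0 : 0 <= b^-1 by rewrite invr_ge0 ltW.
have := invsq_le1 a1; have := invsq_le1 b1 => h1 h2.
by rewrite -[2]/(1 + 1) lerD // mulr_ile1 // invr_ge0 exprn_ge0 // ltW.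
Qed.

Lemma solve_exists m f : 0 < m -> admissible f -> exists FG, solves m f FG.
Proof.
move=> m0 [f0 cf f1].
have cphi : continuous (fun x => f `|x| ^- 2).
  move=> x; apply: cont_inv; last first.
    by rewrite expf_neq0// gt_eqF// (lt_le_trans ltr01)// f1.
  by apply: cont_exp; exact: cf.
have [G [cG G0 dG]] := @linear_solution R (fun x => f x ^- 2) m m0 cphi.
have [K K0 dK] := antiderivative cG.
exists (fun x => K x + 1, G); split => //=.
- by rewrite K0 add0r.
- by move=> x x0; deriv; [exact: dK|rewrite addr0].
- by rewrite G0 f0 expr1n invr1 div1r.
Qed.

Lemma solves_slope m f FG x : 0 < m -> (forall x, 0 <= x -> 1 <= f x) ->
  solves m f FG -> 0 < x -> 0 <= FG.2 x <= m^-1.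
Proof.
move=> m0 f1 [_ _ cG _ dG] x0; apply/andP; split.
  rewrite -(pmulr_rge0 _ m0).
  apply: (@average_ge _ FG.2 (fun x => f x ^- 2) m 0 x m0 (cG 0) _ _ x0).
  - by move=> y /andP[y0 _]; exact: dG.
  - by move=> y /andP[y0 _]; rewrite invr_ge0 exprn_ge0// (le_trans _ (f1 _ (ltW y0))).
rewrite -(ler_pM2l m0) mulfV ?gt_eqF//.
apply: (@average_le _ FG.2 (fun x => f x ^- 2) m 1 x m0 (cG 0) _ _ x0).
- by move=> y /andP[y0 _]; exact: dG.
- by move=> y /andP[y0 _]; apply: invsq_le1; exact: f1 (ltW y0).
Qed.

Lemma solves_lip m f FG x y : 0 < m -> (forall x, 0 <= x -> 1 <= f x) ->
  solves m f FG -> 0 <= x -> x <= y -> 0 <= FG.1 y - FG.1 x <= m^-1 * (y - x).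
Proof.
move=> m0 f1 sol x0 xy; have [_ dF _ _ _] := sol.
have pos t : x < t < y -> 0 < t by move=> /andP[xt _]; exact: le_lt_trans xt.
have dF' t : x <= t <= y -> is_derive t 1 FG.1 (FG.2 t).
  by move=> /andP[xt _]; apply: dF; exact: le_trans xt.
apply/andP; split.
  rewrite subr_ge0; apply: (derive_itv_ge0_le xy dF') => t /pos t0.
  by have /andP[] := solves_slope m0 f1 sol t0.
have := @derive_norm_le R FG.1 FG.2 (fun t => m^-1 * t) (fun=> m^-1) x y xy dF'.
rewrite -mulrBr => h; apply: le_trans (ler_norm _) _; apply: h.
- by move=> t _; deriv; rewrite mul0r add0r mulr1.
- move=> t /pos t0; have /andP[g0 g1] := solves_slope m0 f1 sol t0.
  by rewrite ger0_norm.
Qed.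

Lemma solves_admissible m f FG : 0 < m -> (forall x, 0 <= x -> 1 <= f x) ->
  solves m f FG -> admissible FG.1.
Proof.
move=> m0 f1 sol; have [F0 dF _ _ _] := sol; split => //.
- move=> x; apply: (@cont_comp _ _ (fun x : R => `|x|)).
    exact: norm_continuous.
  by apply: (is_derive_continuous (dF _ _)).
- move=> x x0; rewrite -F0 -subr_ge0.
  by have /andP[] := solves_lip m0 f1 sol (lexx 0) x0.
Qed.

(** Freezing H in the right-hand side gives a linear equation, and
    its solution operator halves distances in the supremum norm with weight
    exp (- 4 x / m): the difference of the slopes is a weighted average of the
    difference of the right-hand sides, and one integration of
    exp (4 x / m) gains the factor m / 4. *)
Lemma solves_contract m f g FG FG' C : 0 < m ->
  (forall x, 0 <= x -> 1 <= f x) -> (forall x, 0 <= x -> 1 <= g x) ->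
  solves m f FG -> solves m g FG' ->
  (forall x, 0 <= x -> `|f x - g x| <= C * expR (4 / m * x)) ->
  forall x, 0 <= x -> `|FG.1 x - FG'.1 x| <= C / 2 * expR (4 / m * x).
Proof.
move=> m0 f1 g1 [F0 dF cG _ dG] [F0' dF' cG' _ dG'] fg x x0.
have C0 : 0 <= C.
  by have := le_trans (normr_ge0 _) (fg 0 (lexx 0)); rewrite mulr0 expR0 mulr1.
pose D t := FG.1 t - FG'.1 t; pose dD t := FG.2 t - FG'.2 t.
have e_mono t y : t <= y -> C * expR (4 / m * t) <= C * expR (4 / m * y).
  move=> ty; rewrite ler_wpM2l// ler_expR ler_wpM2l//.
  by rewrite divr_ge0// ltW.
have slope y : 0 < y -> `|dD y| <= 2 * C / m * expR (4 / m * y).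
  move=> y0.
  have dDD t : 0 < t <= y ->
      is_derive t 1 dD ((f t ^- 2 - g t ^- 2 - m * dD t) / t).
    move=> /andP[t0 _]; rewrite /dD; deriv; [exact: dG|exact: dG'|].
    by rewrite -mulrBl; congr (_ / _); ring.
  have cD : continuous_at 0 dD.
    by apply: cont_add; [exact: cG|apply: cont_opp; exact: cG'].
  have bnd t : 0 < t <= y ->
      `|f t ^- 2 - g t ^- 2| <= 2 * (C * expR (4 / m * y)).
    move=> /andP[/ltW t0 ty].
    apply: (le_trans (invsq_lip (f1 _ t0) (g1 _ t0))).
    by rewrite ler_wpM2l // (le_trans (fg _ t0))// e_mono.
  have l1 : m * dD y <= 2 * (C * expR (4 / m * y)).
    apply: (average_le m0 cD dDD) => // t /bnd; exact: le_trans (ler_norm _).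
  have l2 : - (2 * (C * expR (4 / m * y))) <= m * dD y.
    by apply: (average_ge m0 cD dDD) => // t /bnd; rewrite ler_norml => /andP[].
  have -> : 2 * C / m * expR (4 / m * y) = (2 * (C * expR (4 / m * y))) / m.
    by field; rewrite gt_eqF.
  rewrite ler_pdivlMr// mulrC -[X in X * _](gtr0_norm m0) -normrM.
  by rewrite ler_norml l2 l1.
have -> : FG.1 x - FG'.1 x = D x - D 0 by rewrite /D F0 F0' subrr subr0.
have := @derive_norm_le R D dD (fun t => C / 2 * expR (4 / m * t))
  (fun t => 2 * C / m * expR (4 / m * t)) 0 x x0.
move=> h; apply: (le_trans (h _ _ _)).
- move=> t /andP[t0 _]; rewrite /D; deriv; [exact: dF|exact: dF'|by []].
- move=> t _.
  have de : is_derive t 1 (fun t => expR (4 / m * t)) (expR (4 / m * t) * (4 / m)).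
    apply: (@is_derive_compf _ expR (fun t => 4 / m * t)) => //.
    by deriv; rewrite mul0r add0r mulr1.
  by deriv; [exact: de|field; rewrite gt_eqF].
- by move=> t /andP[t0 _]; exact: slope.
by rewrite lerBlDr lerDl mulr_ge0 ?divr_ge0// expR_ge0.
Qed.

(** Picard iteration from the constant 1, with the weighted norm of
    [solves_contract]; the limit is a fixed point because both it and its image
    are within geometrically small distance of the iterates. *)
Theorem profile_exists mu : -1 < mu -> exists H G, profile mu H G.
Proof.
move=> mu1; pose m := 1 + mu.
have m0 : 0 < m by rewrite /m; lra.
have /choice[T hT] : forall f, exists FG, admissible f -> solves m f FG.
  move=> f; have [af|naf] := pselect (admissible f); last by exists (f, f).
  by have [FG h] := solve_exists m0 af; exists FG.
pose u n := iter n (fun f => (T f).1) (fun=> 1).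
have adm n : admissible (u n).
  elim: n => [|n IH].
    by split => // x; exact: cont_cst.
  have [_ _ g1] := IH.
  exact: solves_admissible m0 g1 (hT _ IH).
have ge1 n x : 0 <= x -> 1 <= u n x by move=> x0; have [_ _] := adm n; apply.
have du n x : 0 <= x -> `|u n.+1 x - u n x| <= (2 ^+ n)^-1 * expR (4 / m * x).
  elim: n x => [|n IH] x x0.
    rewrite expr0 invr1 mul1r.
    have := solves_lip m0 (ge1 0%N) (hT _ (adm 0%N)) (lexx 0) x0.
    have [-> _ _ _ _] := hT _ (adm 0%N).
    rewrite subr0 => /andP[l1 l2]; rewrite /= ger0_norm//.
    apply: (le_trans l2); apply: le_trans (expR_ge1Dx _).
    have : 0 <= m^-1 * x by rewrite mulr_ge0// invr_ge0 ltW.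
    by rewrite mulrAC -mulrA; lra.
  rewrite exprS invfM [2^-1 * _]mulrC.
  exact: (solves_contract m0 (ge1 n.+1) (ge1 n) (hT _ (adm _)) (hT _ (adm _)) IH).
have lim_ex x : exists L, 0 <= x ->
    forall n, `|L - u n x| <= 2 * expR (4 / m * x) / 2 ^+ n.
  have [x0|x0] := leP 0 x; last by exists 0.
  have [n|L hL] := @geometric_limit R (u^~ x) (expR (4 / m * x)).
    by rewrite mulrC; exact: du.
  by exists L.
have [f hf] := choice lim_ex.
have fle a n : 0 <= a -> u n a <= f a + 2 * expR (4 / m * a) / 2 ^+ n.
  by move=> a0; have := hf a a0 n; rewrite ler_norml => /andP[]; lra.
have fge a n : 0 <= a -> f a <= u n a + 2 * expR (4 / m * a) / 2 ^+ n.
  by move=> a0; have := hf a a0 n; rewrite ler_norml => /andP[]; lra.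
have f1 x : 0 <= x -> 1 <= f x.
  move=> x0; apply: (@le_geometric _ _ _ (2 * expR (4 / m * x))) => n.
  exact: le_trans (ge1 n x x0) (fle _ _ x0).
have flip x y : 0 <= x -> x <= y -> `|f y - f x| <= m^-1 * (y - x).
  move=> x0 xy; have y0 := le_trans x0 xy.
  apply: (@le_geometric _ _ _ (2 * expR (4 / m * x) + 2 * expR (4 / m * y))).
  move=> n; have [_ _ ge] := adm n.
  have lip : 0 <= u n y - u n x <= m^-1 * (y - x).
    case: n {ge} => [|n]; last exact: solves_lip m0 (ge1 n) (hT _ (adm n)) x0 xy.
    by rewrite /= subrr lexx mulr_ge0 ?subr_ge0// invr_ge0 ltW.
  have := fle x n x0; have := fge x n x0; have := fle y n y0; have := fge y n y0.
  rewrite mulrDl ler_norml; move: lip => /andP[] *; apply/andP; split; lra.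
have f0 : f 0 = 1.
  have u0 n : u n 0 = 1 by have [] := adm n.
  apply/eqP; rewrite eq_le; apply/andP; split;
    apply: (@le_geometric _ _ _ (2 * expR (4 / m * 0))) => n.
    by have := fge 0 n (lexx 0); rewrite u0.
  by have := fle 0 n (lexx 0); rewrite u0.
have cf : continuous (fun x => f `|x|).
  move=> x; apply/cvgrPdist_lt => e e0.
  apply/nbhs_ballP; exists (m * e) => /=; first exact: mulr_gt0.
  move=> y; rewrite /ball /= => xy.
  have key a b : 0 <= a -> 0 <= b -> `|f a - f b| <= m^-1 * `|a - b|.
    move=> a0 b0; have [ab|/ltW ba] := leP a b.
      by rewrite distrC [`|a - b|]distrC [`|b - a|]ger0_norm ?subr_ge0// flip.
    by rewrite [`|a - b|]ger0_norm ?subr_ge0// flip.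
  apply: (le_lt_trans (key _ _ (normr_ge0 _) (normr_ge0 _))).
  rewrite mulrC ltr_pdivrMr// mulrC.
  exact: le_lt_trans (ler_dist_dist _ _) xy.
have af : admissible f by split.
have sol := hT _ af.
have [F0 dF cG G0 dG] := sol.
have Ff x : 0 <= x -> (T f).1 x = f x.
  move=> x0; apply/eqP; rewrite -subr_eq0 -normr_le0.
  apply: (@le_geometric _ _ _ (3 * expR (4 / m * x))) => n; rewrite add0r.
  have hu t : 0 <= t -> `|f t - u n t| <= 2 / 2 ^+ n * expR (4 / m * t).
    by move=> t0; have := hf t t0 n; rewrite mulrAC.
  have := solves_contract m0 f1 (ge1 n) sol (hT _ (adm n)) hu x0.
  rewrite -[(T (u n)).1]/(u n.+1) => h1.
  have := hf x x0 n.+1; rewrite distrC exprS invfM => h2.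
  have := ler_distD (u n.+1 x) ((T f).1 x) (f x).
  have : 0 <= expR (4 / m * x) * (2 ^+ n)^-1.
    by rewrite mulr_ge0 ?expR_ge0// invr_ge0 exprn_ge0.
  move: h1 h2; move: (expR _) ((2 ^+ n)^-1) => E i.
  by move=> h1 h2 Ei h3; apply: (le_trans h3); lra.
exists (T f).1, (T f).2; split => //.
by move=> x x0; rewrite Ff ?ltW//; exact: dG.
Qed.
End picard.

Section phase_plane.
Context {R : realType}.
Variables (mu : R) (H G : R -> R).
Hypotheses (mu1 : -1 < mu) (prof : profile mu H G).
Implicit Types (x y a b c e t r : R).

Let m0 : 0 < 1 + mu. Proof. by have := mu1; lra. Qed.

Lemma slope_ge0 x : 0 <= x -> 0 <= G x.
Proof.
rewrite le_eqVlt => /orP[/eqP <-|x0].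
  by rewrite (profile_slope0 prof) invr_ge0 ltW.
rewrite -(pmulr_rge0 _ m0).
apply: (@average_ge _ G (fun y => H y ^- 2) _ _ x m0 (@profile_cont _ _ _ _ prof 0) _ _ x0).
  by move=> y /andP[y0 _]; exact: (profile_eq prof).
by move=> y /andP[y0 _]; rewrite invr_ge0 exprn_even_ge0.
Qed.

Lemma profile_le x y : 0 <= x -> x <= y -> H x <= H y.
Proof.
move=> x0 xy; apply: (@derive_itv_ge0_le _ H G) => //.
  by move=> t /andP[xt _]; apply: (profile_derive prof); exact: le_trans xt.
by move=> t /andP[xt _]; apply: slope_ge0; rewrite (le_trans x0)// ltW.
Qed.

Lemma profile_ge1 x : 0 <= x -> 1 <= H x.
Proof. by move=> x0; rewrite -(profile0 prof); exact: profile_le. Qed.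

Lemma profile_gt0 x : 0 <= x -> 0 < H x.
Proof. by move=> /profile_ge1; exact: lt_le_trans. Qed.

Lemma slope_ge x : 0 <= x -> H x ^- 2 <= (1 + mu) * G x.
Proof.
rewrite le_eqVlt => /orP[/eqP <-|x0].
  by rewrite (profile_slope0 prof) (profile0 prof) expr1n invr1 mulfV// gt_eqF.
apply: (@average_ge _ G (fun y => H y ^- 2) _ _ x m0 (@profile_cont _ _ _ _ prof 0) _ _ x0).
  by move=> y /andP[y0 _]; exact: (profile_eq prof).
move=> y /andP[y0 yx].
have y0' := ltW y0.
by apply: invsq_le; [exact: profile_gt0|exact: profile_le].
Qed.

Lemma slope_le x : 0 <= x -> (1 + mu) * G x <= 1.
Proof.
rewrite le_eqVlt => /orP[/eqP <-|x0].
  by rewrite (profile_slope0 prof) mulfV// gt_eqF.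
apply: (@average_le _ G (fun y => H y ^- 2) _ _ x m0 (@profile_cont _ _ _ _ prof 0) _ _ x0).
  by move=> y /andP[y0 _]; exact: (profile_eq prof).
by move=> y /andP[y0 _]; apply: invsq_le1; exact: profile_ge1 (ltW y0).
Qed.

Lemma slope_gt0 x : 0 <= x -> 0 < G x.
Proof.
move=> x0; rewrite -(pmulr_rgt0 _ m0); apply: lt_le_trans (slope_ge x0).
by rewrite invr_gt0 exprn_gt0// profile_gt0.
Qed.

Lemma profile_lip x y : 0 <= x -> x <= y ->
  H y - H x <= (1 + mu)^-1 * (y - x).
Proof.
move=> x0 xy; apply: le_trans (ler_norm _) _; rewrite mulrBr.
apply: (@derive_norm_le _ H G (fun t => (1 + mu)^-1 * t) (fun=> (1 + mu)^-1)) => //.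
- by move=> t /andP[xt _]; apply: (profile_derive prof); exact: le_trans xt.
- by move=> t _; deriv; rewrite mul0r add0r mulr1.
- move=> t /andP[/ltW xt _]; have t0 := le_trans x0 xt.
  by rewrite ger0_norm ?slope_ge0// -[leRHS]mulr1 ler_pdivlMl// slope_le.
Qed.

(** If H stayed below M, its slope would stay above M^-2 / (1 + mu)
    by [slope_ge]. *)
Lemma profile_unbounded M : exists2 x, 0 < x & M < H x.
Proof.
apply/not_exists2P => h.
have hM x : 0 < x -> H x <= M.
  by move=> x0; have [//|/negP] := h x; rewrite -leNgt.
have M0 : 0 < M by apply: lt_le_trans (hM 1 ltr01); exact: profile_gt0.
pose x := (1 + mu) * M ^+ 3.
have x0 : 0 < x by rewrite mulr_gt0// exprn_gt0.
have Mm : 0 < M ^+ 2 by rewrite exprn_gt0.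
have := @derive_norm_le _ (fun t => (1 + mu)^-1 * M ^- 2 * t)
  (fun=> (1 + mu)^-1 * M ^- 2) H G 0 x (ltW x0).
have e1 : (1 + mu)^-1 * M ^- 2 * x = M.
  by rewrite /x; field; rewrite !gt_eqF.
rewrite e1 mulr0 subr0 (profile0 prof) => k.
have : M <= H x - 1.
  rewrite -[leLHS](gtr0_norm M0); apply: k => [t _|t /andP[t0 _]|t /andP[t0 _]].
  - by deriv; rewrite mul0r add0r mulr1.
  - exact: (profile_derive prof).
  rewrite gtr0_norm ?divr_gt0 ?invr_gt0//.
  rewrite ler_pdivrMl//; apply: le_trans (slope_ge (ltW t0)).
  by apply: invsq_le; [exact: profile_gt0 (ltW t0)|exact: hM].
by have := hM x x0; lra.
Qed.

(** Phase-plane coordinates: up to the factor (2 + alpha)^2, zz b is the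
    parameter lambda of the solution built from b, and pp is the logarithmic
    slope of H. *)
Definition zz x := x / H x ^+ 3.
Definition pp x := x * G x / H x.

Let Hn0 x : 0 <= x -> H x != 0. Proof. by move=> /profile_gt0/lt0r_neq0. Qed.

Lemma zz_derive x : 0 < x -> is_derive x 1 zz (zz x * (1 - 3 * pp x) / x).
Proof.
move=> x0; have x0' := ltW x0; rewrite /zz.
deriv; [by rewrite expf_neq0 ?Hn0|exact: (profile_derive prof)|].
by rewrite /pp; field; rewrite Hn0// gt_eqF.
Qed.

Lemma pp_derive x : 0 < x ->
  is_derive x 1 pp ((zz x - pp x ^+ 2 - mu * pp x) / x).
Proof.
move=> x0; have x0' := ltW x0; rewrite /pp.
deriv; [exact: (profile_eq prof)|by rewrite Hn0|exact: (profile_derive prof)|].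
by rewrite /zz; field; rewrite Hn0// gt_eqF.
Qed.

Lemma zz_gt0 x : 0 < x -> 0 < zz x.
Proof. by move=> x0; rewrite divr_gt0// exprn_gt0// profile_gt0// ltW. Qed.

Lemma pp_gt0 x : 0 < x -> 0 < pp x.
Proof.
move=> x0; have x0' := ltW x0.
by rewrite divr_gt0 ?profile_gt0// mulr_gt0// slope_gt0.
Qed.

Lemma zz_le x : 0 <= x -> zz x <= x.
Proof.
move=> x0; rewrite ler_pdivrMr ?exprn_gt0 ?profile_gt0//.
by rewrite ler_peMr// exprn_ege1// profile_ge1.
Qed.

Lemma pp_le x : 0 <= x -> (1 + mu) * pp x <= x.
Proof.
move=> x0; rewrite /pp !mulrA ler_pdivrMr ?profile_gt0//.
apply: (@le_trans _ _ x); last by rewrite ler_peMr// profile_ge1.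
by rewrite mulrAC ler_piMl// slope_le.
Qed.

End phase_plane.

(** * The trajectory in the phase plane *)

Section trajectory.
Context {R : realType}.
Variables (mu : R) (H G : R -> R).
Hypotheses (mu1 : -1 < mu) (prof : profile mu H G).
Implicit Types (x y a b c e t r : R).

Local Notation z := (zz H).
Local Notation p := (pp H G).

Let dz x (x0 : 0 < x) := zz_derive mu1 prof x0.
Let dp x (x0 : 0 < x) := pp_derive mu1 prof x0.
Let z_gt0 x (x0 : 0 < x) := zz_gt0 mu1 prof x0.
Let p_gt0 x (x0 : 0 < x) := pp_gt0 mu1 prof x0.

(** The trajectory starts at the origin. *)
Lemma phase_near0 e : 0 < e -> exists2 x0, 0 < x0 &
  forall x, 0 < x <= x0 -> z x < e /\ p x < e.
Proof.
move=> e0; pose a := Num.min 1 (1 + mu).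
have a0 : 0 < a by rewrite /a lt_min ltr01 /=; have := mu1; lra.
exists (a * e / 2) => [|x /andP[x0 xe]]; first by rewrite divr_gt0 ?mulr_gt0.
have a1 : a <= 1 by rewrite /a ge_min lexx.
have am : a <= 1 + mu by rewrite /a ge_min lexx orbT.
have ae : a * e <= e by rewrite ler_piMl// ltW.
split; first by apply: le_lt_trans (zz_le mu1 prof (ltW x0)) _; lra.
rewrite -(ltr_pM2l a0).
have := pp_le mu1 prof (ltW x0).
have : a * p x <= (1 + mu) * p x by rewrite ler_wpM2r// ltW// p_gt0.
have : 0 < a * e by exact: mulr_gt0.
by lra.
Qed.

Lemma zz_lt b x y : (forall t, 0 < t < b -> p t < 1 / 3) ->
  0 < x -> x < y -> y <= b -> z x < z y.
Proof.
move=> hp x0 xy yb.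
apply: (@derive_itv_gt0_lt _ z (fun t => z t * (1 - 3 * p t) / t)) => //.
  by move=> t /andP[xt _]; apply: dz; exact: lt_le_trans xt.
move=> t /andP[xt ty]; have t0 := lt_trans x0 xt.
rewrite divr_gt0// mulr_gt0 ?z_gt0//.
by have := hp t; rewrite t0 (lt_le_trans ty yb) => /(_ isT); lra.
Qed.

(** Below p = 1 / 3 the trajectory stays above the line through the origin
    and the equilibrium: the quotient k = p / z satisfies
    x k' + (mu + 1 / 3) k = 1 + 2 k (p - 1 / 3), hence is at most
    1 / (mu + 1 / 3) as a weighted average. *)
Lemma zz_ge_line b x : (forall t, 0 < t < b -> p t < 1 / 3) ->
  0 < x < b -> (mu + 1 / 3) * p x <= z x.
Proof.
move=> hp /andP[x0 xb].
have [k0|k0] := leP (mu + 1 / 3) 0.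
  apply: (@le_trans _ _ 0); last exact: ltW (z_gt0 x0).
  by rewrite mulr_le0_ge0// ltW// p_gt0.
pose k t := H t ^+ 2 * G t.
have kz t : 0 < t -> p t = k t * z t.
  move=> t0; rewrite /k /pp /zz; field.
  by rewrite gt_eqF// (profile_gt0 mu1 prof (ltW t0)).
suff kk : (mu + 1 / 3) * k x <= 1.
  by rewrite kz// mulrA ler_piMl// ltW// z_gt0.
apply: (@average_le _ k (fun t => 1 + 2 * k t * (p t - 1 / 3)) _ _ x k0) => //.
- apply: cont_mul; last exact: (profile_cont prof).
  apply: cont_exp; apply: is_derive_continuous.
  exact: (profile_derive prof).
- move=> t /andP[t0 _]; rewrite /k; deriv.
  + exact: (profile_derive prof (ltW t0)).
  + exact: (profile_eq prof).
  rewrite /k /pp; field.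
  by rewrite !gt_eqF// (profile_gt0 mu1 prof (ltW t0)).
- move=> t /andP[t0 tx].
  have kt : 0 <= k t.
    by rewrite /k mulr_ge0 ?exprn_even_ge0// (slope_ge0 mu1 prof (ltW t0)).
  have pt : p t < 1 / 3 by apply: hp; rewrite t0 (le_lt_trans tx).
  have : 0 <= k t * (1 / 3 - p t) by rewrite mulr_ge0// subr_ge0 ltW.
  by lra.
Qed.

(** The right-hand side is x p', so that p grows at least like a solution
    of the logistic equation with limit 1 / 3. *)
Lemma pp_logistic b x : (forall t, 0 < t < b -> p t < 1 / 3) ->
  0 < x < b -> p x * (1 / 3 - p x) <= z x - p x ^+ 2 - mu * p x.
Proof. by move=> hp xb; have := zz_ge_line hp xb; lra. Qed.

Lemma pp_le_mono b x y : (forall t, 0 < t < b -> p t < 1 / 3) ->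
  0 < x -> x <= y -> y < b -> p x <= p y.
Proof.
move=> hp x0 xy yb.
apply: (@derive_itv_ge0_le _ p (fun t => (z t - p t ^+ 2 - mu * p t) / t)) => //.
  by move=> t /andP[xt _]; apply: dp; exact: lt_le_trans xt.
move=> t /andP[xt ty]; have t0 := lt_trans x0 xt.
have tb : 0 < t < b by rewrite t0 (lt_trans ty).
rewrite divr_ge0 ?(ltW t0)//; apply: le_trans (pp_logistic hp tb).
by rewrite mulr_ge0 ?subr_ge0 ?(ltW (p_gt0 t0)) ?(ltW (hp _ tb)).
Qed.

Section forever.
Hypothesis hp : forall x, 0 < x -> p x < 1 / 3.
Let hpb b x : 0 < x < b -> p x < 1 / 3. Proof. by move=> /andP[/hp]. Qed.

Lemma pp_cvg_third e : 0 < e ->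
  exists2 X, 1 <= X & forall x, X <= x -> 1 / 3 - p x < e.
Proof.
move=> e0; pose p1 := p 1.
have p10 : 0 < p1 by exact: p_gt0.
pose X := (1 + e^-1) `^ p1^-1.
have ie : 0 < e^-1 by rewrite invr_gt0.
have b1 : 1 < 1 + e^-1 by rewrite ltrDl.
have X1 : 1 <= X.
  by rewrite /X -[1 in leLHS](powRr0 (1 + e^-1)) ler_powR ?ltW// invr_gt0.
exists X => // x Xx; have x1 := le_trans X1 Xx.
have pos t : 1 <= t -> 0 < t by exact: lt_le_trans.
pose w t := (1 / 3 - p t) * t `^ p1.
have wx : w x <= w 1.
  apply: (@derive_itv_le0_le _ w (fun t =>
    ((1 / 3 - p t) * p1 - (z t - p t ^+ 2 - mu * p t)) * t `^ p1 / t) 1 x x1).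
    move=> t /andP[t1 _]; have t0 := pos _ t1; rewrite /w.
    deriv; [exact: dp|exact: is_derive_powRf|].
    by field; rewrite gt_eqF.
  move=> t /andP[/ltW t1 _]; have t0 := pos _ t1.
  rewrite -mulrA; apply: mulr_le0_ge0; last first.
    by rewrite divr_ge0 ?powR_ge0 ?(ltW t0).
  have tb : 0 < t < t + 1 by rewrite t0 ltrDl ltr01.
  have := pp_logistic (@hpb _) tb.
  have : p1 <= p t by apply: (pp_le_mono (@hpb (t + 1))); rewrite ?ltrDl ?ltr01.
  move=> h1 h2; rewrite subr_le0; apply: le_trans h2; rewrite mulrC.
  by rewrite ler_wpM2r// subr_ge0 ltW// hp.
have w1 : w 1 < 1.
  by rewrite /w powR1 mulr1; have := p10; rewrite /p1; lra.
have xp : 1 + e^-1 <= x `^ p1.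
  have -> : 1 + e^-1 = X `^ p1.
    by rewrite /X -powRrM mulVf ?gt_eqF// powRr1// ltW// (lt_trans ltr01).
  by apply: ge0_ler_powR; rewrite ?nnegrE ?(ltW p10) ?(ltW (pos _ X1)) ?(ltW (pos _ x1)).
rewrite ltNge; apply/negP => le.
have : e * (1 + e^-1) <= w x.
  by rewrite /w ler_pM// ltW// (lt_trans ltr01).
rewrite mulrDr mulfV ?gt_eqF// mulr1; lra.
Qed.
End forever.

(** A quantitative form of the absence of roots of the quadratic
    polynomial that drives the slope of the trajectory seen from the
    equilibrium.  For mu <= 0 the roots may be real; they lie below
    the range r >= - (mu + 1 / 3) allowed by [zz_ge_line]. *)
Lemma quadratic_gap : 0 < mu + 1 / 3 ->
  mu <= 0 \/ (mu + 2 / 3) ^+ 2 < 4 * (mu + 1 / 3) ->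
  exists2 c, 0 < c & forall r, - (mu + 1 / 3) <= r ->
    2 * c * (1 + r ^+ 2) <= r ^+ 2 + (mu + 2 / 3) * r + (mu + 1 / 3).
Proof.
move=> k0 [m|disc].
  exists ((mu + 1 / 3) / 4) => [|r hr]; first by rewrite divr_gt0.
  have [r0|r0] := leP 0 r.
    have : 0 <= (mu + 2 / 3) * r by rewrite mulr_ge0//; lra.
    have : 0 <= r ^+ 2 * (5 / 6 + (- mu) / 2) by rewrite mulr_ge0 ?sqr_ge0//; lra.
    by lra.
  have : 0 <= (r + (mu + 1 / 3)) * (- r) by rewrite mulr_ge0//; lra.
  have : 0 <= (r + (mu + 1 / 3)) by lra.
  have : 0 <= (- mu) * (mu + 1 / 3) by rewrite mulr_ge0//; lra.
  nra.
pose k := mu + 1 / 3; pose s := mu + 2 / 3.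
have k1 : 0 < 1 + k by rewrite /k; lra.
pose c := (4 * k - s ^+ 2) / (8 * (1 + k)).
have c0 : 0 < c by rewrite /c divr_gt0 ?mulr_gt0//; rewrite /k /s; lra.
exists c => [//|r _].
have ck : 8 * c * (1 + k) = 4 * k - s ^+ 2 by rewrite /c; field; rewrite gt_eqF.
have c1 : 0 < 1 - 2 * c.
  have : 8 * c * (1 + k) <= 4 * k by rewrite ck gerBl sqr_ge0.
  have : 0 < c * k by rewrite mulr_gt0.
  nra.
rewrite -/s -/k -subr_ge0 -(pmulr_rge0 _ c1) -(pmulr_rge0 _ (ltr0n R 4)).
have -> : 4%:R * ((1 - 2 * c) * (r ^+ 2 + s * r + k - 2 * c * (1 + r ^+ 2))) =
  (2 * (1 - 2 * c) * r + s) ^+ 2 + (4 * k - s ^+ 2 - 8 * c * (1 + k)) + 16 * c ^+ 2.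
  by ring.
by have := sqr_ge0 (2 * (1 - 2 * c) * r + s); have := sqr_ge0 c; lra.
Qed.

End trajectory.

Section crossing.
Context {R : realType}.
Variables (mu : R) (H G : R -> R).
Hypotheses (mu1 : -1 < mu) (prof : profile mu H G).
Implicit Types (x y a b c e t r : R).

Local Notation z := (zz H).
Local Notation p := (pp H G).

Let dz x (x0 : 0 < x) := zz_derive mu1 prof x0.
Let dp x (x0 : 0 < x) := pp_derive mu1 prof x0.
Let z_gt0 x (x0 : 0 < x) := zz_gt0 mu1 prof x0.
Let p_gt0 x (x0 : 0 < x) := pp_gt0 mu1 prof x0.

Lemma p_continuous x : 0 < x -> continuous_at x p.
Proof. by move=> /dp; exact: is_derive_continuous. Qed.

Lemma first_crossing y : 0 < y -> 1 / 3 <= p y ->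
  exists2 b, 0 < b <= y & p b = 1 / 3 /\ forall x, 0 < x < b -> p x < 1 / 3.
Proof.
move=> y0 py; have t0 : 0 < 1 / 3 :> R by [].
have [x0 x00 near0] := phase_near0 mu1 prof t0.
have {}near0 x : 0 < x -> x <= x0 -> p x < 1 / 3.
  by move=> xp le; have [] := near0 x _; rewrite ?xp.
have x0y : x0 < y.
  rewrite ltNge; apply/negP => yx; have := near0 y y0 yx; lra.
have [|||c /andP[xc cy] [pc hc]] := @first_zero _ (fun t => 1 / 3 - p t) x0 y (ltW x0y).
- move=> x /andP[xx _]; apply: cont_add; first exact: cont_cst.
  by apply: cont_opp; apply: p_continuous; exact: lt_le_trans xx.
- by have := near0 x0 x00 (lexx _); lra.
- by lra.
exists c; first by rewrite cy (lt_trans x00).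
split => [|x /andP[xp xlt]]; first by move: pc; lra.
have [le|lt] := leP x x0; first exact: near0.
by have := hc x; rewrite (ltW lt) xlt => /(_ isT); lra.
Qed.

(** At the first crossing p cannot be decreasing, and x p' is
    z - 1 / 9 - mu / 3 there. *)
Lemma equilibrium_le_crossing b : 0 < b -> p b = 1 / 3 ->
  (forall x, 0 < x < b -> p x < 1 / 3) -> (mu + 1 / 3) / 3 <= z b.
Proof.
move=> b0 pb hp.
have := @left_max_derive_ge0 _ p (b / 2) b _ _ _ (dp b0).
have b2 : b / 2 < b by lra.
move=> /(_ b2) h.
have : 0 <= (z b - p b ^+ 2 - mu * p b) / b.
  apply: h => x /andP[bx xb]; rewrite pb ltW// hp// xb andbT.
  by apply: lt_le_trans bx; rewrite divr_gt0.
by rewrite pmulr_lge0 ?invr_gt0// pb; lra.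
Qed.

(** The function t |-> (t + c)^3 / t^2 increases for t >= 2 c. *)
Lemma cubic_lt u v c : 0 < v -> v < u -> 2 * c <= v ->
  (v + c) ^+ 3 * u ^+ 2 < (u + c) ^+ 3 * v ^+ 2.
Proof.
move=> v0 vu cv; rewrite -subr_gt0.
have -> : (u + c) ^+ 3 * v ^+ 2 - (v + c) ^+ 3 * u ^+ 2 =
  (u - v) * (u ^+ 2 * v ^+ 2 - 3 * c ^+ 2 * u * v - c ^+ 3 * (u + v)) by ring.
apply: mulr_gt0; first by lra.
have u0 := lt_trans v0 vu.
have [c0|c0] := leP 0 c.
  have vv : (2 * c) ^+ 2 <= v ^+ 2 by rewrite lerXn2r ?nnegrE//; lra.
  have uv : v ^+ 2 < u * v by rewrite expr2 ltr_pM2r.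
  have h1 : 0 < (u * v) * (u * v - 4 * c ^+ 2) by rewrite !mulr_gt0//; lra.
  have h2 : 0 <= c ^+ 2 * (u * (v - 2 * c)).
    by rewrite !mulr_ge0 ?sqr_ge0 ?(ltW u0)//; lra.
  have h3 : 0 <= c ^+ 2 * (v * (u - 2 * c)).
    by rewrite !mulr_ge0 ?sqr_ge0 ?(ltW v0)//; lra.
  by lra.
pose a := - c; have a0 : 0 < a by rewrite /a; lra.
pose w := u * v; have w0 : 0 < w by rewrite mulr_gt0.
have -> : u ^+ 2 * v ^+ 2 - 3 * c ^+ 2 * u * v - c ^+ 3 * (u + v) =
  a ^+ 3 * (u + v) - (3 * a ^+ 2 - w) * w by rewrite /a /w; ring.
have a3 : 0 < a ^+ 3 * (u + v) by rewrite mulr_gt0 ?exprn_gt0//; lra.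
have [wa|wa] := leP (3 * a ^+ 2) w.
  have : 0 <= (w - 3 * a ^+ 2) * w by rewrite mulr_ge0 ?(ltW w0)// subr_ge0.
  by lra.
rewrite subr_gt0 -ltr_sqr ?nnegrE ?(ltW a3)//; last first.
  by rewrite mulr_ge0 ?(ltW w0)// subr_ge0 ltW.
have h1 : 0 < a ^+ 6 * (u - v) ^+ 2 by rewrite mulr_gt0 ?exprn_gt0//; lra.
have h2 : 0 <= w * ((a ^+ 2 - w) ^+ 2 * (4 * a ^+ 2 - w)).
  apply: mulr_ge0; first exact: ltW.
  apply: mulr_ge0; first exact: sqr_ge0.
  by have := exprn_gt0 2 a0; lra.
rewrite -subr_gt0.
have -> : (a ^+ 3 * (u + v)) ^+ 2 - ((3 * a ^+ 2 - w) * w) ^+ 2 =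
   a ^+ 6 * (u - v) ^+ 2 + w * ((a ^+ 2 - w) ^+ 2 * (4 * a ^+ 2 - w)).
  by rewrite /w; ring.
by lra.
Qed.

(** After the crossing the trajectory may wind around the equilibrium,
    but z never exceeds its value at the first crossing.  In terms of
    y = z^(-1/3) and log x, the system is a damped oscillator; the cube of its
    energy is A^3 / z^2 with A = (p - 1 / 3)^2 / 2 + z + c.  It decreases
    when mu >= - (2 / 3), and on the line p = 1 / 3 it is an increasing
    function of z above the equilibrium, while off this line it is larger. *)
Lemma zz_le_crossing b : - (2 / 3) <= mu -> 0 < b -> p b = 1 / 3 ->
  (forall x, 0 < x < b -> p x < 1 / 3) -> forall x, 0 < x -> z x <= z b.
Proof.
move=> mu2 b0 pb hp x x0.
have [xb|bx|->//] := ltgtP x b.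
  exact: ltW (zz_lt mu1 prof hp x0 xb (lexx b)).
rewrite leNgt; apply/negP => zbx.
pose c := (mu + 1 / 3) / 6.
pose A t := (p t - 1 / 3) ^+ 2 / 2 + z t + c.
pose F t := A t ^+ 3 / z t ^+ 2.
have FF : F x <= F b.
  apply: (@derive_itv_le0_le _ F (fun t => - (3 * (mu + 2 / 3) *
    (p t - 1 / 3) ^+ 2 * A t ^+ 2 / z t ^+ 2 / t))) => //; first exact: ltW.
    move=> t /andP[bt _]; have t0 := lt_le_trans b0 bt.
    have zt := z_gt0 t0; rewrite /F /A; deriv;
      [exact: dp|exact: dz|by rewrite expf_neq0// gt_eqF|exact: dz|].
    by rewrite /c; field; rewrite !gt_eqF.
  move=> t /andP[bt _]; have t0 := lt_trans b0 bt.
  rewrite oppr_le0; apply: divr_ge0; last exact: ltW.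
  apply: divr_ge0; last exact: sqr_ge0.
  apply: mulr_ge0; last exact: sqr_ge0.
  by apply: mulr_ge0; [lra|exact: sqr_ge0].
have zx0 := z_gt0 x0; have zb0 := z_gt0 b0.
have c2 : 2 * c <= z b.
  by have := equilibrium_le_crossing b0 pb hp; rewrite /c; lra.
have := cubic_lt zb0 zbx c2; apply/negP; rewrite -leNgt.
have : F b = (z b + c) ^+ 3 / z b ^+ 2 by rewrite /F /A pb subrr expr0n mul0r add0r.
have Ax : (z x + c) ^+ 3 <= A x ^+ 3.
  rewrite -subr_ge0; have hA : z x + c <= A x by rewrite /A; have := sqr_ge0 (p x - 1 / 3); lra.
  have -> : A x ^+ 3 - (z x + c) ^+ 3 = (A x - (z x + c)) *
     ((A x + (z x + c) / 2) ^+ 2 + 3 / 4 * (z x + c) ^+ 2) by field.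
  by rewrite mulr_ge0 ?subr_ge0// addr_ge0 ?sqr_ge0// mulr_ge0 ?sqr_ge0.
move=> Fb; rewrite -ler_pdivlMr ?exprn_gt0// mulrAC -Fb.
rewrite -ler_pdivrMr ?exprn_gt0//.
apply: le_trans FF; rewrite /F.
by rewrite ler_pM2r ?invr_gt0 ?exprn_gt0.
Qed.

(** If p stayed below 1 / 3, it would tend to 1 / 3 and the slope - rho of
    the segment from the equilibrium to the trajectory would satisfy
    x rho' = rho^2 + (mu + 2 / 3) rho + mu + 1 / 3 up to the term
    2 rho (1 / 3 - p).  By
    [quadratic_gap], atan rho would then grow at least like c log x, which is
    absurd.  When mu <= - (1 / 3) there is no equilibrium with z > 0, and
    p itself grows at least like a logarithm. *)
Lemma crossing_exists : mu <= 0 \/ (mu + 2 / 3) ^+ 2 < 4 * (mu + 1 / 3) ->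
  exists2 b, 0 < b & p b = 1 / 3 /\ forall x, 0 < x < b -> p x < 1 / 3.
Proof.
move=> gap.
suff [y y0 py] : exists2 y, 0 < y & 1 / 3 <= p y.
  by have [b /andP[b0 _] hb] := first_crossing y0 py; exists b.
apply/not_exists2P => hn.
have hp x : 0 < x -> p x < 1 / 3.
  by move=> x0; have [//|/negP] := hn x; rewrite -ltNge.
have hpb b x : 0 < x < b -> p x < 1 / 3 by move=> /andP[/hp].
have [k0|k0] := leP (mu + 1 / 3) 0.
  pose z1 := z 1; have z10 : 0 < z1 by exact: z_gt0.
  pose X := expR z1^-1.
  have X1 : 1 <= X by rewrite -expR0 ler_expR invr_ge0 ltW.
  have : p 1 - z1 * ln 1 <= p X - z1 * ln X.
    apply: (@derive_itv_ge0_le _ (fun t => p t - z1 * ln t)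
      (fun t => (z t - p t ^+ 2 - mu * p t - z1) / t)) => //.
      move=> t /andP[t1 _]; have t0 := lt_le_trans ltr01 t1.
      deriv; [exact: dp|exact: is_derive1_ln|].
      by field; rewrite gt_eqF.
    move=> t /andP[t1 _]; have t0 := lt_trans ltr01 t1.
    rewrite divr_ge0 ?(ltW t0)//.
    have zt : z1 <= z t.
      by apply: ltW; apply: (zz_lt mu1 prof (@hpb t)) => //; rewrite ltr01.
    have : 0 <= p t * (1 / 3 - p t).
      by rewrite mulr_ge0 ?(ltW (p_gt0 t0))// subr_ge0 ltW// hp.
    have : 0 <= p t * - (mu + 1 / 3).
      by rewrite mulr_ge0 ?(ltW (p_gt0 t0))// oppr_ge0.
    by lra.
  rewrite ln1 /X expRK mulr0 mulfV ?gt_eqF// -/X.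
  have := hp X (lt_le_trans ltr01 X1); have := p_gt0 (ltr01 : 0 < 1 :> R).
  by lra.
have [c c0 hc] := quadratic_gap k0 gap.
pose k := mu + 1 / 3.
have [X X1 hX] := pp_cvg_third mu1 prof hp (divr_gt0 c0 (mulr_gt0 (ltr0n R 2) k0)).
have X0 := lt_le_trans ltr01 X1.
pose rho t := (z t - k / 3) / (1 / 3 - p t).
have e0 t : 0 < t -> 0 < 1 / 3 - p t by move=> /hp; rewrite subr_gt0.
have rge t : 0 < t -> - k <= rho t.
  move=> t0; rewrite ler_pdivlMr ?e0//.
  have tb : 0 < t < t + 1 by rewrite t0 ltrDl ltr01.
  by have := zz_ge_line mu1 prof (@hpb _) tb; rewrite -/k; lra.
have drho t : 0 < t -> is_derive t 1 rho
    ((rho t ^+ 2 + (mu + 2 / 3) * rho t + k + 2 * rho t * (1 / 3 - p t)) / t).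
  move=> t0; have := e0 t t0 => et; rewrite /rho; deriv;
    [exact: dz|by rewrite gt_eqF|exact: dp|].
  by rewrite /k; field; rewrite gt_eqF//=; apply: lt0r_neq0; lra.
pose Y := X * expR (pi / c).
have Y0 : 0 < Y by rewrite mulr_gt0// expR_gt0.
have XY : X <= Y by rewrite ler_peMr ?(ltW X0)// -expR0 ler_expR divr_ge0 ?pi_ge0 ?(ltW c0).
have : atan (rho X) - c * ln X <= atan (rho Y) - c * ln Y.
  apply: (@derive_itv_ge0_le _ (fun t => atan (rho t) - c * ln t)
    (fun t => ((1 + rho t ^+ 2)^-1 *
     (rho t ^+ 2 + (mu + 2 / 3) * rho t + k + 2 * rho t * (1 / 3 - p t)) - c) / t)) => //.
    move=> t /andP[t1 _]; have t0 := lt_le_trans X0 t1.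
    deriv; [apply: is_derive_compf (drho _ t0); exact: is_derive1_atan|exact: is_derive1_ln|].
    field; rewrite gt_eqF//= gt_eqF//.
    by have := sqr_ge0 (rho t); lra.
  move=> t /andP[/ltW t1 _]; have t0 := lt_le_trans X0 t1.
  rewrite divr_ge0 ?(ltW t0)// subr_ge0 mulrC ler_pdivlMr; last first.
    by have := sqr_ge0 (rho t); lra.
  have := hc _ (rge _ t0); rewrite -/k.
  have := hX _ t1; rewrite ltr_pdivlMr ?mulr_gt0// -/k => h1.
  have h2 : 0 <= (rho t + k) * (1 / 3 - p t).
    by rewrite mulr_ge0 ?(ltW (e0 _ t0))//; have := rge _ t0; lra.
  have : 0 <= c * rho t ^+ 2 by rewrite mulr_ge0 ?(ltW c0)// sqr_ge0.
  by lra.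
rewrite lnM ?posrE ?expR_gt0// expRK mulrDr.
have -> : c * (pi / c) = pi by field; rewrite gt_eqF.
have := atan_gtNpi2 (rho X); have := atan_ltpi2 (rho Y); lra.
Qed.

(** The line through the equilibrium of slope s = (mu + 2 / 3) / 2, the
    direction of the common eigenvector when the discriminant vanishes, is a barrier: the trajectory
    starts below it, and on the line the field points downwards.  Below the
    line, 1 / 3 - p decreases at most like x^(-s), so that it
    stays positive. *)
Lemma no_crossing : 0 < mu -> 4 * (mu + 1 / 3) <= (mu + 2 / 3) ^+ 2 ->
  forall x, 0 < x -> p x < 1 / 3 /\ z x < (mu + 1 / 3) / 3.
Proof.
move=> mu0 disc.
pose s := (mu + 2 / 3) / 2; pose k := mu + 1 / 3.
have s0 : 0 < s by rewrite /s; lra.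
pose Q t := s * (p t - 1 / 3) - (z t - k / 3).
(* Q tends to mu / 6 at the origin *)
have e0 : 0 < mu / (12 * (1 + s)) by rewrite divr_gt0// mulr_gt0//; lra.
have [x0 x00 near0] := phase_near0 mu1 prof e0.
have Q0 x : 0 < x <= x0 -> 0 < Q x.
  move=> /[dup] /near0[zx px] /andP[xp _].
  have : z x < mu / 12.
    by apply: (lt_le_trans zx); rewrite ler_pM2l// lef_pV2 ?posrE//; lra.
  have : 0 < s * p x by rewrite mulr_gt0// p_gt0.
  by rewrite /Q /s /k; lra.
have Qpos b : (forall x, 0 < x < b -> p x < 1 / 3) -> forall x, 0 < x < b -> 0 < Q x.
  move=> hp x /andP[xp xb].
  have [le|/ltW lt] := leP x x0; first by apply: Q0; rewrite xp.
  apply: (@barrier _ Q (fun t => (s * (z t - p t ^+ 2 - mu * p t)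
     - z t * (1 - 3 * p t)) / t) x0 x lt).
  - move=> t /andP[t1 _]; have t0 := lt_le_trans x00 t1.
    rewrite /Q; deriv; [exact: dp|exact: dz|].
    by field; rewrite gt_eqF.
  - by apply: Q0; rewrite x00 lexx.
  move=> t /andP[t1 tx] Qt _; have t0 := lt_trans x00 t1.
  rewrite divr_gt0//.
  have pt : p t < 1 / 3 by apply: hp; rewrite t0 (le_lt_trans tx).
  have -> : z t = k / 3 + s * (p t - 1 / 3) by move: Qt; rewrite /Q; lra.
  rewrite -subr_gt0 in pt; move: pt; set e := 1 / 3 - p t.
  have -> : p t = 1 / 3 - e by rewrite /e; ring.
  move=> ep.
  have -> : s * (k / 3 + s * (1 / 3 - e - 1 / 3) - (1 / 3 - e) ^+ 2 - mu * (1 / 3 - e)) -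
     (k / 3 + s * (1 / 3 - e - 1 / 3)) * (1 - 3 * (1 / 3 - e)) =
     e * ((mu + 2 / 3) ^+ 2 - 4 * k) / 4 + 2 * s * e ^+ 2.
    by rewrite /s /k; field.
  have : 0 < s * e ^+ 2 by rewrite mulr_gt0// exprn_gt0.
  have : 0 <= e * ((mu + 2 / 3) ^+ 2 - 4 * k).
    by rewrite mulr_ge0 ?(ltW ep)// /k subr_ge0.
  by lra.
have hp x : 0 < x -> p x < 1 / 3.
  move=> xp; rewrite ltNge; apply/negP => px.
  have [b /andP[b0 _] [pb hb]] := first_crossing xp px.
  pose w t := (1 / 3 - p t) * t `^ s.
  have : w (b / 2) <= w b.
    have b2 : 0 < b / 2 by rewrite divr_gt0.
    apply: (@derive_itv_ge0_le _ w (fun t =>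
      ((1 / 3 - p t) * s - (z t - p t ^+ 2 - mu * p t)) * t `^ s / t)).
    - by lra.
    - move=> t /andP[t1 _]; have t0 := lt_le_trans b2 t1; rewrite /w.
      deriv; [exact: dp|exact: is_derive_powRf|].
      by field; rewrite gt_eqF.
    move=> t /andP[t1 tb]; have t0 := lt_trans b2 t1.
    rewrite !mulr_ge0 ?powR_ge0 ?invr_ge0 ?(ltW t0)//.
    have t0b : 0 < t < b by rewrite t0.
    have := Qpos b hb t t0b; have := hb t t0b; rewrite /Q -subr_gt0.
    have := sqr_ge0 (1 / 3 - p t); rewrite /s /k; lra.
  rewrite /w pb subrr mul0r leNgt pmulr_lgt0 ?powR_gt0 ?divr_gt0//.
  rewrite subr_gt0 hb// divr_gt0//=; lra.
move=> x xp; split; first exact: hp.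
have xb : 0 < x < x + 1 by rewrite xp ltrDl ltr01.
have := Qpos (x + 1) _ x xb; rewrite /Q -/k.
have : 0 < s * (1 / 3 - p x) by rewrite mulr_gt0// subr_gt0 hp.
move=> h1 h2; have : 0 < s * (p x - 1 / 3) - (z x - k / 3).
  by apply: h2 => t /andP[/hp].
by lra.
Qed.

Lemma zz_cvg_equilibrium e : (forall x, 0 < x -> p x < 1 / 3) ->
  0 < mu + 1 / 3 -> 0 < e ->
  exists2 X, 1 <= X & forall x, X <= x -> (mu + 1 / 3) / 3 - e < z x.
Proof.
move=> hp k0 e0.
have [X X1 hX] := pp_cvg_third mu1 prof hp (divr_gt0 e0 k0).
exists X => // x Xx; have x0 := lt_le_trans (lt_le_trans ltr01 X1) Xx.
have xb : 0 < x < x + 1 by rewrite x0 ltrDl ltr01.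
have hpb t : 0 < t < x + 1 -> p t < 1 / 3 by move=> /andP[/hp].
have := zz_ge_line mu1 prof hpb xb; have := hX x Xx.
by rewrite ltr_pdivlMr//; lra.
Qed.

End crossing.

(** * Numerical bounds for the planar profile *)

(** A polynomial whose coefficients in the Bernstein basis of an interval are
    positive is positive there: these terms let linear arithmetic find the
    coefficients. *)
Ltac bernstein_terms B k m :=
  let t := fresh "t" in
  have t := B k m;
  lazymatch m with
  | S ?m' => let k' := constr:(S k) in bernstein_terms B k' m'
  | _ => idtac
  end.

Section polynomial_inequalities.
Context {R : realType}.
Implicit Types s t : R.

(** In the planar case v = H^2 H' and H are functions of sg = p^2 / z on the
    increasing part of the trajectory.  With s = sg, these are polynomial
    approximations of them from above and from below, with rounded
    coefficients: v is between vlo / 10000 and vup / 1000, and H is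
    between hlo / 10000 and hup / 1000; primes denote their derivatives.
    The range is 0 <= s <= 4 / 7, the crossing being near s = 0.563. *)
Definition vup s : R :=
  1001 + 1000 * s + 331 * s ^+ 2 + 97 * s ^+ 3 - 2 * s ^+ 4 + 72 * s ^+ 5.
Definition vup' s : R :=
  1000 + 662 * s + 291 * s ^+ 2 - 8 * s ^+ 3 + 360 * s ^+ 4.
Definition vlo s : R :=
  9999 + 10000 * s + 3310 * s ^+ 2 + 970 * s ^+ 3 - 20 * s ^+ 4 + 720 * s ^+ 5.
Definition vlo' s : R :=
  10000 + 6620 * s + 2910 * s ^+ 2 - 80 * s ^+ 3 + 3600 * s ^+ 4.
Definition hup s : R :=
  1000 + 1004 * s + 489 * s ^+ 2 + 381 * s ^+ 3 - 133 * s ^+ 4 + 490 * s ^+ 5.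
Definition hup' s : R :=
  1004 + 978 * s + 1143 * s ^+ 2 - 532 * s ^+ 3 + 2450 * s ^+ 4.
Definition hlo s : R :=
  10000 + 9998 * s + 4990 * s ^+ 2 + 2879 * s ^+ 3 + 1035 * s ^+ 4
  + 3602 * s ^+ 5 - 3690 * s ^+ 6 + 4172 * s ^+ 7.
Definition hlo' s : R :=
  9998 + 2 * 4990 * s + 3 * 2879 * s ^+ 2 + 4 * 1035 * s ^+ 3
  + 5 * 3602 * s ^+ 4 - 6 * 3690 * s ^+ 5 + 7 * 4172 * s ^+ 6.

(** In this lemma and the next one, the sign says that the polynomial is
    a strict upper or lower solution of
    dv/ds = v (1 + 2 s - v) / (s (2 + s - v)). *)
Lemma vup_barrier s : 0 <= s -> 7 * s <= 4 ->
  0 < vup' s * s * (2000 + 1000 * s - vup s) - vup s * (1000 + 2000 * s - vup s).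
Proof.
move=> s0 s1.
have B (k m : nat) : 0 <= s ^+ k * (4 - 7 * s) ^+ m.
  by rewrite mulr_ge0 ?exprn_ge0//; lra.
bernstein_terms B 0%N 10%N; clear B; rewrite /vup /vup'; lra.
Qed.

Lemma vlo_barrier s : 0 <= s -> 7 * s <= 4 ->
  0 < vlo s * (10000 + 2 * 10000 * s - vlo s)
     - vlo' s * s * (2 * 10000 + 10000 * s - vlo s).
Proof.
move=> s0 s1.
have B (k m : nat) : 0 <= s ^+ k * (4 - 7 * s) ^+ m.
  by rewrite mulr_ge0 ?exprn_ge0//; lra.
bernstein_terms B 0%N 10%N; clear B; rewrite /vlo /vlo'; lra.
Qed.

(** In this lemma and the next one, the sign says that the polynomial is
    an upper or lower solution of dH/ds = H / (2 + s - v), where v has been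
    replaced by its own polynomial bound. *)
Lemma hup_barrier s : 0 <= s -> 7 * s <= 4 ->
  1000 * hup s <= hup' s * (2000 + 1000 * s - vup s).
Proof.
move=> s0 s1.
have B (k m : nat) : 0 <= s ^+ k * (4 - 7 * s) ^+ m.
  by rewrite mulr_ge0 ?exprn_ge0//; lra.
bernstein_terms B 0%N 9%N; clear B; rewrite /hup /hup' /vup; lra.
Qed.

Lemma hlo_barrier s : 0 <= s -> 7 * s <= 4 ->
  hlo' s * (2 * 10000 + 10000 * s - vlo s) <= 10000 * hlo s.
Proof.
move=> s0 s1.
have B (k m : nat) : 0 <= s ^+ k * (4 - 7 * s) ^+ m.
  by rewrite mulr_ge0 ?exprn_ge0//; lra.
bernstein_terms B 0%N 11%N; clear B; rewrite /hlo /hlo' /vlo; lra.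
Qed.

(** As the crossing is at 3 s = v, the place where a polynomial bound of v
    meets the line 3 s bounds the value of s at the crossing. *)
Lemma vup_fixpoint s : 4 < 7 * s -> s <= 1 -> vup s < 3000 * s.
Proof.
move=> s0 s1.
have B (k m : nat) : 0 <= (7 * s - 4) ^+ k * (1 - s) ^+ m.
  by rewrite mulr_ge0 ?exprn_ge0//; lra.
bernstein_terms B 0%N 5%N; clear B; rewrite /vup; lra.
Qed.

Lemma vlo_fixpoint s : 0 <= s -> 135 * s <= 76 -> 3 * 10000 * s < vlo s.
Proof.
move=> s0 s1.
have B (k m : nat) : 0 <= s ^+ k * (76 - 135 * s) ^+ m.
  by rewrite mulr_ge0 ?exprn_ge0//; lra.
bernstein_terms B 0%N 5%N; clear B; rewrite /vlo; lra.
Qed.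

Lemma vup_fixpoint_sharp s : 53 <= 94 * s -> 7 * s <= 4 -> vup s < 3000 * s.
Proof.
move=> s0 s1.
have B (k m : nat) : 0 <= (94 * s - 53) ^+ k * (4 - 7 * s) ^+ m.
  by rewrite mulr_ge0 ?exprn_ge0//; lra.
bernstein_terms B 0%N 5%N; clear B; rewrite /vup; lra.
Qed.

Lemma hlo_value s : 76 <= 135 * s -> 7 * s <= 4 -> 2 * 8993 < hlo s.
Proof.
move=> s0 s1.
have B (k m : nat) : 0 <= (135 * s - 76) ^+ k * (4 - 7 * s) ^+ m.
  by rewrite mulr_ge0 ?exprn_ge0//; lra.
bernstein_terms B 0%N 7%N; clear B; rewrite /hlo; lra.
Qed.

Lemma hup_value s : 0 <= s -> 94 * s <= 53 -> hup s < 1805.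
Proof.
move=> s0 s1.
have B (k m : nat) : 0 <= s ^+ k * (53 - 94 * s) ^+ m.
  by rewrite mulr_ge0 ?exprn_ge0//; lra.
bernstein_terms B 0%N 5%N; clear B; rewrite /hup; lra.
Qed.

Lemma hup'_ge0 s : 0 <= s -> 7 * s <= 4 -> 0 <= hup' s.
Proof.
move=> s0 s1.
have B (k m : nat) : 0 <= s ^+ k * (4 - 7 * s) ^+ m.
  by rewrite mulr_ge0 ?exprn_ge0//; lra.
bernstein_terms B 0%N 4%N; clear B; rewrite /hup'; lra.
Qed.

Lemma hlo'_ge0 s : 0 <= s -> 7 * s <= 4 -> 0 <= hlo' s.
Proof.
move=> s0 s1.
have B (k m : nat) : 0 <= s ^+ k * (4 - 7 * s) ^+ m.
  by rewrite mulr_ge0 ?exprn_ge0//; lra.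
bernstein_terms B 0%N 6%N; clear B; rewrite /hlo'; lra.
Qed.

Lemma hup_gt0 s : 0 <= s -> 7 * s <= 4 -> 0 < hup s.
Proof.
move=> s0 s1.
have B (k m : nat) : 0 <= s ^+ k * (4 - 7 * s) ^+ m.
  by rewrite mulr_ge0 ?exprn_ge0//; lra.
bernstein_terms B 0%N 5%N; clear B; rewrite /hup; lra.
Qed.

Lemma hlo_gt0 s : 0 <= s -> 7 * s <= 4 -> 0 < hlo s.
Proof.
move=> s0 s1.
have B (k m : nat) : 0 <= s ^+ k * (4 - 7 * s) ^+ m.
  by rewrite mulr_ge0 ?exprn_ge0//; lra.
bernstein_terms B 0%N 7%N; clear B; rewrite /hlo; lra.
Qed.

End polynomial_inequalities.

Section contact.
Context {R : realType}.
Implicit Types v s t a : R.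

Lemma upper_contact v s t a : 0 < v -> 0 < t ->
  0 < a * s * (2 * 1000 + 1000 * s - 1000 * v)
      - 1000 * v * (1000 + 2 * 1000 * s - 1000 * v) ->
  0 < (a * (s * (2 + s - v)) / v - 1000 * (1 + 2 * s - v)) / t.
Proof.
move=> v0 t0 h; apply: divr_gt0; last exact: t0.
have vn0 := lt0r_neq0 v0; have -> : a * (s * (2 + s - v)) / v - 1000 * (1 + 2 * s - v) =
    (a * (s * (2 + s - v)) - v * (1000 * (1 + 2 * s - v))) / v.
  by clear h; field.
by apply: divr_gt0; [lra|exact: v0].
Qed.

Lemma lower_contact v s t a : 0 < v -> 0 < t ->
  0 < 10000 * v * (10000 + 2 * 10000 * s - 10000 * v)
      - a * s * (2 * 10000 + 10000 * s - 10000 * v) ->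
  0 < (10000 * (1 + 2 * s - v) - a * (s * (2 + s - v)) / v) / t.
Proof.
move=> v0 t0 h; apply: divr_gt0; last exact: t0.
have vn0 := lt0r_neq0 v0; have -> : 10000 * (1 + 2 * s - v) - a * (s * (2 + s - v)) / v =
    (v * (10000 * (1 + 2 * s - v)) - a * (s * (2 + s - v))) / v.
  by clear h; field.
by apply: divr_gt0; [lra|exact: v0].
Qed.

Lemma inverse_bounds v s : 0 < v -> 3 * v * s = 1 -> 76 / 45 < v -> v < 159 / 94 ->
  788 / 4000 < s < 790 / 4000.
Proof.
move=> v0 vs l u; have v3 : 0 < 3 * v by lra.
have -> : s = 1 / (3 * v) by rewrite -[X in X / _]vs mulrAC mulfV ?mul1r // lt0r_neq0.
apply/andP; split; [rewrite ltr_pdivlMr|rewrite ltr_pdivrMr]; by [exact: v3|lra].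
Qed.

Lemma decimal_bounds s : 2 * 8993 < 10000 * s -> 1000 * s < 1805 ->
  1 / (1 - 444 / 1000) < s < 1 / (1 - 446 / 1000).
Proof.
move=> l u; apply/andP; split.
  by rewrite ltr_pdivrMr; lra.
by rewrite ltr_pdivlMr; lra.
Qed.

Lemma bounds_at_crossing v s w h : 0 < v -> 0 <= s -> 7 * s <= 4 ->
  3 * s = v -> vlo s < 10000 * v -> 1000 * v < vup s -> 3 * v * w = 1 ->
  hlo s <= 10000 * h -> 1000 * h <= hup s ->
  788 / 4000 < w < 790 / 4000 /\ 1 / (1 - 444 / 1000) < h < 1 / (1 - 446 / 1000).
Proof.
move=> v0 s0 s1 sv lo up vw hl hu.
have l1 : 76 < 135 * s.
  rewrite ltNge; apply/negP => l; move: (vlo_fixpoint s0 l).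
  by clear hl hu vw up; lra.
have l2 : 94 * s < 53.
  rewrite ltNge; apply/negP => l; move: (vup_fixpoint_sharp l s1).
  by clear hl hu vw lo; lra.
split.
  clear hl hu lo up; apply: inverse_bounds v0 vw _ _; lra.
move: (hlo_value (ltW l1) s1) (hup_value s0 (ltW l2)) => hl' hu'.
by apply: decimal_bounds; clear lo up vw; lra.
Qed.
End contact.

(** The quantities v = p / z and sg = p^2 / z have the regular
    equations x v' = 1 + 2 sg - v and x sg' = sg (2 + sg - v) / v, and
    they start at v = 1, sg = 0. *)
Section planar_numerics.
Context {R : realType}.
Variables (H G : R -> R) (b : R).
Hypothesis prof : profile 0 H G.
Hypotheses (b0 : 0 < b) (pb : pp H G b = 1 / 3)
  (hp : forall x, 0 < x < b -> pp H G x < 1 / 3).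
Implicit Types (x y a c e t r : R).

Local Notation z := (zz H).
Local Notation p := (pp H G).
Let v x := H x ^+ 2 * G x.
Let sg x := p x * v x.

Let mu1 : (-1 : R) < 0. Proof. lra. Qed.
Let H0 x : 0 <= x -> H x != 0.
Proof. by move=> /(profile_gt0 mu1 prof)/lt0r_neq0. Qed.

Let v_gt0 x : 0 <= x -> 0 < v x.
Proof.
move=> x0; rewrite /v mulr_gt0 ?(slope_gt0 mu1 prof)// exprn_gt0//.
exact: (profile_gt0 mu1 prof).
Qed.

Let pv x : 0 < x -> p x = v x * z x.
Proof. by move=> x0; rewrite /v /pp /zz; field; rewrite H0// ltW. Qed.

Let cH x : 0 <= x -> continuous_at x H.
Proof. by move=> x0; apply: is_derive_continuous; exact: (profile_derive prof). Qed.

Let cv x : 0 <= x -> continuous_at x v.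
Proof.
move=> x0; apply: cont_mul; last exact: (profile_cont prof).
by apply: cont_exp; exact: cH.
Qed.

Let csg x : 0 <= x -> continuous_at x sg.
Proof.
move=> x0; apply: cont_mul; last exact: cv.
apply: cont_mul; last by apply: cont_inv; [exact: cH|exact: H0].
by apply: cont_mul; [exact: cvg_id|exact: (profile_cont prof)].
Qed.

Let dv x : 0 < x -> is_derive x 1 v ((1 + 2 * sg x - v x) / x).
Proof.
move=> x0; have x0' := ltW x0; rewrite /v; deriv.
- exact: (profile_derive prof).
- exact: (profile_eq prof).
by rewrite /sg /v /pp; field; rewrite H0// gt_eqF.
Qed.

Let dsg x : 0 < x -> is_derive x 1 sg (sg x * (2 + sg x - v x) / v x / x).
Proof.
move=> x0; have x0' := ltW x0; rewrite /sg; deriv;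
  [exact: (pp_derive mu1 prof)|exact: dv|].
have vx := v_gt0 x0'.
rewrite /sg -[z x](mulKf (lt0r_neq0 vx)) -pv//; field.
by rewrite !gt_eqF.
Qed.

Let v00 : v 0 = 1.
Proof.
by rewrite /v (profile0 prof) (profile_slope0 prof) addr0 expr1n invr1 mulr1.
Qed.

Let sg0 : sg 0 = 0. Proof. by rewrite /sg /pp !mul0r. Qed.

Let sg_ge0 x : 0 <= x -> 0 <= sg x.
Proof.
move=> x0; rewrite /sg /pp; apply: mulr_ge0; last exact: ltW (v_gt0 x0).
apply: divr_ge0; last exact: ltW (profile_gt0 mu1 prof x0).
by apply: mulr_ge0 => //; exact: (slope_ge0 mu1 prof).
Qed.

Let sg_le x : 0 < x <= b -> 3 * sg x <= v x.
Proof.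
move=> /andP[x0 xb]; have v0 := v_gt0 (ltW x0).
have px : p x <= 1 / 3.
  by move: xb; rewrite le_eqVlt => /orP[/eqP ->|xb]; [rewrite pb|rewrite ltW// hp// x0].
have : 0 <= v x * (1 / 3 - p x) by rewrite mulr_ge0 ?subr_ge0// ltW.
by rewrite /sg; lra.
Qed.

Let v_le3 x : 0 < x <= b -> v x <= 3.
Proof.
move=> /andP[x0 xb].
have : (0 + 1 / 3) * p x <= z x.
  move: xb; rewrite le_eqVlt => /orP[/eqP ->|xb].
    by have := equilibrium_le_crossing mu1 prof b0 pb hp; rewrite pb; lra.
  by apply: (zz_ge_line mu1 prof hp); rewrite x0.
rewrite pv// => h; have zx := zz_gt0 mu1 prof x0.
by rewrite -(ler_pM2r zx); lra.
Qed.

Let from_zero (f df : R -> R) x : (forall t, 0 <= t -> continuous_at t f) -> 0 < f 0 ->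
  (forall t, 0 < t -> is_derive t 1 f (df t)) ->
  (forall t, 0 < t <= b -> f t = 0 -> 0 < df t) -> 0 < x <= b -> 0 < f x.
Proof.
move=> cf f0 fd fb /andP[x0 xb].
have [e e0 he] := cont_eps (cf 0 (lexx 0)) f0.
pose a := Num.min x (e / 2).
have a0 : 0 < a by rewrite /a lt_min x0 divr_gt0.
have ax : a <= x by rewrite /a ge_min lexx.
have ae : a < e by rewrite /a gt_min; apply/orP; right; lra.
apply: (@barrier _ f df a x ax).
- by move=> t /andP[at_ _]; apply: fd; exact: lt_le_trans at_.
- have := he a; rewrite sub0r normrN gtr0_norm// => /(_ ae).
  by rewrite ltr_norml => /andP[_]; lra.
move=> t /andP[at_ tx] ft _; apply: fb => //.
by rewrite (lt_trans a0)//= (le_trans tx).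
Qed.

(** The bound on sg comes along: sg = 4 / 7 is beyond the place where vup
    meets the line 3 s, while 3 sg <= v up to the crossing. *)
Lemma slope_upper x : 0 < x <= b -> 1000 * v x < vup (sg x) /\ 7 * sg x <= 4.
Proof.
move=> xb; suff h : 0 < vup (sg x) - 1000 * v x.
  split; first by lra.
  rewrite leNgt; apply/negP => s1.
  have := sg_le xb; have := v_le3 xb => h1 h2.
  have sle1 : sg x <= 1 by lra.
  by have := vup_fixpoint s1 sle1; lra.
apply: (@from_zero (fun x => vup (sg x) - 1000 * v x) (fun x =>
   (vup' (sg x) * (sg x * (2 + sg x - v x)) / v x - 1000 * (1 + 2 * sg x - v x)) / x) x _ _ _ _ xb).
- move=> t t0; rewrite /vup; cont_rec; try exact: csg; exact: cv.
- by rewrite v00 sg0 /vup; lra.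
- move=> t t0; rewrite /vup; deriv; try exact: dsg; try exact: dv.
  rewrite /vup'; field; rewrite !gt_eqF//; exact: v_gt0 (ltW t0).
move=> t tb /eqP; rewrite subr_eq0 => /eqP vt.
have /andP[t0 _] := tb; have v0 := v_gt0 (ltW t0).
have s0 := sg_ge0 (ltW t0).
have s1 : 7 * sg t <= 4.
  rewrite leNgt; apply/negP => s1.
  have := sg_le tb; have := v_le3 tb => h1 h2.
  have sle1 : sg t <= 1 by lra.
  by have := vup_fixpoint s1 sle1; lra.
have := vup_barrier s0 s1; rewrite vt => h.
apply: upper_contact v0 t0 _.
by apply: lt_le_trans h _; lra.
Qed.

Lemma slope_lower x : 0 < x <= b -> vlo (sg x) < 10000 * v x.
Proof.
move=> xb; suff : 0 < 10000 * v x - vlo (sg x) by lra.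
apply: (@from_zero (fun x => 10000 * v x - vlo (sg x)) (fun x =>
   (10000 * (1 + 2 * sg x - v x) - vlo' (sg x) * (sg x * (2 + sg x - v x)) / v x) / x) x _ _ _ _ xb).
- move=> t t0; rewrite /vlo; cont_rec; try exact: csg; exact: cv.
- by rewrite v00 sg0 /vlo; lra.
- move=> t t0; rewrite /vlo; deriv; try exact: dsg; try exact: dv.
  rewrite /vlo'; field; rewrite !gt_eqF//; exact: v_gt0 (ltW t0).
move=> t tb /eqP; rewrite subr_eq0 => /eqP vt.
have /andP[t0 _] := tb; have v0 := v_gt0 (ltW t0).
have s0 := sg_ge0 (ltW t0).
have [_ s1] := slope_upper tb.
have := vlo_barrier s0 s1; rewrite -vt => h.
apply: lower_contact v0 t0 _.
by apply: lt_le_trans h _; lra.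
Qed.

Let dH x : 0 < x -> is_derive x 1 H (sg x * H x / v x / x).
Proof.
move=> x0; apply: (is_derive_eq (profile_derive prof (ltW x0))).
rewrite /sg /pp; field.
by rewrite (gt_eqF x0) H0 ?(ltW x0)// (gt_eqF (v_gt0 (ltW x0))).
Qed.

(** The quotient of H by its polynomial bound, both taken along the
    trajectory, decreases. *)
Lemma profile_upper : 1000 * H b <= hup (sg b).
Proof.
have hg x : 0 < x <= b -> 0 < hup (sg x).
  move=> xb; have [_ s1] := slope_upper xb.
  by apply: hup_gt0 => //; apply: sg_ge0; case/andP: xb => /ltW.
have hg0 : 0 < hup (sg 0) by rewrite sg0 /hup; lra.
have := @derive_le0_le _ (fun x => H x / hup (sg x)) (fun x =>
  (sg x * H x / hup (sg x) ^+ 2 / v x) *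
  (hup (sg x) - hup' (sg x) * (2 + sg x - v x)) / x) 0 b (ltW b0).
rewrite (profile0 prof) [hup (sg 0)]/hup sg0 => h.
have {}h : H b / hup (sg b) <= 1 / 1000.
  have -> : 1 / 1000 = 1 / (1000 + 1004 * 0 + 489 * 0 ^+ 2 + 381 * 0 ^+ 3 - 133 * 0 ^+ 4 + 490 * 0 ^+ 5) :> R.
    by congr (_ / _); ring.
  apply: h.
  - apply: continuous_in_subspaceT => x; rewrite inE /= in_itv /= => /andP[x0 xb].
    apply: cont_mul; first exact: cH.
    apply: cont_inv; first by rewrite /hup; cont_rec; exact: csg.
    rewrite gt_eqF//; move: x0; rewrite le_eqVlt => /orP[/eqP <-//|x0].
    by apply: hg; rewrite x0.
  - move=> x /andP[x0 xb]; have x0b : 0 < x <= b by rewrite x0 ltW.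
    have hx := hg x x0b; have vx := v_gt0 (ltW x0).
    have dh : is_derive x 1 (fun t => hup (sg t))
        (hup' (sg x) * (sg x * (2 + sg x - v x) / v x / x)).
      rewrite /hup; deriv; try exact: dsg.
      by rewrite /hup'; ring.
    deriv; [exact: dH|by rewrite gt_eqF|exact: dh|].
    by field; rewrite !gt_eqF.
  move=> x /andP[x0 xb]; have x0b : 0 < x <= b by rewrite x0 ltW.
  have [vx s1] := slope_upper x0b; have s0 := sg_ge0 (ltW x0).
  apply: mulr_le0_ge0; last by rewrite invr_ge0 ltW.
  apply: mulr_ge0_le0.
    apply: divr_ge0; last exact: ltW (v_gt0 (ltW x0)).
    apply: divr_ge0; last exact: sqr_ge0.
    by apply: mulr_ge0 => //; exact: ltW (profile_gt0 mu1 prof (ltW x0)).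
  have := hup_barrier s0 s1.
  have : 0 <= hup' (sg x) * (vup (sg x) - 1000 * v x).
    apply: mulr_ge0; first exact: hup'_ge0.
    by rewrite subr_ge0; exact: ltW vx.
  by lra.
have bb : 0 < b <= b by rewrite b0 lexx.
by move: h; rewrite ler_pdivrMr ?hg//; lra.
Qed.

Lemma profile_lower : hlo (sg b) <= 10000 * H b.
Proof.
have hg x : 0 < x <= b -> 0 < hlo (sg x).
  move=> xb; have [_ s1] := slope_upper xb.
  by apply: hlo_gt0 => //; apply: sg_ge0; case/andP: xb => /ltW.
have hg0 : 0 < hlo (sg 0) by rewrite sg0 /hlo; lra.
have := @derive_ge0_le _ (fun x => H x / hlo (sg x)) (fun x =>
  (sg x * H x / hlo (sg x) ^+ 2 / v x) *
  (hlo (sg x) - hlo' (sg x) * (2 + sg x - v x)) / x) 0 b (ltW b0).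
rewrite (profile0 prof) [hlo (sg 0)]/hlo sg0 => h.
have {}h : 1 / 10000 <= H b / hlo (sg b).
  have -> : 1 / 10000 = 1 / (10000 + 9998 * 0 + 4990 * 0 ^+ 2 + 2879 * 0 ^+ 3 + 1035 * 0 ^+ 4
  + 3602 * 0 ^+ 5 - 3690 * 0 ^+ 6 + 4172 * 0 ^+ 7) :> R.
    by congr (_ / _); ring.
  apply: h.
  - apply: continuous_in_subspaceT => x; rewrite inE /= in_itv /= => /andP[x0 xb].
    apply: cont_mul; first exact: cH.
    apply: cont_inv; first by rewrite /hlo; cont_rec; exact: csg.
    rewrite gt_eqF//; move: x0; rewrite le_eqVlt => /orP[/eqP <-//|x0].
    by apply: hg; rewrite x0.
  - move=> x /andP[x0 xb]; have x0b : 0 < x <= b by rewrite x0 ltW.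
    have hx := hg x x0b; have vx := v_gt0 (ltW x0).
    have dh : is_derive x 1 (fun t => hlo (sg t))
        (hlo' (sg x) * (sg x * (2 + sg x - v x) / v x / x)).
      rewrite /hlo; deriv; try exact: dsg.
      by rewrite /hlo'; ring.
    deriv; [exact: dH|by rewrite gt_eqF|exact: dh|].
    by field; rewrite !gt_eqF.
  move=> x /andP[x0 xb]; have x0b : 0 < x <= b by rewrite x0 ltW.
  have [_ s1] := slope_upper x0b; have vx := slope_lower x0b.
  have s0 := sg_ge0 (ltW x0).
  apply: divr_ge0; last exact: ltW.
  apply: mulr_ge0.
    apply: divr_ge0; last exact: ltW (v_gt0 (ltW x0)).
    apply: divr_ge0; last exact: sqr_ge0.
    by apply: mulr_ge0 => //; exact: ltW (profile_gt0 mu1 prof (ltW x0)).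
  have := hlo_barrier s0 s1.
  have : 0 <= hlo' (sg x) * (10000 * v x - vlo (sg x)).
    apply: mulr_ge0; first exact: hlo'_ge0.
    by rewrite subr_ge0; exact: ltW vx.
  by lra.
have bb : 0 < b <= b by rewrite b0 lexx.
by move: h; rewrite ler_pdivlMr ?hg//; lra.
Qed.

(** At the crossing p = 1 / 3 one has 3 sg = v and z = 1 / (3 v), so that
    enclosures of sg, v and H there give those of z and H. *)
Theorem planar_bounds :
  788 / 4000 < z b < 790 / 4000 /\ 1 / (1 - 444 / 1000) < H b < 1 / (1 - 446 / 1000).
Proof.
have bb : 0 < b <= b by rewrite b0 lexx.
have [vu s1] := slope_upper bb; have vl := slope_lower bb.
have s0 := sg_ge0 (ltW b0); have vb := v_gt0 (ltW b0).
have sb : 3 * sg b = v b.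
  by rewrite /sg pb mulrA mulrA [3 * (1 / 3)]mulrA mulr1 mulfV ?mul1r.
have zv : 3 * v b * z b = 1.
  by rewrite -mulrA -pv// pb mulrA mulr1 mulfV.
exact: bounds_at_crossing vb s0 s1 sb vl vu zv profile_lower profile_upper.
Qed.

End planar_numerics.

(** * The maximum of z and its dependence on mu *)

Section phase_maximum.
Context {R : realType}.
Implicit Types (x y a b c e t r mu : R) (H G : R -> R).

Definition profile_pair mu : (R -> R) * (R -> R) :=
  get [set HG | profile mu HG.1 HG.2].
Definition prH mu := (profile_pair mu).1.
Definition prG mu := (profile_pair mu).2.

Lemma prP mu : -1 < mu -> profile mu (prH mu) (prG mu).
Proof.
move=> /profile_exists[H [G HG]].
exact: (@getPex _ [set HG | profile mu HG.1 HG.2] (ex_intro _ (H, G) HG)).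
Qed.

Definition zmax mu := sup [set zz (prH mu) x | x in [set x | 0 < x]].

Lemma zmax_crossing mu b : -1 < mu -> - (2 / 3) <= mu -> 0 < b ->
  pp (prH mu) (prG mu) b = 1 / 3 ->
  (forall x, 0 < x < b -> pp (prH mu) (prG mu) x < 1 / 3) ->
  zmax mu = zz (prH mu) b.
Proof.
move=> mu1 mu2 b0 pb hp.
have ub : ubound [set zz (prH mu) x | x in [set x | 0 < x]] (zz (prH mu) b).
  by move=> _ [x /= x0 <-]; exact: (zz_le_crossing mu1 (prP mu1) mu2 b0 pb hp).
apply/eqP; rewrite eq_le; apply/andP; split.
  by apply: ge_sup => //; exists (zz (prH mu) b), b.
by apply: ub_le_sup; [exists (zz (prH mu) b)|exists b].
Qed.

Lemma invcube_lip a b : 1 <= a -> 1 <= b -> `|a ^- 3 - b ^- 3| <= 3 * `|a - b|.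
Proof.
move=> a1 b1.
have a0 : 0 < a by rewrite (lt_le_trans _ a1).
have b0 : 0 < b by rewrite (lt_le_trans _ b1).
have -> : a ^- 3 - b ^- 3 =
    (a^-1 * b ^- 3 + a ^- 2 * b ^- 2 + a ^- 3 * b^-1) * (b - a).
  by field; rewrite !gt_eqF.
have inv1 n : 0 <= a ^- n <= 1 /\ 0 <= b ^- n <= 1.
  split; apply/andP; split.
  - by rewrite invr_ge0 exprn_ge0// ltW.
  - by rewrite invf_le1 ?exprn_gt0// exprn_ege1.
  - by rewrite invr_ge0 exprn_ge0// ltW.
  - by rewrite invf_le1 ?exprn_gt0// exprn_ege1.
have [/andP[a10 a11] /andP[b10 b11]] := inv1 1%N.
have [/andP[a20 a21] /andP[b20 b21]] := inv1 2%N.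
have [/andP[a30 a31] /andP[b30 b31]] := inv1 3%N.
rewrite normrM (distrC b) ler_wpM2r// ger0_norm; last first.
  by rewrite !addr_ge0 // mulr_ge0.
have l1 : a^-1 * b ^- 3 <= 1 by rewrite mulr_ile1.
have l2 : a ^- 2 * b ^- 2 <= 1 by rewrite mulr_ile1.
have l3 : a ^- 3 * b^-1 <= 1 by rewrite mulr_ile1.
by lra.
Qed.

(** Gronwall comparison with the planar profile: as long as the
    difference is below e exp (3 x), its slope, a weighted average, is below
    3 e exp (3 x). *)
Lemma profile_near_planar mu e x H G H' G' : `|mu| <= 1 / 2 -> 2 * `|mu| < e ->
  profile mu H G -> profile 0 H' G' -> 0 <= x ->
  `|H x - H' x| <= e * expR (3 * x).
Proof.
move=> mub mue prof prof' x0.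
have mu1 : -1 < mu by move: mub; rewrite ler_norml => /andP[]; lra.
have mu1' : -1 < 0 :> R by lra.
have e0 : 0 < e by apply: le_lt_trans mue; rewrite mulr_ge0.
pose E t := e * expR (3 * t).
have Emono s t : s <= t -> E s <= E t.
  by move=> st; rewrite /E ler_pM2l// ler_expR ler_pM2l.
have Ege t : 0 <= t -> e <= E t.
  by move=> /Emono; rewrite {1}/E mulr0 expR0 mulr1.
have dE t : is_derive t 1 E (3 * E t).
  have de : is_derive t 1 (fun t => expR (3 * t)) (expR (3 * t) * 3).
    apply: (@is_derive_compf _ expR (fun t => 3 * t)).
    by deriv; rewrite mul0r add0r mulr1.
  by rewrite /E; deriv; [exact: de|ring].
pose d t := H t - H' t; pose D t := G t - G' t.
have dd t : 0 <= t -> is_derive t 1 d (D t).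
  move=> t0; rewrite /d; deriv;
    [exact: (profile_derive prof)|exact: (profile_derive prof')|by []].
have d0 : d 0 = 0 by rewrite /d (profile0 prof) (profile0 prof') subrr.
rewrite leNgt; apply/negP => /ltW lt.
have cf t : 0 <= t <= x -> continuous_at t (fun t => E t - `|d t|).
  move=> /andP[t0 _]; apply: cont_add; first exact: is_derive_continuous (dE t).
  apply: cont_opp; apply: (@cont_comp _ _ d t _ (fun s : R => `|s|)).
    exact: is_derive_continuous (dd _ t0).
  exact: norm_continuous.
have E00 : 0 < E 0 - `|d 0| by rewrite d0 normr0 subr0 /E mulr0 expR0 mulr1.
have Ex : E x - `|d x| <= 0 by rewrite subr_le0.
(* up to the first point c where the bound is attained, it may be used
   in the right-hand side *)
have [c /andP[c0 cx] [fc hc]] := first_zero x0 cf E00 Ex.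
have slope t : 0 < t <= c -> `|D t| <= 3 * E t.
  move=> /andP[t0 tc].
  have eqD s : 0 < s <= t -> is_derive s 1 D
      ((H s ^- 2 - H' s ^- 2 - mu * G s - 1 * D s) / s).
    move=> /andP[s0 _]; rewrite /D; deriv;
      [exact: (profile_eq prof)|exact: (profile_eq prof')|].
    by rewrite -mulrBl; congr (_ / _); ring.
  have bnd s : 0 < s <= t -> `|H s ^- 2 - H' s ^- 2 - mu * G s| <= 3 * E t.
    move=> /andP[s0 st]; have s0' := ltW s0.
    have h1 := invsq_lip (profile_ge1 mu1 prof s0') (profile_ge1 mu1' prof' s0').
    have h2 : `|H s - H' s| <= E s.
      rewrite -subr_ge0; have [sc|cs] := ltP s c.
        by apply: ltW; apply: hc; rewrite s0'.
      have -> : s = c by apply/eqP; rewrite eq_le cs (le_trans st).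
      by rewrite fc.
    have h3 : `|mu * G s| <= 2 * `|mu|.
      rewrite normrM mulrC ler_wpM2r// ger0_norm ?(slope_ge0 mu1 prof)//.
      have := slope_le mu1 prof s0'; have := slope_ge0 mu1 prof s0'.
      move: mub; rewrite ler_norml => /andP[m1 _] g0.
      have : 0 <= (mu + 1 / 2) * G s by rewrite mulr_ge0//; lra.
      by lra.
    have h4 := Emono _ _ st.
    have h5 := Ege _ s0'.
    have := ler_normB (H s ^- 2 - H' s ^- 2) (mu * G s).
    by lra.
  have cD : continuous_at 0 D.
    apply: cont_add; first exact: (profile_cont prof).
    by apply: cont_opp; exact: (profile_cont prof').
  have l1 : 1 * D t <= 3 * E t.
    apply: (average_le ltr01 cD eqD _ t0) => s /bnd.
    by apply: le_trans; exact: ler_norm.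
  have l2 : - (3 * E t) <= 1 * D t.
    by apply: (average_ge ltr01 cD eqD _ t0) => s /bnd; rewrite ler_norml => /andP[].
  by rewrite ler_norml -[D t]mul1r l1 l2.
have := @derive_norm_le _ d D E (fun t => 3 * E t) 0 c (ltW c0).
rewrite d0 subr0 => h.
have : `|d c| <= E c - E 0.
  have dd' t : 0 <= t <= c -> is_derive t 1 d (D t) by move=> /andP[/dd].
  apply: (h dd' (fun t _ => dE t)).
  by move=> t /andP[t0 tc]; apply: slope; rewrite t0 ltW.
have := Ege 0 (lexx 0); move: fc; lra.
Qed.

(** Near mu = 0 the profiles are uniformly close on a bounded interval
    [0, x2].  For mu = 0, z has dropped strictly below its maximum at x2, so
    that the crossing of the nearby trajectories occurs before x2 and
    the maxima are compared on that interval. *)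
Lemma zmax_continuous e : 0 < e ->
  exists2 d, 0 < d & forall mu, `|mu| < d -> `|zmax mu - zmax 0| <= e.
Proof.
move=> e0.
have mu1 : -1 < 0 :> R by lra.
have prof := prP mu1; set H := prH 0 in prof *; set G := prG 0 in prof *.
have gap : 0 <= 0 :> R \/ (0 + 2 / 3) ^+ 2 < 4 * (0 + 1 / 3) :> R by left.
have [b b0 [pb hb]] := crossing_exists mu1 prof gap.
have [/andP[zb1 _] _] := planar_bounds prof b0 pb hb.
have mu2 : - (2 / 3) <= 0 :> R by lra.
have z0E : zmax 0 = zz H b by exact: zmax_crossing.
(* just after b one has p > 1 / 3, because z b > 1 / 9 makes p increase *)
have [x2 bx2 zx2] : exists2 x2, b < x2 & zz H x2 < zz H b.
  have cz t : 0 < t -> continuous_at t (zz H).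
    by move=> t0; exact: is_derive_continuous (zz_derive mu1 prof t0).
  have cp t : 0 < t -> continuous_at t (pp H G).
    by move=> t0; exact: is_derive_continuous (pp_derive mu1 prof t0).
  have cf : continuous_at b (fun t => zz H t - pp H G t ^+ 2 - 0 * pp H G t).
    cont_rec; try exact: cp; exact: cz.
  have f0 : 0 < zz H b - pp H G b ^+ 2 - 0 * pp H G b.
    by rewrite pb; clear - zb1; lra.
  have [d d0 hd] := cont_eps cf f0.
  have fpos t : b <= t <= b + d / 2 -> 0 < zz H t - pp H G t ^+ 2 - 0 * pp H G t.
    move=> /andP[bt tb].
    have := hd t; rewrite distrC ger0_norm ?subr_ge0//.
    have td : t - b < d by clear - tb d0; lra.
    by move=> /(_ td); rewrite ltr_norml => /andP[_]; clear; lra.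
  have pgt t : b < t <= b + d / 2 -> 1 / 3 < pp H G t.
    move=> /andP[bt tb]; rewrite -pb.
    apply: (@derive_itv_gt0_lt _ (pp H G) (fun t =>
      (zz H t - pp H G t ^+ 2 - 0 * pp H G t) / t) b t bt).
      move=> s /andP[bs _]; apply: (pp_derive mu1 prof); exact: lt_le_trans bs.
    move=> s /andP[bs st]; apply: divr_gt0; last exact: lt_trans bs.
    apply: fpos; apply/andP; split; first exact: ltW.
    exact: le_trans (ltW st) tb.
  have bd : b < b + d / 2 by rewrite ltrDl divr_gt0.
  exists (b + d / 2) => //.
  rewrite -ltrN2.
  apply: (@derive_itv_gt0_lt _ (fun t => - zz H t) (fun t =>
      - (zz H t * (1 - 3 * pp H G t) / t)) b _ bd).
    move=> s /andP[bs _]; apply: is_deriveNf; apply: (zz_derive mu1 prof).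
    exact: lt_le_trans bs.
  move=> s /andP[bs st]; have s0 := lt_trans b0 bs.
  rewrite oppr_gt0 ltr_pdivrMr// mul0r pmulr_rlt0 ?(zz_gt0 mu1 prof)//.
  have : 1 / 3 < pp H G s by apply: pgt; rewrite bs ltW.
  by clear; lra.
have x20 := lt_trans b0 bx2.
pose e' := Num.min e ((zz H b - zz H x2) / 3).
have e'0 : 0 < e' by rewrite /e' lt_min e0 divr_gt0// subr_gt0.
have e'e : e' <= e by rewrite /e' ge_min lexx.
have e'z : e' <= (zz H b - zz H x2) / 3 by rewrite /e' ge_min lexx orbT.
pose C := 3 * x2 * expR (3 * x2).
have C0 : 0 < C by rewrite !mulr_gt0// expR_gt0.
exists (Num.min (1 / 10) (e' / C / 2)).
  by rewrite lt_min; apply/andP; split; [|rewrite !divr_gt0].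
move=> mu; rewrite lt_min => /andP[m1 m2].
have mub : - (1 / 10) < mu < 1 / 10 by rewrite -ltr_norml.
have mu1' : -1 < mu by clear - mub; case/andP: mub; lra.
have mu2' : - (2 / 3) <= mu by clear - mub; case/andP: mub; lra.
have profm := prP mu1'; set Hm := prH mu in profm *; set Gm := prG mu in profm *.
have gapm : mu <= 0 \/ (mu + 2 / 3) ^+ 2 < 4 * (mu + 1 / 3).
  by right; clear - mub; case/andP: mub => l u; nra.
have [bm bm0 [pbm hbm]] := crossing_exists mu1' profm gapm.
have zmE : zmax mu = zz Hm bm by exact: zmax_crossing.
have close x : 0 < x <= x2 -> `|zz Hm x - zz H x| <= e'.
  move=> /andP[x0 xx2]; have x0' := ltW x0.
  have -> : zz Hm x - zz H x = x * (Hm x ^- 3 - H x ^- 3) by rewrite /zz mulrBr.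
  rewrite normrM (gtr0_norm x0).
  have h1 := invcube_lip (profile_ge1 mu1' profm x0') (profile_ge1 mu1 prof x0').
  have mh : `|mu| <= 1 / 2 by clear - m1; lra.
  have me : 2 * `|mu| < e' / C by clear - m2; lra.
  have h2 := profile_near_planar mh me profm prof x0'.
  apply: (@le_trans _ _ (x2 * (3 * (e' / C * expR (3 * x2))))).
    apply: ler_pM => //; apply: le_trans h1 _; rewrite ler_pM2l//.
    apply: le_trans h2 _; rewrite ler_pM2l ?divr_gt0// ler_expR ler_pM2l//.
  rewrite le_eqVlt; apply/orP; left; apply/eqP; rewrite /C; field.
  by rewrite !gt_eqF// expR_gt0.
have cb : `|zz Hm b - zz H b| <= e' by apply: close; rewrite b0 ltW.
have cx2 : `|zz Hm x2 - zz H x2| <= e' by apply: close; rewrite x20 lexx.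
have bmx2 : bm < x2.
  rewrite ltNge; apply/negP => le.
  have := zz_lt mu1' profm hbm b0 bx2 le.
  move: cb cx2; rewrite !ler_norml => /andP[c1 c2] /andP[c3 c4].
  by clear - c1 c2 c3 c4 e'z e'0; lra.
have cbm : `|zz Hm bm - zz H bm| <= e' by apply: close; rewrite bm0 ltW.
have le1 := zz_le_crossing mu1 prof mu2 b0 pb hb bm0.
have le2 := zz_le_crossing mu1' profm mu2' bm0 pbm hbm b0.
rewrite zmE z0E; move: cb cbm; rewrite !ler_norml => /andP[c1 c2] /andP[c3 c4].
by apply/andP; split; clear - c1 c2 c3 c4 le1 le2 e'e; lra.
Qed.

End phase_maximum.

(** * The Euclidean ball and the weak maximum principle *)

Section sqnorm.
Context {R : realType} {N : nat}.
Implicit Types (x y v : 'rV[R]_N) (t r e : R) (i j : 'I_N) (u w : 'rV[R]_N -> R).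

(** Radial functions are written in terms of the square of the Euclidean norm,
    which is smooth at the origin. *)
Definition sqnorm x : R := \sum_(i < N) x 0 i ^+ 2.

Lemma sqnorm_ge0 x : 0 <= sqnorm x.
Proof. by apply: sumr_ge0 => i _; exact: sqr_ge0. Qed.

Lemma sqnorm0 : sqnorm 0 = 0.
Proof. by rewrite /sqnorm big1// => i _; rewrite mxE expr0n. Qed.

Lemma sqnorm_eq0 x : (sqnorm x == 0) = (x == 0).
Proof.
apply/idP/idP => [|/eqP ->]; last by rewrite sqnorm0.
rewrite psumr_eq0 => [/allP h|i _]; last exact: sqr_ge0.
apply/eqP/rowP => i; have := h i; rewrite mem_index_enum => /(_ isT).
by rewrite sqrf_eq0 => /eqP ->; rewrite mxE.
Qed.

Lemma sqnorm_gt0 x : (0 < sqnorm x) = (x != 0).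
Proof. by rewrite lt_def sqnorm_eq0 sqnorm_ge0 andbT. Qed.

Lemma sqr_coord_le x i : x 0 i ^+ 2 <= sqnorm x.
Proof.
rewrite /sqnorm (bigD1 i)//= lerDl.
by apply: sumr_ge0 => j _; exact: sqr_ge0.
Qed.

Lemma sqnorm_continuous : continuous sqnorm.
Proof.
move=> x; rewrite /sqnorm.
have -> : (fun y => \sum_(i < N) y 0 i ^+ 2) =
    \sum_(i < N) (fun y : 'rV[R]_N => y 0 i ^+ 2).
  by apply/funext => y; rewrite fct_sumE.
apply: (@big_ind _ (fun f : 'rV[R]_N -> R => continuous_at x f)).
- exact: cont_cst.
- by move=> f g cf cg; exact: cont_add.
- by move=> i _; apply: cont_exp; exact: coord_continuous.
Qed.

Lemma enormE x : enorm x = Num.sqrt (sqnorm x).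
Proof. by []. Qed.

Lemma enorm_powR x t : enorm x `^ t = sqnorm x `^ (t / 2).
Proof.
by rewrite enormE -powR12_sqrt ?sqnorm_ge0// -powRrM mulrC.
Qed.

Lemma uballE x : uball x <-> sqnorm x < 1.
Proof.
rewrite /uball /= enormE -[X in _ < X]sqrtr1 ltr_sqrt//.
Qed.

Lemma cuballE x : cuball x <-> sqnorm x <= 1.
Proof. by rewrite /cuball /= enormE -[X in _ <= X]sqrtr1 ler_sqrt. Qed.

Lemma usphereE x : usphere x <-> sqnorm x = 1.
Proof.
rewrite /usphere /= enormE; split => [h|->]; last exact: sqrtr1.
by rewrite -[LHS]sqr_sqrtr ?sqnorm_ge0// h expr1n.
Qed.

Lemma sqnorm_line t x i :
  sqnorm (t *: delta_mx 0 i + x) = sqnorm x + (2 * x 0 i * t + t ^+ 2).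
Proof.
rewrite /sqnorm (bigD1 i)//= [in RHS](bigD1 i)//=.
rewrite !mxE !eqxx mulr1.
have -> : \sum_(j < N | j != i) (t *: delta_mx 0 i + x) 0 j ^+ 2 =
    \sum_(j < N | j != i) x 0 j ^+ 2.
  by apply: eq_bigr => j ji; rewrite !mxE eqxx (negbTE ji) mulr0 add0r.
by ring.
Qed.

Lemma coord_line t x i j : (t *: delta_mx 0 i + x) 0 j = t * (i == j)%:R + x 0 j.
Proof. by rewrite !mxE eqxx eq_sym. Qed.

Lemma line_continuous x v : continuous (fun t : R => t *: v + x).
Proof.
by move=> t; apply: cvgD; [exact: scalel_continuous|exact: cvg_cst].
Qed.

Lemma is_derive_lineP u x v (d : R) :
  is_derive x v u d <-> is_derive (0 : R) 1 (fun t => u (t *: v + x)) d.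
Proof.
have E : (fun h : R => h^-1 *: ((u \o shift x) (h *: v) - u x)) =
    (fun h : R => h^-1 *: (((fun t : R => u (t *: v + x)) \o shift 0) (h *: 1) -
      u (0 *: v + x))).
  by apply/funext => h /=; rewrite addr0 scale0r add0r [_%:A]mulr1.
split=> -[du <-].
  apply: DeriveDef; first by rewrite /derivable -E.
  by rewrite /derive -E.
apply: DeriveDef; first by rewrite /derivable E.
by rewrite /derive E.
Qed.

Lemma is_derive_along u x v t (d : R) : is_derive (t *: v + x) v u d ->
  is_derive t 1 (fun s : R => u (s *: v + x)) d.
Proof.
move=> /is_derive_lineP h.
have -> : (fun s : R => u (s *: v + x)) =
    (fun s : R => (fun r : R => u (r *: v + (t *: v + x))) (s - t)).
  by apply/funext => s /=; rewrite addrA -scalerDl subrK.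
have dst : is_derive t 1 (fun s : R => s - t) 1.
  by deriv; rewrite addr0.
rewrite -[d]mulr1; apply: (@is_derive_compf _ (fun r : R => u (r *: v + (t *: v + x)))) => //.
by rewrite subrr.
Qed.

Lemma min_second_derive (f g : R -> R) (L e : R) : 0 < e ->
  (forall t, `|t| < e -> is_derive t 1 f (g t)) ->
  (forall t, `|t| < e -> f 0 <= f t) -> is_derive (0 : R) 1 g L -> 0 <= L.
Proof.
move=> e0 fg fmin dg.
have n0 : `|0 : R| < e by rewrite normr0.
have g0 : g 0 = 0.
  have ee : - e <= e by have := ltW e0; lra.
  have fd t : t \in `](- e), e[%R -> derivable f t 1.
    by rewrite in_itv /= -ltr_norml => /fg[].
  have oin : 0 \in `](- e), e[%R by rewrite in_itv /= -ltr_norml.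
  have fm t : t \in `](- e), e[%R -> f 0 <= f t.
    by rewrite in_itv /= -ltr_norml; exact: fmin.
  have [_ d0] := derive1_at_min ee fd oin fm.
  by have [_ <-] := fg 0 n0.
rewrite leNgt; apply/negP => L0.
have /is_derive1_caratheodory[k [gk ck kL]] := dg.
have nL : 0 < - L by rewrite oppr_gt0.
have [d d0 hd] := cont_eps ck nL.
pose t := Num.min (e / 2) (d / 2).
have t0 : 0 < t by rewrite /t lt_min !divr_gt0.
have te : t < e by rewrite /t gt_min; apply/orP; left; lra.
have td : t < d by rewrite /t gt_min; apply/orP; right; lra.
have := @derive_itv_gt0_lt _ (fun s => - f s) (fun s => - g s) 0 t t0.
rewrite ltrN2 => h.
have : f t < f 0.
  apply: h => s /andP[s0 st].
    by apply: is_deriveNf; apply: fg; rewrite ger0_norm// (le_lt_trans st).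
  have := gk s; rewrite g0 !subr0 => ->.
  have := hd s; rewrite sub0r normrN gtr0_norm// => /(_ (lt_trans st td)).
  rewrite kL ltr_norml => /andP[l _].
  have ks : k s < 0 by move: l; lra.
  by rewrite oppr_gt0 pmulr_llt0.
by rewrite ltNge fmin// gtr0_norm.
Qed.

(** The second derivatives of w - u along the axes are nonnegative
    at a minimum. *)
Lemma laplacian_le_at_min (U : set 'rV[R]_N) u w x : open U -> U x ->
  C2_on U u -> C2_on U w -> (forall y, U y -> w x - u x <= w y - u y) ->
  laplacian u x <= laplacian w x.
Proof.
move=> oU Ux cu cw hmin.
apply: ler_sum => i _.
pose l (t : R) : 'rV[R]_N := t *: delta_mx 0 i + x.
have l0 : l 0 = x by rewrite /l scale0r add0r.
have [e e0 he] : exists2 e, 0 < e & forall t, `|t| < e -> U (l t).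
  have : nbhs (l 0) U by rewrite l0; exact: open_nbhs_nbhs.
  move=> /(@line_continuous x (delta_mx 0 i) 0) /nbhs_ballP[e /= e0 he].
  by exists e => // t te; apply: he; rewrite /ball /= sub0r normrN.
have [_ _ /(_ i i)[du2 _]] := cu x Ux.
have [_ _ /(_ i i)[dw2 _]] := cw x Ux.
rewrite -subr_ge0.
apply: (@min_second_derive (fun t => w (l t) - u (l t))
  (fun t => partial i w (l t) - partial i u (l t)) _ e e0).
- move=> t te; have [_ /(_ i)[du1 _] _] := cu _ (he _ te).
  have [_ /(_ i)[dw1 _] _] := cw _ (he _ te).
  by apply: is_deriveDf; [|apply: is_deriveNf]; apply: is_derive_along;
    exact: derivableP.
- by move=> t te; rewrite l0; apply: hmin; exact: he.
- have hx (f : 'rV[R]_N -> R) : derivable f x (delta_mx 0 i) ->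
      is_derive (0 : R) 1 (fun t => f (l t)) (partial i f x).
    by move=> df; apply/is_derive_lineP; exact: derivableP.
  by apply: is_deriveDf; [|apply: is_deriveNf]; apply: hx.
Qed.

Definition shell r : set 'rV[R]_N := [set x | r <= sqnorm x <= 1].

Lemma shell_compact r : compact (shell r).
Proof.
have cub : compact [set v : 'rV[R]_N | forall i, `[(- 1), 1]%classic (v ord0 i)].
  by apply: (@rV_compact R N (fun=> `[(- 1), 1]%classic)) => _; exact: segment_compact.
apply: (subclosed_compact _ cub).
  rewrite /shell; have -> : [set x | r <= sqnorm x <= 1] = sqnorm @^-1` `[r, 1]%classic.
    by apply/seteqP; split=> x /=; rewrite in_itv.
  apply: preimage_closed; last exact: itv_closed.
  by move=> x _; exact: sqnorm_continuous.
move=> x /= /andP[_ x1] i; rewrite /= in_itv /= -ler_norml.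
rewrite -(@ler_pXn2r _ 2) ?nnegrE// real_normK ?num_real// expr1n.
exact: le_trans (sqr_coord_le x i) x1.
Qed.

Lemma open_shell r : open [set x : 'rV[R]_N | r < sqnorm x < 1].
Proof.
have -> : [set x | r < sqnorm x < 1] = sqnorm @^-1` `]r, 1[%classic.
  by apply/seteqP; split=> x /=; rewrite in_itv.
by apply: open_comp; [move=> x _; exact: sqnorm_continuous|exact: itv_open].
Qed.

(** A minimum of w - u in the open annulus would contradict the strict
    inequality between the Laplacians, so that the minimum is on the boundary.
    For r < 0 the annulus is the whole ball. *)
Lemma shell_comparison r m u w :
  {within shell r, continuous (fun x => w x - u x)} ->
  C2_on [set x | r < sqnorm x < 1] u -> C2_on [set x | r < sqnorm x < 1] w ->
  (forall x, r < sqnorm x < 1 -> laplacian w x < laplacian u x) ->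
  (forall x, sqnorm x = r -> m <= w x - u x) ->
  (forall x, sqnorm x = 1 -> m <= w x - u x) ->
  forall x, shell r x -> m <= w x - u x.
Proof.
move=> cwu cu cw lap hr h1 x Sx.
have [c] := EVT_min_rV (ex_intro _ x Sx) (shell_compact (r := r)) cwu.
rewrite inE /shell /= => /andP[rc c1] hmin.
have {}hmin y : shell r y -> w c - u c <= w y - u y.
  by move=> Sy; apply: hmin; rewrite inE.
apply: le_trans (hmin x Sx).
have [rc'|] := ltP r (sqnorm c); last first.
  by move=> cr; apply: hr; apply/eqP; rewrite eq_le rc cr.
have [c1'|] := ltP (sqnorm c) 1; last first.
  by move=> ge1; apply: h1; apply/eqP; rewrite eq_le ge1 c1.
have Uc : r < sqnorm c < 1 by rewrite rc' c1'.
have := lap c Uc; rewrite ltNge => /negP[].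
apply: (@laplacian_le_at_min [set x | r < sqnorm x < 1] u w c (open_shell (r := r)) Uc cu cw) => y /andP[ry y1].
by apply: hmin; rewrite /shell /= (ltW ry) (ltW y1).
Qed.

End sqnorm.

(** * Laplacians of radial functions *)

Section radial.
Context {R : realType} {N : nat}.
Implicit Types (x y v : 'rV[R]_N) (t r e q : R) (i j : 'I_N) (F : R -> R).

(** What makes x |-> F |x|^2 of class C^2, with F1 and F2 the first two
    derivatives of F; s tells that the origin is excluded.  At the origin the
    second derivative is only asked to be small compared with 1 / q:
    F q may behave like q^(1 + alpha / 2), whose second derivative blows
    up when 0 < alpha < 2. *)
Record radial_profile (s : bool) F F1 F2 : Prop := RadialProfile {
  radial_derive : forall q, 0 < q -> is_derive q 1 F (F1 q);
  radial_derive2 : forall q, 0 < q -> is_derive q 1 F1 (F2 q);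
  radial_cont2 : forall q, 0 < q -> continuous_at q F2;
  radial_cont_0 : ~~ s -> continuous_at 0 (fun t => F `|t|);
  radial_cont1_0 : ~~ s -> continuous_at 0 (fun t => F1 `|t|);
  radial_cont2_0 : ~~ s -> continuous_at 0 (fun t => `|t| * F2 `|t|) }.

Lemma norm_cont_gt0 F q : 0 < q -> continuous_at q F ->
  continuous_at q (fun t => F `|t|).
Proof.
move=> q0 cF; apply: (@cont_comp _ _ (fun t : R => `|t|)).
  exact: norm_continuous.
by rewrite gtr0_norm.
Qed.

(** F is controlled on the right of 0 only, where F1 is bounded; so
    F (t^2) - F 0 is of the order of t^2. *)
Lemma even_derive0 F F1 : (forall q, 0 < q -> is_derive q 1 F (F1 q)) ->
  continuous_at 0 (fun t => F `|t|) -> continuous_at 0 (fun t => F1 `|t|) ->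
  is_derive (0 : R) 1 (fun t => F (t ^+ 2)) 0.
Proof.
move=> dF cF cF1.
apply/is_derive1_caratheodory; exists (fun t => (F (t ^+ 2) - F 0) / t).
split.
- move=> t; rewrite subr0 expr0n.
  by have [->|t0] := eqVneq t 0; [rewrite expr0n !mulr0 subrr|rewrite divfK].
- rewrite /prop_for /continuous_at /= invr0 mulr0; apply/cvgrPdist_lt => e e0.
  have [d d0 hd] := cont_eps cF1 ltr01.
  pose C := `|F1 0| + 1.
  have C0 : 0 < C by rewrite ltr_wpDl.
  pose d' := Num.min 1 (Num.min d (e / C)).
  have d'0 : 0 < d' by rewrite /d' !lt_min ltr01 d0 divr_gt0.
  apply/nbhs_ballP; exists d' => //= t; rewrite /ball /= sub0r normrN => td.
  rewrite sub0r normrN.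
  have [->|t0] := eqVneq t 0; first by rewrite invr0 mulr0 normr0.
  have nt0 : 0 < `|t| by rewrite normr_gt0.
  have t20 : 0 < t ^+ 2 by rewrite exprn_even_gt0.
  have [t1 tdd te] : [/\ `|t| < 1, `|t| < d & `|t| < e / C].
    by move: td; rewrite /d' !lt_min => /andP[-> /andP[-> ->]].
  have tt : t ^+ 2 <= `|t|.
    by rewrite -real_normK ?num_real// expr2 ler_piMl// ltW.
  have dFn s : 0 < s < t ^+ 2 -> is_derive s 1 (fun t => F `|t|) (F1 s).
    move=> /andP[s0 _]; apply: near_eq_is_derive (dF s s0).
    by apply: near_gt0_eq => // r r0; rewrite gtr0_norm.
  have cFn : {within `[0, t ^+ 2], continuous (fun t => F `|t|)}.
    apply: continuous_in_subspaceT => s; rewrite inE /= in_itv /= => /andP[].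
    rewrite le_eqVlt => /orP[/eqP <- _|s0 _]; first exact: cF.
    by apply: norm_cont_gt0 => //; exact: is_derive_continuous (dF _ s0).
  have [c] := MVT t20 (fun s (h : s \in `]0, t ^+ 2[) => dFn s h) cFn.
  rewrite in_itv /= normr0 (gtr0_norm t20) => /andP[c0 ct] ->.
  have Fc : `|F1 c| <= C.
    have := hd c; rewrite sub0r normrN normr0 gtr0_norm//.
    have cd : c < d by apply: lt_trans (lt_le_trans ct tt) tdd.
    move=> /(_ cd) h; rewrite /C; have := ler_distD (F1 0) 0 (F1 c).
    by rewrite !sub0r !normrN; lra.
  rewrite subr0 expr2 mulrA mulfK// normrM.
  apply: le_lt_trans (ler_wpM2r (normr_ge0 _) Fc) _.
  by rewrite mulrC -ltr_pdivlMr.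
- by rewrite invr0 mulr0.
Qed.

Section fixed_profile.
Variables (s : bool) (F F1 F2 : R -> R).
Hypothesis prof : radial_profile s F F1 F2.

Let u x := F (sqnorm x).
Let W := [set x : 'rV[R]_N | s -> x != 0].

Lemma regular_or_gt0 x : W x -> 0 < sqnorm x \/ x = 0 /\ ~~ s.
Proof.
move=> Wx; have [x0|x0] := eqVneq x 0; last by left; rewrite sqnorm_gt0.
by right; split=> //; apply/negP => /Wx; rewrite x0 eqxx.
Qed.

Lemma open_regular : open W.
Proof.
rewrite /W; case: (s); last first.
  have -> : [set x : 'rV[R]_N | false -> x != 0] = setT by apply/seteqP; split.
  exact: openT.
have -> : [set x : 'rV[R]_N | true -> x != 0] = @sqnorm R N @^-1` [set t : R | 0 < t].
  apply/seteqP; split=> x /=; rewrite sqnorm_gt0 //.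
  by move=> ->.
by apply: open_comp; [move=> x _; exact: sqnorm_continuous|exact: open_gt].
Qed.

Lemma sqnorm_line_derive x i :
  is_derive (0 : R) 1 (fun t => sqnorm (t *: delta_mx 0 i + x)) (2 * x 0 i).
Proof.
have -> : (fun t => sqnorm (t *: delta_mx 0 i + x)) =
    (fun t => sqnorm x + (2 * x 0 i * t + t ^+ 2)).
  by apply/funext => t; rewrite sqnorm_line.
by deriv; rewrite expr1; ring.
Qed.

Lemma radial_partial x i : W x ->
  is_derive x (delta_mx 0 i) u (2 * x 0 i * F1 (sqnorm x)).
Proof.
move=> /regular_or_gt0[q0|[-> ns]]; apply/is_derive_lineP.
  rewrite mulrC; apply: (@is_derive_compf _ F (fun t => sqnorm (t *: delta_mx 0 i + x))).
    by rewrite scale0r add0r; exact: (radial_derive prof).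
  exact: sqnorm_line_derive.
have -> : (fun t => u (t *: delta_mx 0 i + 0)) = (fun t => F (t ^+ 2)).
  by apply/funext => t; rewrite /u sqnorm_line sqnorm0 mxE mulr0 mul0r !add0r.
rewrite mxE mulr0 mul0r; apply: (even_derive0 (radial_derive prof)).
  exact: (radial_cont_0 prof).
exact: (radial_cont1_0 prof).
Qed.

Let p1 i x := 2 * x 0 i * F1 (sqnorm x).
Let p2 i j x := 2 * (i == j)%:R * F1 (sqnorm x) + 4 * x 0 i * x 0 j * F2 (sqnorm x).

Lemma radial_partial2 x i j : W x ->
  is_derive x (delta_mx 0 j) (p1 i) (p2 i j x).
Proof.
have coordE y : (fun t => (t *: delta_mx 0 j + y) 0 i) =
    (fun t : R => t * (i == j)%:R + y 0 i).
  by apply/funext => t; rewrite coord_line eq_sym.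
move=> /regular_or_gt0[q0|[-> ns]]; apply/is_derive_lineP.
  have d1 := is_derive_compf (f := F1) (x := 0) (b := 2 * x 0 j)
    (g := fun t => sqnorm (t *: delta_mx 0 j + x)) (a := F2 (sqnorm x)).
  have {}d1 : is_derive (0 : R) 1 (fun t => F1 (sqnorm (t *: delta_mx 0 j + x)))
      (F2 (sqnorm x) * (2 * x 0 j)).
    apply: d1; last exact: sqnorm_line_derive.
    by rewrite scale0r add0r; exact: (radial_derive2 prof).
  have d2 : is_derive (0 : R) 1 (fun t => (t *: delta_mx 0 j + x) 0 i) (i == j)%:R.
    by rewrite coordE; deriv; ring.
  rewrite /p1; deriv; [exact: d2|exact: d1|].
  by rewrite scale0r add0r /p2; ring.
apply/is_derive1_caratheodory.
exists (fun t => 2 * (i == j)%:R * F1 `|t ^+ 2|); split.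
- move=> t; rewrite /p1 !coord_line sqnorm_line sqnorm0 !mxE !(mulr0, mul0r, add0r, addr0, subr0).
  by rewrite ger0_norm ?sqr_ge0// eq_sym; ring.
- apply: cont_mul; first exact: cont_cst.
  apply: (@cont_comp _ _ (fun t : R => t ^+ 2) 0 _ (fun t => F1 `|t|)).
    by apply: cont_exp; exact: cvg_id.
  by rewrite expr0n; exact: (radial_cont1_0 prof).
- by rewrite /p2 expr0n normr0 sqnorm0 !mxE !mulr0 !mul0r addr0.
Qed.

Let comp_sqnorm_continuous (f : R -> R) x :
  (0 < sqnorm x -> continuous_at (sqnorm x) f) ->
  (x = 0 -> ~~ s -> continuous_at (0 : R) (fun t => f `|t|)) -> W x ->
  continuous_at x (fun y => f (sqnorm y)).
Proof.
move=> c1 c0 /regular_or_gt0 Wx.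
have -> : (fun y : 'rV[R]_N => f (sqnorm y)) = (fun y => (fun t => f `|t|) (sqnorm y)).
  by apply/funext => y; rewrite ger0_norm ?sqnorm_ge0.
apply: (@cont_comp _ _ (@sqnorm R N) x _ (fun t => f `|t|)).
  exact: sqnorm_continuous.
case: Wx => [q0|[x0 ns]]; first exact: norm_cont_gt0 (c1 q0).
by rewrite x0 sqnorm0; exact: c0.
Qed.

Lemma radial_continuous x : W x -> continuous_at x u.
Proof.
apply: comp_sqnorm_continuous => [q0|_ ns]; last exact: (radial_cont_0 prof).
exact: is_derive_continuous (radial_derive prof q0).
Qed.

Let p1_continuous x i : W x -> continuous_at x (p1 i).
Proof.
move=> Wx; apply: cont_mul.
  by apply: cont_mul; [exact: cont_cst|exact: coord_continuous].
apply: comp_sqnorm_continuous => // [q0|_ ns]; last exact: (radial_cont1_0 prof).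
exact: is_derive_continuous (radial_derive2 prof q0).
Qed.

Let p2_continuous x i j : W x -> continuous_at x (p2 i j).
Proof.
move=> Wx; apply: cont_add.
  apply: cont_mul; first exact: cont_cst.
  apply: comp_sqnorm_continuous => // [q0|_ ns]; last exact: (radial_cont1_0 prof).
  exact: is_derive_continuous (radial_derive2 prof q0).
have [q0|[-> ns]] := regular_or_gt0 Wx.
  apply: cont_mul.
    apply: cont_mul; last exact: coord_continuous.
    by apply: cont_mul; [exact: cont_cst|exact: coord_continuous].
  apply: (@cont_comp _ _ (@sqnorm R N) x _ F2); first exact: sqnorm_continuous.
  exact: (radial_cont2 prof).
have cq : continuous_at (0 : 'rV[R]_N) (fun y => sqnorm y * F2 (sqnorm y)).
  have -> : (fun y : 'rV[R]_N => sqnorm y * F2 (sqnorm y)) =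
      (fun y => (fun t => `|t| * F2 `|t|) (sqnorm y)).
    by apply/funext => y; rewrite ger0_norm ?sqnorm_ge0.
  apply: (@cont_comp _ _ (@sqnorm R N) 0 _ (fun t => `|t| * F2 `|t|)).
    exact: sqnorm_continuous.
  by rewrite sqnorm0; exact: (radial_cont2_0 prof).
have v0 : 4 * (0 : 'rV[R]_N) 0 i * (0 : 'rV[R]_N) 0 j * F2 (sqnorm (0 : 'rV[R]_N)) = 0.
  by rewrite !mxE !(mulr0, mul0r).
apply/(@cvgrPdist_lt _ _ _ (nbhs (0 : 'rV[R]_N))); rewrite v0 => e e0.
have e4 : 0 < e / 4 by rewrite divr_gt0.
have /cvgrPdist_lt /(_ _ e4) cq' := cq.
near=> y.
have h : `|sqnorm y * F2 (sqnorm y)| < e / 4.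
  have : `|sqnorm (0 : 'rV[R]_N) * F2 (sqnorm (0 : 'rV[R]_N)) - sqnorm y * F2 (sqnorm y)| < e / 4.
    by near: y; exact: cq'.
  by rewrite sqnorm0 mul0r sub0r normrN.
rewrite sub0r normrN.
apply: (@le_lt_trans _ _ (4 * `|sqnorm y * F2 (sqnorm y)|)); last by lra.
rewrite !normrM -!mulrA (ger0_norm (ler0n R 4)) ler_pM2l// mulrA.
rewrite ler_wpM2r// (ger0_norm (sqnorm_ge0 y)).
have := sqr_coord_le y i; have := sqr_coord_le y j.
have := sqr_ge0 (`|y 0 i| - `|y 0 j|).
rewrite -[y 0 i ^+ 2](@real_normK _ (y 0 i)) ?num_real//.
rewrite -[y 0 j ^+ 2](@real_normK _ (y 0 j)) ?num_real//.
by rewrite sqrrB; lra.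
Unshelve. all: by end_near. Qed.

Lemma radial_partialE x i : W x -> partial i u x = p1 i x.
Proof. by move=> Wx; rewrite /partial; have [_ ->] := radial_partial i Wx. Qed.

Let near_partial x i : W x -> \near x, p1 i x = partial i u x.
Proof.
move=> Wx; have := open_nbhs_nbhs (conj open_regular Wx).
by apply: filterS => y Wy; rewrite radial_partialE.
Qed.

Let partial_is_derive x i j : W x ->
  is_derive x (delta_mx 0 j) (partial i u) (p2 i j x).
Proof.
by move=> Wx; apply: near_eq_is_derive (radial_partial2 i j Wx); exact: near_partial.
Qed.

Let partial2E x i j : W x -> partial j (partial i u) x = p2 i j x.
Proof. by move=> Wx; rewrite {1}/partial; have [_ ->] := partial_is_derive i j Wx. Qed.

Let near_cont (f g : 'rV[R]_N -> R) x : (\near x, f x = g x) ->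
  continuous_at x f -> continuous_at x g.
Proof.
move=> fg cf; rewrite /continuous_at -(nbhs_singleton fg).
exact: cvg_trans (near_eq_cvg fg) cf.
Qed.

Lemma radial_C2 (U : set 'rV[R]_N) : U `<=` W -> C2_on U u.
Proof.
move=> UW x /UW Wx; split.
- exact: radial_continuous.
- move=> i; split; first by have [] := radial_partial i Wx.
  exact (near_cont (@near_partial x i Wx) (@p1_continuous x i Wx)).
- move=> i j; split; first by have [] := partial_is_derive i j Wx.
  suff h : \near x, p2 i j x = partial j (partial i u) x.
    exact (near_cont h (@p2_continuous x i j Wx)).
  have := open_nbhs_nbhs (conj open_regular Wx).
  by apply: filterS => y Wy; rewrite partial2E.
Qed.

(** The Laplacian of F |x|^2 is 4 |x|^2 F'' + 2 N F'. *)
Lemma radial_laplacian x : W x ->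
  laplacian u x = 4 * sqnorm x * F2 (sqnorm x) + 2 * N%:R * F1 (sqnorm x).
Proof.
move=> Wx; rewrite /laplacian; under eq_bigr do rewrite partial2E//.
rewrite /p2 big_split /= addrC; congr (_ + _).
  rewrite {2}/sqnorm mulr_sumr mulr_suml; apply: eq_bigr => i _.
  by rewrite expr2 !mulrA.
rewrite (eq_bigr (fun=> 2 * F1 (sqnorm x))).
  by rewrite sumr_const card_ord -[RHS]mulrA [N%:R * _]mulr_natl mulrnAr.
by move=> i _; rewrite eqxx mulr1.
Qed.

End fixed_profile.
End radial.

(** * Comparison with radial functions *)

Section comparison.
Context {R : realType} {N : nat}.
Implicit Types (x y : 'rV[R]_N) (t r e q m alpha : R) (F : R -> R) (v : 'rV[R]_N -> R).

Lemma cuball_shell : @cuball R N = shell (-1).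
Proof.
apply/seteqP; split=> x; rewrite /shell /=.
  by move=> /cuballE ->; rewrite andbT (le_trans _ (sqnorm_ge0 x))// lerN10.
by move=> /andP[_ /cuballE].
Qed.

Lemma open_uball : open (@uball R N).
Proof.
have -> : @uball R N = @sqnorm R N @^-1` [set t : R | t < 1].
  by apply/seteqP; split=> x /uballE.
by apply: open_comp; [move=> x _; exact: sqnorm_continuous|exact: open_lt].
Qed.

Lemma uball_cuball : @uball R N `<=` @cuball R N.
Proof. by move=> x /uballE/ltW/cuballE. Qed.

Lemma within_cuball_at v x : {within @cuball R N, continuous v} -> uball x ->
  continuous_at x v.
Proof.
move=> cv xB; have := continuous_subspaceW uball_cuball cv.
rewrite continuous_open_subspace; last exact: open_uball.
by apply; rewrite inE.
Qed.

Section comparison_principle.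
Variables (alpha : R) (F F1 F2 : R -> R) (v : 'rV[R]_N -> R) (m : R).
Hypotheses (N0 : (0 < N)%N) (N2 : alpha < 0 -> (2 <= N)%N).
Hypothesis prof : radial_profile (alpha < 0) F F1 F2.
Hypothesis cF0 : continuous_at 0 (fun t => F `|t|).
Hypotheses (vC2 : C2_on (mems_domain alpha) v)
  (vcont : {within @cuball R N, continuous v}).
Hypothesis lap : forall x, mems_domain alpha x ->
  laplacian v x <= 4 * sqnorm x * F2 (sqnorm x) + 2 * N%:R * F1 (sqnorm x).
Hypothesis bdry : forall x, usphere x -> m <= v x - F 1.

Let Fq_continuous : continuous (fun x : 'rV[R]_N => F (sqnorm x)).
Proof.
move=> x.
have -> : (fun y : 'rV[R]_N => F (sqnorm y)) = (fun y => (fun t => F `|t|) (sqnorm y)).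
  by apply/funext => y; rewrite ger0_norm ?sqnorm_ge0.
apply: (@cont_comp _ _ (@sqnorm R N) x _ (fun t => F `|t|)).
  exact: sqnorm_continuous.
have := sqnorm_ge0 x; rewrite le_eqVlt => /orP[/eqP <-//|q0].
apply: norm_cont_gt0 => //.
exact: is_derive_continuous (radial_derive prof q0).
Qed.

Let N0R : 0 < N%:R :> R. Proof. by rewrite ltr0n. Qed.

Let C2_sub (U : set 'rV[R]_N) : U `<=` mems_domain alpha -> C2_on U v.
Proof. by move=> UD x /UD; exact: vC2. Qed.

(** Adding e |x|^2 to the radial function makes the inequality between
    the Laplacians strict. *)
Lemma comparison_regular x : 0 <= alpha -> cuball x -> m <= v x - F (sqnorm x).
Proof.
move=> a0 xB.
have ns : ~~ (alpha < 0) by rewrite -leNgt.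
apply/ler_addgt0Pr => e e0.
pose Fe t := F t + e * t.
have pe : radial_profile false Fe (fun t => F1 t + e) F2.
  split=> [q q0|q q0|q q0|_|_|_].
  - by rewrite /Fe; deriv; [exact: (radial_derive prof)|ring].
  - by deriv; [exact: (radial_derive2 prof)|rewrite addr0].
  - exact: (radial_cont2 prof q0).
  - apply: cont_add; first exact: cF0.
    by apply: cont_mul; [exact: cont_cst|exact: norm_continuous].
  - by apply: cont_add; [exact: (radial_cont1_0 prof ns)|exact: cont_cst].
  - exact: (radial_cont2_0 prof ns).
have inB (y : 'rV[R]_N) : -1 < sqnorm y < 1 -> mems_domain alpha y.
  by move=> /andP[_ y1]; split; [exact/uballE|rewrite ltNge a0].
have /= := @shell_comparison R N (-1) (m - e) (fun x => Fe (sqnorm x)) v.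
move=> h; have : m - e <= v x - Fe (sqnorm x).
  apply: h.
  - rewrite -cuball_shell => y; apply: cvgB; first exact: vcont.
    apply: (@continuous_subspaceT _ _ _ (fun x => Fe (sqnorm x))) => {}y.
    apply: cont_add; first exact: Fq_continuous.
    by apply: cont_mul; [exact: cont_cst|exact: sqnorm_continuous].
  - by apply: (radial_C2 pe).
  - exact: C2_sub.
  - move=> y yB; rewrite (radial_laplacian pe)//.
    apply: le_lt_trans (lap (inB y yB)) _.
    by rewrite mulrDr addrA ltrDl !mulr_gt0.
  - by move=> y yN; have := sqnorm_ge0 y; rewrite yN oppr_ge0 ler10.
  - move=> y y1; rewrite /Fe y1 mulr1 opprD addrA lerB//.
    by apply: bdry; exact/usphereE.
  - by rewrite -cuball_shell.
rewrite /Fe opprD addrA => h'.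
have : 0 <= e * sqnorm x by rewrite mulr_ge0 ?(ltW e0)// sqnorm_ge0.
by lra.
Qed.

(** The origin is removable in dimension at least 2: adding
    e log |x|^2, which is subharmonic there and tends to - oo at the
    origin, makes the boundary inequality hold on a small sphere, and e tends to
    0 afterwards.  The value at the origin follows by continuity. *)
Lemma comparison_singular x : alpha < 0 -> cuball x -> m <= v x - F (sqnorm x).
Proof.
move=> a0 xB.
have cvF : {within @cuball R N, continuous (fun y => v y - F (sqnorm y))}.
  move=> y; apply: cvgB; first exact: vcont.
  exact: (@continuous_subspaceT _ _ _ (fun x => F (sqnorm x)) Fq_continuous).
have [c _ hc] := EVT_min_rV (ex_intro _ x xB)
  (ltac:(rewrite cuball_shell; exact: shell_compact) : compact (@cuball R N)) cvF.
set M := v c - F (sqnorm c) in hc.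
have {}hc y : cuball y -> M <= v y - F (sqnorm y) by move=> yB; apply: hc; rewrite inE.
have N2R : 2 <= N%:R :> R by rewrite ler_nat N2.
(* away from the origin: the inner radius r is so small that e * ln r
   outweighs the minimum M of v - F *)
have off y : cuball y -> y != 0 -> m <= v y - F (sqnorm y).
  move=> yB y0; have q0 : 0 < sqnorm y by rewrite sqnorm_gt0.
  have q1 : sqnorm y <= 1 by exact/cuballE.
  have lq : ln (sqnorm y) <= 0 by rewrite -ln1 ler_ln ?posrE.
  apply/ler_addgt0Pr => e' e'0.
  pose e := e' / (1 - ln (sqnorm y)).
  have l1 : 0 < 1 - ln (sqnorm y) by lra.
  have e0 : 0 < e by rewrite divr_gt0.
  pose Fe t := F t + e * t + e * ln t.
  have pe : radial_profile true Fe (fun t => F1 t + e + e * t^-1) (fun t => F2 t - e * t ^- 2).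
    split=> // q qp.
    - rewrite /Fe; deriv; [exact: (radial_derive prof)|exact: is_derive1_ln|].
      by ring.
    - deriv; [exact: (radial_derive2 prof)|by rewrite gt_eqF|].
      by rewrite mulNr; ring.
    - apply: cont_add; first exact: (radial_cont2 prof).
      cont_rec; first exact: cvg_id.
      by rewrite expf_neq0// gt_eqF.
  pose K := `|M| + `|m|.
  pose r := Num.min (sqnorm y) (expR (- (K / e))).
  have r0 : 0 < r by rewrite /r lt_min q0 expR_gt0.
  have rq : r <= sqnorm y by rewrite /r ge_min lexx.
  have rle1 : r <= 1 by exact: le_trans rq q1.
  have lr : e * ln r <= - K.
    apply: (@le_trans _ _ (e * ln (expR (- (K / e))))).
      by rewrite ler_pM2l// ler_ln ?posrE ?expR_gt0// /r ge_min lexx orbT.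
    by rewrite expRK mulrN mulrC divfK// gt_eqF.
  have inD (z : 'rV[R]_N) : r < sqnorm z < 1 -> mems_domain alpha z.
    move=> /andP[rz z1]; split; first exact/uballE.
    by move=> _; rewrite -sqnorm_gt0 (lt_trans r0).
  have := @shell_comparison R N r (m - e) (fun x => Fe (sqnorm x)) v.
  move=> h; have : m - e <= v y - Fe (sqnorm y).
    apply: h.
    - move=> z; apply: cvgB.
        apply: (continuous_subspaceW _ vcont) => w /andP[_ w1]; exact/cuballE.
      apply: (continuous_in_subspaceT (f := fun z => Fe (sqnorm z))) => {}z.
      rewrite inE => /andP[rz _]; have z0 := lt_le_trans r0 rz.
      apply: (@cont_comp _ _ (@sqnorm R N) z _ Fe); first exact: sqnorm_continuous.
      exact: is_derive_continuous (radial_derive pe z0).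
    - by apply: (radial_C2 pe) => z /inD[_ h0] _; exact: h0 a0.
    - exact: C2_sub.
    - move=> z /inD zD; have zn0 : z != 0 by case: zD => _; apply.
      have z0 : 0 < sqnorm z by rewrite sqnorm_gt0.
      rewrite (radial_laplacian pe)//; apply: le_lt_trans (lap zD) _.
      rewrite -subr_gt0.
      have -> : 4 * sqnorm z * (F2 (sqnorm z) - e * sqnorm z ^- 2) +
          2 * N%:R * (F1 (sqnorm z) + e + e * (sqnorm z)^-1) -
          (4 * sqnorm z * F2 (sqnorm z) + 2 * N%:R * F1 (sqnorm z)) =
          2 * e * (N%:R + (N%:R - 2) / sqnorm z).
        by field; rewrite gt_eqF.
      apply: mulr_gt0; first by rewrite mulr_gt0.
      apply: ltr_wpDr; last exact: N0R.
      by apply: divr_ge0; [rewrite subr_ge0|exact: sqnorm_ge0].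
    - move=> z zr; have zB : cuball z by apply/cuballE; rewrite zr.
      rewrite /Fe zr; have := hc z zB; rewrite zr.
      have : e * r <= e by rewrite ler_piMr// ltW.
      have := ler_norm (- M); rewrite normrN; have := ler_norm m.
      by move: lr; rewrite /K; lra.
    - move=> z z1; rewrite /Fe z1 ln1 mulr0 addr0 mulr1 opprD addrA lerB//.
      by apply: bdry; exact/usphereE.
    - by rewrite /shell /= rq q1.
  have ee : e' = e - e * ln (sqnorm y).
    by rewrite -[X in X - _]mulr1 -mulrBr /e divfK// gt_eqF.
  have : 0 <= e * sqnorm y by rewrite mulr_ge0 ?(ltW e0)// ltW.
  by rewrite /Fe ee; lra.
have [x0|] := eqVneq x 0; last exact: off.
rewrite x0 leNgt; apply/negP => lt.
have B0 : @uball R N 0 by apply/uballE; rewrite sqnorm0.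
have cat0 : continuous_at (0 : 'rV[R]_N) (fun y => v y - F (sqnorm y)).
  exact: within_cuball_at cvF B0.
have i : 'I_N by exact: Ordinal N0.
pose f (t : R) := v (t *: delta_mx 0 i + 0) - F (sqnorm (t *: delta_mx 0 i + 0 : 'rV[R]_N)).
have cf : continuous_at 0 f.
  apply: (@continuous_comp _ _ _ (fun t : R => t *: delta_mx 0 i + 0 : 'rV[R]_N)
    (fun y => v y - F (sqnorm y))); first exact: line_continuous.
  by rewrite scale0r add0r.
have f0 : f 0 < m by rewrite /f scale0r add0r.
have mf : 0 < m - f 0 by rewrite subr_gt0.
have [d d0 hd] := cont_eps cf mf.
pose t := Num.min (1 / 2) (d / 2).
have t0 : 0 < t by rewrite /t lt_min !divr_gt0.
have t1 : t < 1 by rewrite /t gt_min; apply/orP; left; lra.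
have td : t < d by rewrite /t gt_min; apply/orP; right; lra.
have qt : sqnorm (t *: delta_mx 0 i + 0 : 'rV[R]_N) = t ^+ 2.
  by rewrite sqnorm_line sqnorm0 mxE mulr0 mul0r !add0r.
have : m <= f t.
  apply: off; first by apply/cuballE; rewrite qt expr_le1// ltW.
  by rewrite -sqnorm_gt0 qt exprn_gt0.
have := hd t; rewrite sub0r normrN gtr0_norm// => /(_ td).
by rewrite ltr_norml => /andP[]; lra.
Qed.

Lemma radial_comparison x : cuball x -> m <= v x - F (sqnorm x).
Proof.
by have [a0|a0] := leP 0 alpha; [exact: comparison_regular|exact: comparison_singular].
Qed.

End comparison_principle.
End comparison.

(** * The radial branch of solutions *)

Section family.
Context {R : realType}.
Variables (mu th b c a : R) (H G : R -> R).
Hypotheses (mu1 : -1 < mu) (prof : profile mu H G).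
Hypotheses (th0 : 0 < th) (b0 : 0 < b).
Implicit Types (x t q e : R).

(** The functions a - c H (b |x|^(2 th)) with 2 th = 2 + alpha, as functions of
    q = |x|^2, and their first two derivatives.  The second derivative
    is written with the equation of the profile. *)
Definition fam q : R := a - c * H (b * q `^ th).
Definition fam1 q : R := - c * th * b * q `^ (th - 1) * G (b * q `^ th).
Definition fam2 q : R := - c * th * b * q `^ (th - 1) *
  (th * (H (b * q `^ th) ^- 2 - mu * G (b * q `^ th)) - G (b * q `^ th)) / q.

Let X_ge0 q : 0 <= b * q `^ th.
Proof. by rewrite mulr_ge0 ?powR_ge0// ltW. Qed.

Let pow_pred q : 0 < q -> q `^ (th - 1) = q `^ th / q.
Proof.
move=> q0; rewrite powRB ?powRr1 ?(ltW q0)//.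
by rewrite (gt_eqF q0) implybT.
Qed.

Let dX q : 0 < q -> is_derive q 1 (fun t => b * t `^ th) (b * th * q `^ (th - 1)).
Proof.
move=> q0; deriv; first exact: is_derive_powRf.
by rewrite pow_pred//; field; rewrite gt_eqF.
Qed.

Let cX : continuous (fun t : R => b * `|t| `^ th).
Proof.
by move=> t; apply: cont_mul; [exact: cont_cst|exact: norm_powR_continuous].
Qed.

Let cH x : 0 <= x -> continuous_at x H.
Proof. by move=> x0; exact: is_derive_continuous (profile_derive prof x0). Qed.

Let cHX t : continuous_at t (fun t : R => H (b * `|t| `^ th)).
Proof. by apply: (cont_comp (@cX t)); exact: cH. Qed.

Let cGX t : continuous_at t (fun t : R => G (b * `|t| `^ th)).
Proof. by apply: (cont_comp (@cX t)); exact: (profile_cont prof). Qed.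

Lemma fam_cont0 : continuous_at 0 (fun t => fam `|t|).
Proof.
apply: cont_add; first exact: cont_cst.
by apply: cont_opp; apply: cont_mul; [exact: cont_cst|exact: cHX].
Qed.

Let E t := - c * th * b * `|t| `^ (th - 1) *
  (th * (H (b * `|t| `^ th) ^- 2 - mu * G (b * `|t| `^ th)) - G (b * `|t| `^ th)).

Let cpow t : 1 <= th \/ 0 < t -> continuous_at t (fun t : R => `|t| `^ (th - 1)).
Proof.
move=> [th1|t0]; last first.
  by apply: (@norm_cont_gt0 _ (@powR R ^~ (th - 1)) _ t0); exact: powR_continuous_gt0.
move: th1; rewrite le_eqVlt => /orP[/eqP <-|th1].
  have -> : (fun t : R => `|t| `^ (1 - 1)) = (fun=> 1).
    by apply/funext => s; rewrite subrr powRr0.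
  exact: cont_cst.
by apply: norm_powR_continuous; rewrite subr_gt0.
Qed.

Let cE t : 1 <= th \/ 0 < t -> continuous_at t E.
Proof.
move=> h; rewrite /E; cont_rec; try exact: cpow; try exact: cGX; first exact: cHX.
by rewrite expf_neq0// gt_eqF// (profile_gt0 mu1 prof (X_ge0 _)).
Qed.

Let E_fam2 t : 1 <= th \/ 0 < t -> `|t| * fam2 `|t| = E t.
Proof.
move=> h; rewrite /fam2 -/(E t).
have [t00|t0] := eqVneq t 0; last by rewrite /E mulrC divfK ?normr_eq0.
rewrite t00 in h *; rewrite /E normr0 mul0r.
case: h => [|]; last by rewrite ltxx.
rewrite le_eqVlt => /orP[/eqP <-|th1].
  rewrite subrr powRr0 powRr1// mulr0 (profile0 prof) (profile_slope0 prof).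
  have m0 : 1 + mu != 0 by rewrite gt_eqF//; have := mu1; lra.
  by rewrite expr1n invr1; field.
by rewrite powR0 ?mulr0 ?mul0r// subr_eq0 gt_eqF.
Qed.

Lemma fam_radial : radial_profile (th < 1) fam fam1 fam2.
Proof.
split=> [q q0|q q0|q q0|_|ns|ns].
- have dHX := is_derive_compf (g := fun t => b * t `^ th)
    (profile_derive prof (X_ge0 q)) (dX q0).
  by rewrite /fam; deriv; [exact: dHX|rewrite /fam1; ring].
- have X0 : 0 < b * q `^ th by rewrite mulr_gt0// powR_gt0.
  have dGX := is_derive_compf (g := fun t => b * t `^ th)
    (profile_eq prof X0) (dX q0).
  rewrite /fam1; deriv; [exact: is_derive_powRf|exact: dGX|].
  have qt0 : q `^ th != 0 by rewrite gt_eqF ?powR_gt0.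
  have H0 : H (b * q `^ th) != 0 by rewrite gt_eqF// (profile_gt0 mu1 prof (X_ge0 _)).
  rewrite /fam2 pow_pred//; field.
  by rewrite qt0 H0 !gt_eqF.
- have : continuous_at q (fun t => E t * t^-1).
    apply: cont_mul; first by apply: cE; right.
    by apply: cont_inv; [exact: cvg_id|rewrite gt_eqF].
  rewrite /continuous_at.
  have eqq t : 0 < t -> E t * t^-1 = fam2 t.
    by move=> t0; rewrite -E_fam2; [rewrite gtr0_norm// mulrC mulKf// gt_eqF|right].
  rewrite eqq//; apply: cvg_trans; apply: near_eq_cvg.
  by apply: near_gt0_eq => // t t0; rewrite eqq.
- exact: fam_cont0.
- apply: cont_mul; last exact: cGX.
  apply: cont_mul; first exact: cont_cst.
  by apply: cpow; left; rewrite leNgt.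
- have -> : (fun t => `|t| * fam2 `|t|) = E.
    by apply/funext => t; apply: E_fam2; left; rewrite leNgt.
  by apply: cE; left; rewrite leNgt.
Qed.

Lemma fam_laplacian (N : nat) q : (0 < N)%N -> 2 * th * mu = N%:R - 2 ->
  0 <= q -> (th < 1 -> 0 < q) ->
  4 * q * fam2 q + 2 * N%:R * fam1 q =
  - (4 * c * th ^+ 2 * b * q `^ (th - 1) * H (b * q `^ th) ^- 2).
Proof.
move=> N0 thmu q0 qs.
have h : 1 <= th \/ 0 < q by have [/qs|] := ltP th 1; [right|left].
have -> : 4 * q * fam2 q = 4 * E q.
  by rewrite -E_fam2// ger0_norm// -[LHS]mulrA.
rewrite /E ger0_norm// /fam1.
have -> : N%:R = 2 * th * mu + 2 by rewrite thmu subrK.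
by ring.
Qed.

End family.

Section solutions.
Context {R : realType} (N : nat) (alpha : R).
Implicit Types (x y : 'rV[R]_N) (b c e lambda : R) (u v : 'rV[R]_N -> R).
Let th := (2 + alpha) / 2.
Let mu := (N%:R - 2) / (2 + alpha).
Variables (H G : R -> R).
Hypothesis N0 : (0 < N)%N.
Hypotheses (alpha2 : -2 < alpha) (mu1 : -1 < mu) (prof : profile mu H G).

Let a2 : 0 < 2 + alpha. Proof. by have := alpha2; lra. Qed.
Let th0 : 0 < th. Proof. by rewrite divr_gt0. Qed.
Let thmu : 2 * th * mu = N%:R - 2.
Proof. by rewrite /th /mu; field; rewrite gt_eqF. Qed.
Let th1 : th - 1 = alpha / 2. Proof. by rewrite /th; field. Qed.
Let sing : (th < 1) = (alpha < 0).
Proof. by rewrite -subr_lt0 th1 pmulr_llt0. Qed.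
Let H_gt0 (t : R) : 0 <= t -> 0 < H t. Proof. exact: (profile_gt0 mu1 prof). Qed.

Definition rad_sol b x : R := 1 - H (b * sqnorm x `^ th) / H b.
Definition rad_lambda b : R := (2 + alpha) ^+ 2 * zz H b.

Lemma mems_domain_gt0 x : mems_domain alpha x -> th < 1 -> 0 < sqnorm x.
Proof. by rewrite sing sqnorm_gt0 => -[_]. Qed.

Let pow_le1 x : cuball x -> sqnorm x `^ th <= 1.
Proof.
move=> /cuballE x1; apply: (@le_trans _ _ (1 `^ th)); last by rewrite powR1.
by apply: ge0_ler_powR; rewrite ?nnegrE ?sqnorm_ge0// ltW.
Qed.

Let X_ge0 b x : 0 <= b -> 0 <= b * sqnorm x `^ th.
Proof. by move=> b0; rewrite mulr_ge0// powR_ge0. Qed.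

Lemma rad_sol_bounds b x : 0 <= b -> cuball x -> 0 <= rad_sol b x <= 1 - (H b)^-1.
Proof.
move=> b0 xB; have Hb := H_gt0 b0; apply/andP; split.
  rewrite subr_ge0 ler_pdivrMr// mul1r; apply: (profile_le mu1 prof); first exact: X_ge0.
  by rewrite ler_piMr// pow_le1.
rewrite /rad_sol lerD2l lerN2 -[X in X <= _]mul1r ler_pM2r ?invr_gt0//.
by apply: (profile_ge1 mu1 prof); exact: X_ge0.
Qed.

Let rad_solE b : rad_sol b = (fun x => fam th b (H b)^-1 1 H (sqnorm x)).
Proof. by apply/funext => x; rewrite /fam mulrC. Qed.

Let fam_prof b c a : 0 < b -> radial_profile (alpha < 0) (fam th b c a H)
  (fam1 th b c G) (fam2 mu th b c H G).
Proof. by move=> b0; rewrite -sing; exact: fam_radial. Qed.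

Let sub_reg : @mems_domain R N alpha `<=` [set x | alpha < 0 -> x != 0].
Proof. by move=> x []. Qed.

Lemma rad_sol_laplacian b c x : 0 < b -> mems_domain alpha x ->
  4 * sqnorm x * fam2 mu th b c H G (sqnorm x) +
  2 * N%:R * fam1 th b c G (sqnorm x) =
  - (c * ((2 + alpha) ^+ 2 * b) * sqnorm x `^ (alpha / 2) *
     H (b * sqnorm x `^ th) ^- 2).
Proof.
move=> b0 xD.
rewrite (fam_laplacian b c mu1 prof N0 thmu (sqnorm_ge0 x) (mems_domain_gt0 xD)).
rewrite th1; have -> : 4 * c * th ^+ 2 * b = c * ((2 + alpha) ^+ 2 * b) by rewrite /th; field.
by [].
Qed.

Lemma fam_sqnorm_continuous b c (a : R) : 0 < b ->
  continuous (fun x => fam th b c a H (sqnorm x)).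
Proof.
move=> b0 x.
have -> : (fun y => fam th b c a H (sqnorm y)) =
    (fun y : 'rV[R]_N => (fun t => fam th b c a H `|t|) (sqnorm y)).
  by apply/funext => y; rewrite ger0_norm ?sqnorm_ge0.
apply: (@cont_comp _ _ (@sqnorm R N) x _ (fun t => fam th b c a H `|t|)).
  exact: sqnorm_continuous.
have := sqnorm_ge0 x; rewrite le_eqVlt => /orP[/eqP <-|q0].
  exact: (@fam_cont0 _ mu th b c a H G prof th0 b0).
apply: (norm_cont_gt0 q0).
exact: is_derive_continuous (radial_derive (fam_prof c a b0) q0).
Qed.

(** The Laplacian of H (b |x|^(2 + alpha)) is
    (2 + alpha)^2 b |x|^alpha H^-2 by the equation of the profile; dividing by
    H b makes the boundary value 1 and multiplies the parameter by H b^-3. *)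
Lemma rad_sol_classical b : 0 < b ->
  classical_solution alpha (rad_lambda b) (rad_sol b : 'rV[R]_N -> R).
Proof.
move=> b0; have Hb := H_gt0 (ltW b0); split.
- rewrite rad_solE; exact: (radial_C2 (fam_prof _ _ b0) sub_reg).
- rewrite rad_solE; apply: continuous_subspaceT; exact: fam_sqnorm_continuous.
- move=> x xD; rewrite {1}rad_solE (radial_laplacian (fam_prof _ _ b0)); last exact: sub_reg.
  rewrite (rad_sol_laplacian _ b0 xD) opprK enorm_powR /rad_lambda /zz /rad_sol.
  have HX : 0 < H (b * sqnorm x `^ th) by apply: H_gt0; exact: X_ge0 (ltW b0).
  have -> : 1 - (1 - H (b * sqnorm x `^ th) / H b) = H (b * sqnorm x `^ th) / H b by ring.
  by field; rewrite !gt_eqF.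
- move=> x /usphereE q1; rewrite /rad_sol q1 powR1 mulr1 mulfV ?subrr//.
  by rewrite gt_eqF.
- apply: (@le_lt_trans _ _ (1 - (H b)^-1)%:E); last by rewrite lte_fin gtrBl invr_gt0.
  apply: ge_ereal_sup => _ [x xB <-]; rewrite lee_fin.
  have /andP[l u] := rad_sol_bounds (ltW b0) (uball_cuball xB).
  by rewrite ger0_norm.
Qed.

End solutions.

(** * Classical solutions lie above the branch *)

Section sliding.
Context {R : realType} (N : nat) (alpha : R).
Implicit Types (x y : 'rV[R]_N) (b c e t lambda : R) (u v : 'rV[R]_N -> R).
Let th := (2 + alpha) / 2.
Let mu := (N%:R - 2) / (2 + alpha).
Variables (H G : R -> R).
Hypotheses (N0 : (0 < N)%N) (N2 : alpha < 0 -> (2 <= N)%N).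
Hypotheses (alpha2 : -2 < alpha) (mu1 : -1 < mu) (prof : profile mu H G).

Let a2 : 0 < 2 + alpha. Proof. by have := alpha2; lra. Qed.
Let th0 : 0 < th. Proof. by rewrite divr_gt0. Qed.
Let th1 : th - 1 = alpha / 2. Proof. by rewrite /th; field. Qed.
Let sing : (th < 1) = (alpha < 0).
Proof. by rewrite -subr_lt0 th1 pmulr_llt0. Qed.
Let H_gt0 t : 0 <= t -> 0 < H t. Proof. exact: (profile_gt0 mu1 prof). Qed.
Let tau x := sqnorm x `^ th.
Let tau01 x : cuball x -> 0 <= tau x <= 1.
Proof.
move=> /cuballE x1; rewrite powR_ge0 /=; apply: (@le_trans _ _ (1 `^ th)); last by rewrite powR1.
by apply: ge0_ler_powR; rewrite ?nnegrE ?sqnorm_ge0// ltW.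
Qed.

Lemma Linfty_lt1 v x : (Linfty v < 1)%E -> uball x -> `|v x| < 1.
Proof.
move=> v1 xB; rewrite -lte_fin; apply: le_lt_trans v1.
by apply: ereal_sup_ubound; exists x.
Qed.

Section supersolution.
Variables (lambda : R) (v : 'rV[R]_N -> R).
Hypotheses (lambda0 : 0 < lambda) (sol : classical_solution alpha lambda v).

Let vC2 : C2_on (mems_domain alpha) v. Proof. by case: sol. Qed.
Let vcont : {within @cuball R N, continuous v}. Proof. by case: sol. Qed.
Let v_bdry x : usphere x -> v x = 0. Proof. by case: sol => _ _ _ + _; apply. Qed.
Let v_lt1 x : uball x -> v x < 1.
Proof.
move=> xB; case: sol => _ _ _ _ /Linfty_lt1/(_ xB).
by rewrite ltr_norml => /andP[].
Qed.
Let v_lap x : mems_domain alpha x ->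
  laplacian v x = - (lambda * sqnorm x `^ (alpha / 2) / (1 - v x) ^+ 2).
Proof. by move=> xD; case: sol => _ _ /(_ x xD) + _ _; rewrite enorm_powR => <-; rewrite opprK. Qed.

Let v_super x : mems_domain alpha x -> laplacian v x <= 0.
Proof.
move=> /v_lap ->; rewrite oppr_le0 divr_ge0 ?sqr_ge0// mulr_ge0 ?(ltW lambda0)//.
exact: powR_ge0.
Qed.

Lemma solution_ge0 x : cuball x -> 0 <= v x.
Proof.
move=> xB; rewrite -[v x]subr0.
have fr : radial_profile (alpha < 0) (fun=> 0 : R) (fun=> 0) (fun=> 0).
  by split=> *; try exact: is_derive_cst; try exact: cont_cst;
    apply: cont_mul; [exact: norm_continuous|exact: cont_cst].
have c0 : continuous_at 0 (fun t : R => (fun=> 0 : R) `|t|) by exact: cont_cst.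
apply: (radial_comparison N0 N2 fr c0 vC2 vcont _ _ xB).
- by move=> y /v_super; rewrite !mulr0 addr0.
- by move=> y /v_bdry ->; rewrite subrr.
Qed.

Variables (eta b0 : R).
Hypotheses (eta0 : 0 < eta) (b00 : 0 <= b0).
Hypothesis below : forall b, 0 <= b <= b0 ->
  rad_lambda alpha H b * (1 + eta) ^+ 3 <= lambda.

Let phi b x := 1 - (1 + eta) * (H (b * tau x) / H b).

Let bump b : 0 <= b <= b0 -> (forall x, cuball x -> phi b x <= v x) ->
  forall x, cuball x -> eta <= v x - phi b x.
Proof.
move=> /andP[bge0 bb0] hphi x xB.
move: bge0; rewrite le_eqVlt => /orP[/eqP b_0|bpos].
  rewrite /phi -b_0 mul0r (profile0 prof) divr1 mulr1.
  by have := solution_ge0 xB; lra.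
have Hb := H_gt0 (ltW bpos).
pose c := (1 + eta) / H b.
have c0 : 0 < c by rewrite divr_gt0// addr_gt0.
have phiE y : phi b y = fam th b c 1 H (sqnorm y).
  by rewrite /phi /fam /c mulrAC mulrA.
rewrite phiE.
have fr : radial_profile (alpha < 0) (fam th b c 1 H) (fam1 th b c G) (fam2 mu th b c H G).
  by rewrite -sing; exact: (fam_radial c 1 mu1 prof th0 bpos).
apply: (radial_comparison N0 N2 fr (@fam_cont0 R mu th b c 1 H G prof th0 bpos)
  vC2 vcont _ _ xB).
- move=> y yD; rewrite (rad_sol_laplacian N0 alpha2 mu1 prof c bpos yD).
  rewrite (v_lap yD) lerN2.
  have yB : uball y by case: yD.
  have X0 : 0 <= b * tau y by rewrite mulr_ge0 ?powR_ge0// ltW.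
  have HX := H_gt0 X0.
  have p1 : 1 - v y <= c * H (b * tau y).
    by have := hphi y (uball_cuball yB); rewrite phiE /fam; lra.
  have v1 : 0 < 1 - v y by rewrite subr_gt0 v_lt1.
  have q0 : 0 <= sqnorm y `^ (alpha / 2) by exact: powR_ge0.
  apply: (@le_trans _ _ (lambda * sqnorm y `^ (alpha / 2) / (c * H (b * tau y)) ^+ 2)).
    have -> : c * ((2 + alpha) ^+ 2 * b) * sqnorm y `^ (alpha / 2) / H (b * tau y) ^+ 2 =
       (rad_lambda alpha H b * (1 + eta) ^+ 3) * sqnorm y `^ (alpha / 2) /
          (c * H (b * tau y)) ^+ 2.
      rewrite /rad_lambda /zz /c; field.
      by rewrite !gt_eqF// addr_gt0.
    apply: ler_wpM2r; first by rewrite invr_ge0 sqr_ge0.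
    by apply: ler_wpM2r => //; apply: below; rewrite bb0 ltW.
  apply: ler_wpM2l; first by rewrite mulr_ge0// ltW.
  by apply: invsq_le.
- move=> y /[dup] /v_bdry -> /usphereE y1; rewrite /fam powR1 mulr1 /c divfK ?gt_eqF//.
  by lra.
Qed.

Let phi_lip b b' x : 0 <= b -> b <= b' -> cuball x ->
  phi b' x <= phi b x + (1 + eta) * ((1 + mu)^-1 * (b' - b)).
Proof.
move=> bge0 bb' xB; have /andP[t0 t1] := tau01 xB.
have b'0 := le_trans bge0 bb'.
have m0 : 0 < 1 + mu by have := mu1; lra.
rewrite /phi -lerBlDl.
have -> : 1 - (1 + eta) * (H (b' * tau x) / H b') - (1 - (1 + eta) * (H (b * tau x) / H b))
  = (1 + eta) * (H (b * tau x) / H b - H (b' * tau x) / H b') by ring.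
rewrite ler_pM2l ?addr_gt0//.
have Hb := H_gt0 bge0; have Hb' := H_gt0 b'0.
have X0 : 0 <= b * tau x by rewrite mulr_ge0.
have HX := H_gt0 X0.
have h1 : H (b * tau x) <= H (b' * tau x).
  by apply: (profile_le mu1 prof) => //; rewrite ler_wpM2r.
have h2 : H (b * tau x) <= H b.
  by apply: (profile_le mu1 prof) => //; rewrite ler_piMr.
have h3 := profile_lip mu1 prof bge0 bb'.
have h4 := profile_ge1 mu1 prof b'0.
have h5 := profile_le mu1 prof bge0 bb'.
apply: (@le_trans _ _ (H b' - H b)) => //.
apply: (@le_trans _ _ (H (b * tau x) / H b - H (b * tau x) / H b')).
  by rewrite lerB// ler_wpM2r// invr_ge0 ltW.
have -> : H (b * tau x) / H b - H (b * tau x) / H b' =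
    (H (b * tau x) / H b) * ((H b' - H b) / H b').
  by field; rewrite !gt_eqF.
have d0 : 0 <= H b' - H b by rewrite subr_ge0.
apply: (@le_trans _ _ (1 * ((H b' - H b) / H b'))).
  apply: ler_wpM2r; first by rewrite divr_ge0// ltW.
  by rewrite ler_pdivrMr// mul1r.
by rewrite mul1r ler_pdivrMr// ler_peMr.
Qed.

(** The functions phi b = 1 - (1 + eta) H (b |x|^(2 + alpha)) / H b solve the
    equation with parameter (1 + eta)^3 rad_lambda b <= lambda, and are - eta
    on the sphere.  If phi b <= v, the right-hand side of the equation of
    phi b is at most that of v, so that v - phi b is superharmonic
    and at least eta.  As phi b is Lipschitz in b, uniformly in x,
    the inequality survives a step in b of fixed length. *)
Lemma sliding x : cuball x -> phi b0 x <= v x.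
Proof.
have m0 : 0 < 1 + mu by have := mu1; lra.
have e1 : 0 < 1 + eta by rewrite addr_gt0.
pose d := eta * (1 + mu) / (1 + eta).
have d0 : 0 < d by rewrite divr_gt0// mulr_gt0.
(* over a step of length d, phi b moves by at most eta *)
pose bn (n : nat) := Num.min (n%:R * d) b0.
have bn0 n : 0 <= bn n by rewrite /bn le_min b00 mulr_ge0// ltW.
have bnb n : bn n <= b0 by rewrite /bn ge_min lexx orbT.
have bnS n : bn n <= bn n.+1.
  by rewrite /bn le_min !ge_min lexx !orbT andbT ler_wpM2r ?ler_nat// ltW.
have bnd n : bn n.+1 - bn n <= d.
  rewrite /bn; have : n.+1%:R * d = n%:R * d + d by rewrite -natr1 mulrDl mul1r.
  by case: (leP (n.+1%:R * d)); case: (leP (n%:R * d)); have := d0; lra.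
have P n : forall x, cuball x -> phi (bn n) x <= v x.
  elim: n => [|n IH] y yB.
    have -> : bn 0%N = 0 by rewrite /bn mul0r; apply/min_idPl.
    rewrite /phi mul0r (profile0 prof) divr1 mulr1.
    by have := solution_ge0 yB; have := eta0; lra.
  apply: le_trans (phi_lip (bn0 n) (bnS n) yB) _.
  have := bump _ IH yB; rewrite bn0 bnb => /(_ isT).
  have : (1 + eta) * ((1 + mu)^-1 * (bn n.+1 - bn n)) <= eta.
    apply: (@le_trans _ _ ((1 + eta) * ((1 + mu)^-1 * d))).
      by rewrite ler_pM2l// ler_pM2l ?invr_gt0.
    by rewrite /d le_eqVlt; apply/orP; left; apply/eqP; field; rewrite !gt_eqF.
  by lra.
move=> xB.
pose n := Num.Def.truncn (b0 / d).
have := P n.+1 x xB.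
have -> // : bn n.+1 = b0.
rewrite /bn; apply/min_idPr; rewrite -ler_pdivrMr//.
exact/ltW/truncnS_gt.
Qed.

End supersolution.

(** Lets the eta of [sliding] tend to 0; the gap between l and lambda leaves
    room for the factor (1 + eta)^3 <= 1 + 7 eta. *)
Lemma rad_sol_le lambda v b l x : 0 < lambda -> classical_solution alpha lambda v ->
  0 <= b -> l < lambda -> (forall t, 0 <= t <= b -> rad_lambda alpha H t <= l) ->
  cuball x -> rad_sol alpha H b x <= v x.
Proof.
move=> lambda0 sol b0 ll hl xB; apply/ler_addgt0Pr => e e0.
have l0 : 0 <= l.
  have h0 : (0 : R) <= 0 <= b by rewrite lexx b0.
  by have := hl 0 h0; rewrite /rad_lambda /zz mul0r mulr0.
pose eta := Num.min e (Num.min 1 ((lambda - l) / (7 * lambda))).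
have eta0 : 0 < eta.
  by rewrite /eta !lt_min e0 ltr01 /= divr_gt0 ?subr_gt0// mulr_gt0.
have etae : eta <= e by rewrite /eta ge_min lexx.
have eta1 : eta <= 1 by rewrite /eta !ge_min lexx orbT.
have etal : 7 * lambda * eta <= lambda - l.
  rewrite mulrC -ler_pdivlMr ?mulr_gt0//.
  by rewrite /eta !ge_min lexx !orbT.
have below t : 0 <= t <= b -> rad_lambda alpha H t * (1 + eta) ^+ 3 <= lambda.
  move=> /[dup] /hl tl /andP[t0 _]; have e1 : 0 <= 1 + eta by rewrite addr_ge0// ltW.
  apply: (@le_trans _ _ (l * (1 + 7 * eta))).
    have r0 : 0 <= rad_lambda alpha H t.
      by rewrite /rad_lambda mulr_ge0 ?sqr_ge0// divr_ge0// exprn_ge0// ltW// H_gt0.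
    apply: ler_pM => //; first exact: exprn_ge0.
    have -> : (1 + eta) ^+ 3 = 1 + 3 * eta + 3 * (eta * eta) + eta * (eta * eta) by ring.
      have h1 : eta * eta <= eta by rewrite ler_piMl// ltW.
      have h2 : eta * (eta * eta) <= eta * eta by rewrite ler_wpM2l// ltW.
      by lra.
  have : 0 <= (lambda - l) * eta by rewrite mulr_ge0 ?(ltW eta0)// subr_ge0 ltW.
  by lra.
have := sliding lambda0 sol eta0 b0 below xB.
have /andP[t0 t1] := tau01 xB.
have Hb := H_gt0 b0.
have : H (b * tau x) / H b <= 1.
  rewrite ler_pdivrMr// mul1r; apply: (profile_le mu1 prof); first by rewrite mulr_ge0.
  by rewrite ler_piMr.
rewrite /rad_sol -/th -/(tau x) => h1 h2.
have : eta * (H (b * tau x) / H b) <= eta by rewrite ler_piMr// ltW.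
by lra.
Qed.

End sliding.

(** * The extremal parameter and the extremal solution *)

Section congruence.
Context {R : realType} (N : nat).
Implicit Types (x y : 'rV[R]_N) (u w : 'rV[R]_N -> R) (alpha lambda : R).

Lemma open_mems_domain alpha : open (@mems_domain R N alpha).
Proof.
have -> : @mems_domain R N alpha = @uball R N `&` [set x | alpha < 0 -> x != 0].
  by apply/seteqP; split=> x.
by apply: openI; [exact: open_uball|exact: open_regular].
Qed.

Lemma partial_ext (U : set 'rV[R]_N) u w i : open U -> (forall x, U x -> w x = u x) ->
  forall x, U x -> partial i w x = partial i u x.
Proof.
move=> oU wu x Ux; apply: near_eq_derive.
by have := open_nbhs_nbhs (conj oU Ux); apply: filterS.
Qed.

Lemma continuous_ext (U : set 'rV[R]_N) u w : open U -> (forall x, U x -> w x = u x) ->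
  forall x, U x -> continuous_at x u -> continuous_at x w.
Proof.
move=> oU wu x Ux; rewrite /continuous_at wu//.
apply: cvg_trans; apply: (@near_eq_cvg _ _ (nbhs x) (nbhs_filter x) u w).
by apply: filterS (open_nbhs_nbhs (conj oU Ux)) => y Uy; rewrite wu.
Qed.

Lemma derivable_ext (U : set 'rV[R]_N) u w (h : 'rV[R]_N) : open U ->
  (forall x, U x -> w x = u x) ->
  forall x, U x -> derivable u x h -> derivable w x h.
Proof.
move=> oU wu x Ux; apply: near_eq_derivable.
by apply: filterS (open_nbhs_nbhs (conj oU Ux)) => y Uy; rewrite wu.
Qed.

Lemma C2_on_ext (U : set 'rV[R]_N) u w : open U -> (forall x, U x -> w x = u x) ->
  C2_on U u -> C2_on U w.
Proof.
move=> oU wu C2 x Ux; have [c d1 d2] := C2 x Ux.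
have p1 i := partial_ext i oU wu.
have p2 i j := partial_ext j oU (p1 i).
split=> [|i|i j]; first exact: (continuous_ext oU wu Ux c).
- have [d c1] := d1 i; split; first exact: (derivable_ext oU wu Ux d).
  exact: (continuous_ext oU (p1 i) Ux c1).
- have [d c2] := d2 i j; split; first exact: (derivable_ext oU (p1 i) Ux d).
  exact: (continuous_ext oU (p2 i j) Ux c2).
Qed.

(** The extremal solution is known only on the closed ball, so that
    being a solution must not depend on the values outside of it. *)
Lemma classical_solution_ext alpha lambda u w : (forall x, cuball x -> w x = u x) ->
  classical_solution alpha lambda u -> classical_solution alpha lambda w.
Proof.
move=> wu [C2 cu eq bd Li].
have oD := @open_mems_domain alpha.
have wuB x : uball x -> w x = u x by move=> /uball_cuball /wu.
have wuD x : mems_domain alpha x -> w x = u x by move=> [/wuB].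
split.
- exact: (C2_on_ext oD wuD C2).
- by apply: subspace_eq_continuous cu => x; rewrite inE => xB; exact/esym/wu.
- move=> x xD; rewrite (wuD x xD) -(eq x xD) /laplacian; congr (- _).
  apply: eq_bigr => i _; apply: (partial_ext i oD) => // y yD.
  exact: (partial_ext i oD).
- by move=> x xS; rewrite wu ?bd//; rewrite /cuball /= xS.
- rewrite /Linfty; suff <- : [set `|u x|%:E | x in @uball R N] =
      [set `|w x|%:E | x in @uball R N] by [].
  by apply: eq_imagel => x xB; rewrite wuB.
Qed.

Lemma Linfty_at0 u M : (forall x, uball x -> 0 <= u x <= M) -> u 0 = M ->
  Linfty u = M%:E.
Proof.
move=> hu u0; apply/eqP; rewrite eq_le; apply/andP; split.
  apply: ge_ereal_sup => _ [x xB <-]; rewrite lee_fin.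
  by have /andP[l h] := hu x xB; rewrite ger0_norm.
have B0 : @uball R N 0 by apply/uballE; rewrite sqnorm0.
apply: ereal_sup_ubound; exists 0 => //.
by have := hu 0 B0; rewrite u0 => /andP[M0 _]; rewrite ger0_norm.
Qed.

End congruence.

Section phase_cases.
Context {R : realType}.
Implicit Types (mu b e x tau : R).

Lemma phase_dichotomy mu :
  (mu <= 0 \/ (mu + 2 / 3) ^+ 2 < 4 * (mu + 1 / 3)) \/
  (0 < mu /\ 4 * (mu + 1 / 3) <= (mu + 2 / 3) ^+ 2).
Proof.
have [m0|m0] := leP mu 0; first by left; left.
by case: (ltP ((mu + 2 / 3) ^+ 2) (4 * (mu + 1 / 3))) => h; [left; right|right].
Qed.

(** The part of the half-line up to the first crossing of p = 1 / 3, where zz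
    increases. *)
Definition branch (H G : R -> R) b := 0 < b /\ forall x, 0 < x < b -> pp H G x < 1 / 3.

Lemma branch_le H G b c : 0 < b -> b <= c -> branch H G c -> branch H G b.
Proof.
move=> b0 bc [_ h]; split=> // x /andP[x0 xb]; apply: h.
by rewrite x0 (lt_le_trans xb).
Qed.

Lemma zmax_no_crossing mu : 0 < mu -> 4 * (mu + 1 / 3) <= (mu + 2 / 3) ^+ 2 ->
  zmax mu = (mu + 1 / 3) / 3.
Proof.
move=> m0 gap; have mu1 : -1 < mu by lra.
have nc := no_crossing mu1 (prP mu1) m0 gap.
have ne : [set zz (prH mu) x | x in [set x | 0 < x]] !=set0.
  by exists (zz (prH mu) 1), 1 => //=.
have ub : ubound [set zz (prH mu) x | x in [set x | 0 < x]] ((mu + 1 / 3) / 3).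
  by move=> _ [x /= x0 <-]; rewrite ltW//; case: (nc x x0).
apply/eqP; rewrite eq_le; apply/andP; split; first exact: ge_sup.
apply/ler_addgt0Pr => e e0.
have m3 : 0 < mu + 1 / 3 by lra.
have hp x : 0 < x -> pp (prH mu) (prG mu) x < 1 / 3 by move=> /nc[].
have [X X1 /(_ X (lexx X)) hX] := zz_cvg_equilibrium mu1 (prP mu1) hp m3 e0.
have : zz (prH mu) X <= zmax mu.
  apply: ub_le_sup; first by exists ((mu + 1 / 3) / 3).
  by exists X => //=; rewrite (lt_le_trans _ X1).
by lra.
Qed.

Lemma zz_le_zmax mu x : - (1 / 2) <= mu -> 0 < x -> zz (prH mu) x <= zmax mu.
Proof.
move=> m2 x0; have mu1 : -1 < mu by lra.
have [gap|[m0 gap]] := phase_dichotomy mu.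
  have [b b0 [pb hp]] := crossing_exists mu1 (prP mu1) gap.
  have m23 : - (2 / 3) <= mu by lra.
  by rewrite (zmax_crossing mu1 m23 b0 pb hp); exact: (zz_le_crossing mu1 (prP mu1) m23 b0 pb hp).
rewrite zmax_no_crossing// ltW//.
by have [] := no_crossing mu1 (prP mu1) m0 gap x0.
Qed.

Lemma zmax_gt0 mu : - (1 / 2) <= mu -> 0 < zmax mu.
Proof.
move=> m2; have mu1 : -1 < mu by lra.
exact: lt_le_trans (zz_gt0 mu1 (prP mu1) ltr01) (zz_le_zmax m2 ltr01).
Qed.

Lemma branch_sup mu l : - (1 / 2) <= mu -> l < zmax mu ->
  exists2 b, branch (prH mu) (prG mu) b & l < zz (prH mu) b.
Proof.
move=> m2; have mu1 : -1 < mu by lra.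
have [gap|[m0 gap]] := phase_dichotomy mu.
  have [b b0 [pb hp]] := crossing_exists mu1 (prP mu1) gap.
  have m23 : - (2 / 3) <= mu by lra.
  by rewrite (zmax_crossing mu1 m23 b0 pb hp) => ll; exists b.
have nc := no_crossing mu1 (prP mu1) m0 gap.
rewrite /zmax => /sup_gt[|_ [b /= b0 <-] lb].
  by exists (zz (prH mu) 1), 1 => //=.
by exists b => //; split=> // x /andP[/nc[]].
Qed.

(** The cube root is Hoelder continuous of exponent 1 / 3 with
    constant 1. *)
Lemma cube_dist (a b : R) : 0 <= a -> 0 <= b -> `|a - b| ^+ 3 <= `|a ^+ 3 - b ^+ 3|.
Proof.
wlog ab : a b / b <= a => [hw a0 b0|a0 b0].
  have [/hw|/ltW/hw] := leP b a; first exact.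
  by rewrite distrC (distrC (b ^+ 3)); exact.
have d0 : 0 <= a - b by rewrite subr_ge0.
have c0 : 0 <= a ^+ 3 - b ^+ 3 by rewrite subr_ge0 lerXn2r.
rewrite !ger0_norm// -subr_ge0.
have -> : a ^+ 3 - b ^+ 3 - (a - b) ^+ 3 = 3 * (a * b) * (a - b) by ring.
by rewrite mulr_ge0// mulr_ge0// mulr_ge0.
Qed.

(** By definition of zz, the cube of H (b tau) / H b is
    tau zz b / zz (b tau), and both values of zz tend to that of the
    equilibrium when tau > 0. *)
Lemma profile_scaling mu tau e : 0 < mu -> 4 * (mu + 1 / 3) <= (mu + 2 / 3) ^+ 2 ->
  0 <= tau <= 1 -> 0 < e ->
  exists2 X, 0 < X & forall b, X <= b ->
    `|tau `^ (1 / 3) - prH mu (b * tau) / prH mu b| < e.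
Proof.
move=> m0 gap /andP[t0 t1] e0; have mu1 : -1 < mu by lra.
have prof := prP mu1.
have Hgt b : 0 <= b -> 0 < prH mu b by exact: (profile_gt0 mu1 prof).
have m3 : 0 < mu + 1 / 3 by lra.
have nc := no_crossing mu1 prof m0 gap.
have hp x : 0 < x -> pp (prH mu) (prG mu) x < 1 / 3 by move=> /nc[].
have [tau0|tau0] := eqVneq tau 0.
  have [X X0 hX] := profile_unbounded mu1 prof e^-1.
  exists X => // b Xb; have b0 := lt_le_trans X0 Xb.
  have hb : e^-1 < prH mu b by apply: lt_le_trans hX _; exact: (profile_le mu1 prof (ltW X0)).
  rewrite tau0 powR0; last by lra.
  rewrite mulr0 (profile0 prof) sub0r normrN mul1r ger0_norm ?invr_ge0 ?(ltW (Hgt _ (ltW b0)))//.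
  by rewrite invf_plt ?posrE// Hgt// ltW.
have tpos : 0 < tau by rewrite lt_neqAle eq_sym tau0.
set zi := (mu + 1 / 3) / 3 in nc *.
have zi0 : 0 < zi by rewrite divr_gt0.
have e30 : 0 < e ^+ 3 by rewrite exprn_gt0.
pose e' := Num.min (zi / 2) (zi / 2 * e ^+ 3).
have e'0 : 0 < e' by rewrite lt_min !mulr_gt0 ?invr_gt0.
have e'1 : e' <= zi / 2 by rewrite /e' ge_min lexx.
have e'2 : e' <= zi / 2 * e ^+ 3 by rewrite /e' ge_min lexx orbT.
have [X X1 hX] := zz_cvg_equilibrium mu1 prof hp m3 e'0.
have X0 : 0 < X by rewrite (lt_le_trans _ X1).
exists (X / tau) => [|b]; first by rewrite divr_gt0.
rewrite ler_pdivrMr// => Xb.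
have b0 : 0 < b by rewrite -(pmulr_lgt0 _ tpos) (lt_le_trans X0).
have Xb' : X <= b by apply: le_trans Xb _; rewrite ler_piMr// ltW.
have bt0 := lt_le_trans X0 Xb.
have za := hX _ Xb; have zb := hX _ Xb'.
rewrite -/zi in za zb; have [_ za'] := nc _ bt0; have [_ zb'] := nc _ b0.
have Ha := Hgt _ (ltW bt0); have Hb := Hgt _ (ltW b0).
set s := _ / prH mu b; have s0 : 0 <= s by rewrite divr_ge0// ltW.
have s3 : s ^+ 3 = tau * zz (prH mu) b / zz (prH mu) (b * tau).
  by rewrite /s /zz; field; rewrite !gt_eqF.
have y3 : (tau `^ (1 / 3)) ^+ 3 = tau.
  rewrite -powR_mulrn ?powR_ge0// -powRrM.
  have -> : 1 / 3 * 3%:R = 1 :> R by lra.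
  by rewrite powRr1// ltW.
have dist := cube_dist (powR_ge0 tau (1 / 3)) s0; rewrite y3 s3 in dist.
rewrite ltNge; apply/negP => he.
have h3 : e ^+ 3 <= `|tau `^ (1 / 3) - s| ^+ 3 by rewrite lerXn2r ?nnegrE// ltW.
have := le_trans h3 dist; apply/negP; rewrite -ltNge.
have z0 : 0 < zz (prH mu) (b * tau) by exact: (zz_gt0 mu1 prof bt0).
have -> : tau - tau * zz (prH mu) b / zz (prH mu) (b * tau) =
    tau * (zz (prH mu) (b * tau) - zz (prH mu) b) / zz (prH mu) (b * tau).
  by field; rewrite gt_eqF.
rewrite normrM normrM (ger0_norm t0) normfV (gtr0_norm z0) ltr_pdivrMr//.
have d : `|zz (prH mu) (b * tau) - zz (prH mu) b| < e'.
  by rewrite ltr_distl; apply/andP; split; lra.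
apply: (@le_lt_trans _ _ (1 * `|zz (prH mu) (b * tau) - zz (prH mu) b|)).
  by rewrite ler_wpM2r.
rewrite mul1r; apply: lt_le_trans d _; apply: le_trans e'2 _.
rewrite mulrC ler_wpM2l ?(ltW e30)//.
by lra.
Qed.

End phase_cases.

Section extremal.
Context {R : realType} (N : nat) (alpha : R).
Implicit Types (x y : 'rV[R]_N) (b c e t lambda : R) (u v : 'rV[R]_N -> R).
Hypotheses (N0 : (0 < N)%N) (N2 : alpha < 0 -> (2 <= N)%N) (alpha2 : -2 < alpha).

Definition phase_mu : R := (N%:R - 2) / (2 + alpha).
Local Notation mu := phase_mu.
Local Notation H := (prH mu).
Local Notation G := (prG mu).
Local Notation I := (branch H G).
Local Notation rlambda := (rad_lambda alpha H).
Local Notation rsol := (rad_sol alpha H).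

Let a2 : 0 < 2 + alpha. Proof. by have := alpha2; lra. Qed.
Let a22 : 0 < (2 + alpha) ^+ 2. Proof. by rewrite exprn_gt0. Qed.

Lemma phase_mu_ge : - (1 / 2) <= mu.
Proof.
rewrite /mu ler_pdivlMr//.
have [a0|a0] := ltP alpha 0.
  have : 2%:R <= N%:R :> R by rewrite ler_nat N2.
  by have := a2; lra.
have : 1%:R <= N%:R :> R by rewrite ler_nat.
by lra.
Qed.

Let mu1 : -1 < mu. Proof. by have := phase_mu_ge; lra. Qed.
Let prof : profile mu H G. Proof. exact: prP. Qed.
Let H_gt0 t : 0 <= t -> 0 < H t. Proof. exact: (profile_gt0 mu1 prof). Qed.
Let zl b : 0 < b -> zz H b <= zmax mu. Proof. exact: (zz_le_zmax phase_mu_ge). Qed.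

Let rlambda_gt0 b : 0 < b -> 0 < rlambda b.
Proof. by move=> b0; rewrite /rad_lambda mulr_gt0// (zz_gt0 mu1 prof b0). Qed.

Lemma rad_sol0 b : rsol b (0 : 'rV[R]_N) = 1 - (H b)^-1.
Proof.
rewrite /rad_sol sqnorm0 powR0 ?mulr0 ?(profile0 prof) ?mul1r//.
by rewrite gt_eqF// divr_gt0.
Qed.

(** The branch gives solutions for all the values of (2 + alpha)^2 zz.  For
    a larger lambda a solution would lie above the whole branch, whose value at
    the origin tends to 1. *)
Lemma lambda_starE : lambda_star N alpha = (2 + alpha) ^+ 2 * zmax mu.
Proof.
have in_set b : 0 < b -> [set lambda | 0 < lambda /\
    exists u : 'rV[R]_N -> R, classical_solution alpha lambda u] (rlambda b).
  move=> b0; split; first exact: rlambda_gt0.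
  by exists (rsol b); exact: (rad_sol_classical N0 alpha2 mu1 prof b0).
have ub : ubound [set lambda | 0 < lambda /\
    exists u : 'rV[R]_N -> R, classical_solution alpha lambda u] ((2 + alpha) ^+ 2 * zmax mu).
  move=> lambda [l0 [v sol]]; rewrite leNgt; apply/negP => gt.
  have B0 : @uball R N 0 by apply/uballE; rewrite sqnorm0.
  have v1 : v 0 < 1.
    case: sol => _ _ _ _ /Linfty_lt1/(_ B0).
    by rewrite ltr_norml => /andP[].
  have d0 : 0 < 1 - v 0 by rewrite subr_gt0.
  have [b b0 hb] := profile_unbounded mu1 prof (1 - v 0)^-1.
  have below t : 0 <= t <= b -> rlambda t <= (2 + alpha) ^+ 2 * zmax mu.
    move=> /andP[]; rewrite le_eqVlt => /orP[/eqP <- _|t0 _].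
      rewrite /rad_lambda /zz mul0r mulr0 mulr_ge0 ?(ltW a22)//.
      exact/ltW/zmax_gt0/phase_mu_ge.
    by rewrite /rad_lambda ler_pM2l// zl.
  have := rad_sol_le N0 N2 alpha2 mu1 prof l0 sol (ltW b0) gt below (uball_cuball B0).
  rewrite rad_sol0 => h.
  have : (H b)^-1 < 1 - v 0 by rewrite invf_plt ?posrE ?H_gt0// ltW.
  by lra.
apply/eqP; rewrite eq_le; apply/andP; split.
  by apply: ge_sup => //; exists (rlambda 1); exact: in_set.
rewrite -ler_pdivlMl// mulrC.
apply: ge_sup; first by exists (zz H 1), 1 => /=.
move=> _ [b /= b0 <-]; rewrite ler_pdivlMr// mulrC.
by apply: ub_le_sup; [exists ((2 + alpha) ^+ 2 * zmax mu)|exact: in_set].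
Qed.

Lemma rad_sol_cont_param b x : 0 < b -> continuous_at b (fun b => rsol b x).
Proof.
move=> b0; rewrite /rad_sol.
have cH t : 0 <= t -> continuous_at t H.
  by move=> t0; exact: is_derive_continuous (profile_derive prof t0).
apply: cont_add; first exact: cont_cst.
apply: cont_opp; apply: cont_mul.
  apply: (@cont_comp _ _ (fun c => c * sqnorm x `^ ((2 + alpha) / 2)) b _ H).
    by apply: cont_mul; [exact: cvg_id|exact: cont_cst].
  by apply: cH; rewrite mulr_ge0 ?powR_ge0// ltW.
by apply: cont_inv; [exact/cH/ltW|rewrite gt_eqF// H_gt0// ltW].
Qed.

Let left_of b d : 0 < b -> 0 < d -> exists c, [/\ 0 < c, c < b & b - c < d].
Proof.
move=> b0 d0; exists (Num.max (b / 2) (b - d / 2)); split.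
- by rewrite lt_max divr_gt0.
- by rewrite gt_max; apply/andP; split; lra.
- have : b - d / 2 <= Num.max (b / 2) (b - d / 2) by rewrite le_max lexx orbT.
  by lra.
Qed.

Let rlambda_lt b c : I c -> 0 < b -> b < c -> rlambda b < rlambda c.
Proof.
move=> [c0 hc] b0 bc; rewrite /rad_lambda ltr_pM2l//.
exact: (zz_lt mu1 prof hc b0 bc (lexx c)).
Qed.

Let rlambda_le b c : I c -> 0 < b -> b <= c -> rlambda b <= rlambda c.
Proof.
move=> Ic b0; rewrite le_eqVlt => /orP[/eqP -> //|bc].
exact/ltW/rlambda_lt.
Qed.

(** The comparison gives rad_sol c <= v for c < b, where the
    parameter is smaller; then c tends to b. *)
Lemma rad_sol_minimal b : I b ->
  minimal_solution alpha (rlambda b) (rsol b : 'rV[R]_N -> R).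
Proof.
move=> Ib; have [b0 _] := Ib; split; first exact: (rad_sol_classical N0 alpha2 mu1 prof b0).
move=> v sol x xB; apply/ler_addgt0Pr => e e0.
have [d d0 hd] := cont_eps (@rad_sol_cont_param b x b0) e0.
have [c [c0 cb cd]] := left_of b0 d0.
have : rsol c x <= v x.
  apply: (rad_sol_le N0 N2 alpha2 mu1 prof (rlambda_gt0 b0) sol (ltW c0) (rlambda_lt Ib c0 cb)).
    move=> t /andP[]; rewrite le_eqVlt => /orP[/eqP <- _|t0 tc].
      by rewrite {1}/rad_lambda {1}/zz mul0r mulr0 ltW// rlambda_gt0.
    exact: (rlambda_le (branch_le c0 (ltW cb) Ib) t0 tc).
  exact: uball_cuball.
have := hd c; rewrite gtr0_norm ?subr_gt0// => /(_ cd); rewrite ltr_norml => /andP[_].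
by lra.
Qed.

Lemma u_min_rad b x : I b -> cuball x -> u_min alpha (rlambda b) x = rsol b x.
Proof.
move=> Ib; have m := rad_sol_minimal Ib.
have [s1 m1] : minimal_solution alpha (rlambda b) (u_min (N := N) alpha (rlambda b)).
  exact: (@getPex _ [set u | minimal_solution alpha (rlambda b) u] (ex_intro _ _ m)).
have [s2 m2] := m.
rewrite /cuball /= le_eqVlt => /orP[/eqP x1|xB].
  have [_ _ _ b1 _] := s1; have [_ _ _ b2 _] := s2.
  by rewrite b1// b2.
by apply/eqP; rewrite eq_le m1//= m2.
Qed.

(** For lambda close to lambda_star, the intermediate value theorem gives a
    point b on the increasing part of zz, beyond any prescribed X, whose
    parameter is lambda; then u_min alpha lambda is rad_sol b. *)
Lemma u_star_limit x l : cuball x ->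
  (forall e, 0 < e -> exists X, [/\ I X, zz H X < zmax mu &
     forall b, I b -> X <= b -> `|l - rsol b x| < e]) ->
  u_star alpha x = l.
Proof.
move=> xB hl; apply: cvg_lim => //.
apply/cvgrPdist_lt => e e0; have [X [[X0 IX] Xz hX]] := hl e e0.
have Xl : rlambda X < lambda_star N alpha.
  by rewrite lambda_starE /rad_lambda ltr_pM2l.
near=> lambda.
have lX : rlambda X < lambda by near: lambda; exact: nbhs_left_gt.
have ll : lambda / (2 + alpha) ^+ 2 < zmax mu.
  rewrite ltr_pdivrMr// mulrC -lambda_starE.
  by near: lambda; exact: nbhs_left_lt.
have [Y IY lY] := branch_sup phase_mu_ge ll.
have {lY}lY : lambda < rlambda Y by rewrite /rad_lambda mulrC -ltr_pdivrMr.
have [Y0 _] := IY.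
have XY : X <= Y.
  rewrite leNgt; apply/negP => YX.
  by have := lt_trans (lt_trans (rlambda_lt (conj X0 IX) Y0 YX) lX) lY; rewrite ltxx.
have cl : {within `[X, Y], continuous rlambda}.
  apply: (@is_derive_within _ rlambda
    (fun b => (2 + alpha) ^+ 2 * (zz H b * (1 - 3 * pp H G b) / b))).
  move=> t /andP[Xt _]; have t0 := lt_le_trans X0 Xt.
  rewrite /rad_lambda; deriv; first exact: (zz_derive mu1 prof).
  by rewrite mul0r add0r.
have [|b] := IVT XY cl (v := lambda).
  by rewrite ge_min le_max (ltW lX) (ltW lY) orbT.
rewrite in_itv /= => /andP[Xb bY] <-.
have Ib := branch_le (lt_le_trans X0 Xb) bY IY.
by rewrite u_min_rad//; exact: hX.
Unshelve. all: by end_near.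
Qed.

Section crossing_reached.
Variable b : R.
Hypotheses (Ib : I b) (pb : pp H G b = 1 / 3).

Let b0 : 0 < b. Proof. by case: Ib. Qed.
Let zb : zmax mu = zz H b.
Proof.
have m := phase_mu_ge; have m23 : - (2 / 3) <= mu by lra.
by have [_ hb] := Ib; exact: (zmax_crossing mu1 m23 b0 pb hb).
Qed.

Lemma u_star_crossing x : cuball x -> u_star alpha x = rsol b x.
Proof.
move=> xB; apply: u_star_limit => // e e0.
have [d d0 hd] := cont_eps (@rad_sol_cont_param b x b0) e0.
have [c [c0 cb cd]] := left_of b0 d0.
exists c; split=> [||t [t0 It] ct].
- exact: branch_le (ltW cb) Ib.
- have [_ hb] := Ib; rewrite zb; exact: (zz_lt mu1 prof hb c0 cb (lexx b)).
- have tb : t <= b.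
    rewrite leNgt; apply/negP => bt; have := It b; rewrite b0 bt pb ltxx.
    by move=> /(_ isT).
  apply: hd; rewrite ger0_norm ?subr_ge0//; lra.
Qed.

Lemma pull_in_crossing : pull_in_distance N alpha = (1 - (H b)^-1)%:E.
Proof.
apply: Linfty_at0 => [x /uball_cuball xB|].
  by rewrite u_star_crossing//; exact: (rad_sol_bounds alpha2 mu1 prof (ltW b0) xB).
by rewrite u_star_crossing ?rad_sol0//; apply: uball_cuball; apply/uballE; rewrite sqnorm0.
Qed.

Lemma u_star_classical : classical_solution alpha (lambda_star N alpha)
  (u_star alpha : 'rV[R]_N -> R).
Proof.
rewrite lambda_starE zb.
exact: classical_solution_ext u_star_crossing (rad_sol_classical N0 alpha2 mu1 prof b0).
Qed.

Lemma pull_in_lt1 : (pull_in_distance N alpha < 1)%E.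
Proof. by have [] := u_star_classical. Qed.

End crossing_reached.

Section equilibrium_reached.
Hypotheses (mu0 : 0 < mu) (gap : 4 * (mu + 1 / 3) <= (mu + 2 / 3) ^+ 2).

Lemma u_star_no_crossing x : cuball x ->
  u_star alpha x = 1 - enorm x `^ ((2 + alpha) / 3).
Proof.
move=> xB; apply: u_star_limit => // e e0.
have nc := no_crossing mu1 prof mu0 gap.
pose tau := sqnorm x `^ ((2 + alpha) / 2).
have t01 : 0 <= tau <= 1.
  rewrite powR_ge0 /=; apply: (@le_trans _ _ (1 `^ ((2 + alpha) / 2))); last by rewrite powR1.
  move/cuballE: xB => xB.
  by apply: ge0_ler_powR; rewrite ?nnegrE ?sqnorm_ge0// divr_ge0// ltW.
have [X X0 hX] := profile_scaling mu0 gap t01 e0.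
exists X; split=> [||b [b0 _] Xb].
- by split=> // t /andP[/nc[]].
- by rewrite (zmax_no_crossing mu0 gap); case: (nc X X0).
- have -> : enorm x `^ ((2 + alpha) / 3) = tau `^ (1 / 3).
    by rewrite enorm_powR /tau -powRrM; congr (_ `^ _); field.
  have -> : 1 - tau `^ (1 / 3) - rsol b x = - (tau `^ (1 / 3) - H (b * tau) / H b).
    by rewrite /rad_sol -/tau; ring.
  by rewrite normrN; exact: hX.
Qed.

Lemma pull_in_no_crossing : pull_in_distance N alpha = 1%E.
Proof.
have e0 : 0 < (2 + alpha) / 3 / 2 by rewrite !divr_gt0.
apply: (@Linfty_at0 _ _ _ 1) => [x xB|].
  rewrite (u_star_no_crossing (uball_cuball xB)) gerBl powR_ge0 andbT subr_ge0.
  rewrite enorm_powR; apply: (@le_trans _ _ (1 `^ ((2 + alpha) / 3 / 2))); last by rewrite powR1.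
  move/uballE: xB => xB.
  by apply: ge0_ler_powR; rewrite ?nnegrE ?sqnorm_ge0// ltW.
rewrite u_star_no_crossing; last by apply/cuballE; rewrite sqnorm0.
by rewrite enorm_powR sqnorm0 powR0 ?subr0// gt_eqF.
Qed.

End equilibrium_reached.
End extremal.

(** * The critical power and the estimates *)

Section critical.
Context {R : realType}.
Implicit Types (alpha mu s : R) (N : nat).

Lemma phase_mu2 alpha : phase_mu 2 alpha = 0.
Proof. by rewrite /phase_mu subrr mul0r. Qed.

Lemma crossing_branch N alpha : (0 < N)%N -> (alpha < 0 -> (2 <= N)%N) -> -2 < alpha ->
  phase_mu N alpha <= 0 \/
    (phase_mu N alpha + 2 / 3) ^+ 2 < 4 * (phase_mu N alpha + 1 / 3) ->
  exists2 b, branch (prH (phase_mu N alpha)) (prG (phase_mu N alpha)) b &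
    pp (prH (phase_mu N alpha)) (prG (phase_mu N alpha)) b = 1 / 3.
Proof.
move=> N0 N2 a2 gap; have m := phase_mu_ge N0 N2 a2.
have m1 : -1 < phase_mu N alpha by lra.
by have [b b0 [pb hp]] := crossing_exists m1 (prP m1) gap; exists b.
Qed.

Lemma sqrt6_bounds : 244 / 100 < Num.sqrt (6 : R) < 245 / 100.
Proof.
have s6 : Num.sqrt 6 ^+ 2 = 6 :> R by rewrite sqr_sqrtr.
have s0 : 0 <= Num.sqrt 6 :> R by exact: sqrtr_ge0.
by apply/andP; split; nra.
Qed.

Lemma alpha_crit_gt0 N : (8 <= N)%N -> 0 < alpha_crit N :> R.
Proof.
move=> N8; have /andP[s1 s2] := sqrt6_bounds.
have : 8%:R <= N%:R :> R by rewrite ler_nat.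
by rewrite /alpha_crit => h; apply: divr_gt0; lra.
Qed.

(** alpha_crit N is the value of alpha for which phase_mu N alpha is
    (4 + 2 sqrt 6) / 3. *)
Lemma critical_mu N alpha : -2 < alpha ->
  (alpha_crit N < alpha) = (phase_mu N alpha < (4 + 2 * Num.sqrt 6) / 3).
Proof.
move=> a2; have /andP[s1 s2] := sqrt6_bounds.
have a0 : 0 < 2 + alpha by lra.
rewrite /alpha_crit /phase_mu ltr_pdivrMr; last by lra.
rewrite ltr_pdivrMr//.
by apply/idP/idP => h; lra.
Qed.

(** The discriminant at the equilibrium is a quadratic polynomial in mu with
    roots (4 + 2 sqrt 6) / 3 and (4 - 2 sqrt 6) / 3 < 0. *)
Lemma gap_factor mu : 0 < mu ->
  ((mu + 2 / 3) ^+ 2 < 4 * (mu + 1 / 3)) = (mu < (4 + 2 * Num.sqrt 6) / 3).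
Proof.
move=> m0; have /andP[s1 s2] := sqrt6_bounds.
have s6 : Num.sqrt 6 ^+ 2 = 6 :> R by rewrite sqr_sqrtr.
have c0 : 0 < mu - (4 - 2 * Num.sqrt 6) / 3 by lra.
rewrite -[LHS]subr_lt0 -[RHS]subr_lt0.
have -> : (mu + 2 / 3) ^+ 2 - 4 * (mu + 1 / 3) =
   (mu - (4 + 2 * Num.sqrt 6) / 3) * (mu - (4 - 2 * Num.sqrt 6) / 3).
  have -> : (mu - (4 + 2 * Num.sqrt 6) / 3) * (mu - (4 - 2 * Num.sqrt 6) / 3) =
    mu ^+ 2 - 8 / 3 * mu + (16 - 4 * Num.sqrt 6 ^+ 2) / 9 by field.
  by rewrite s6; field.
by rewrite pmulr_llt0.
Qed.

(** Here mu <= (N - 2) / 2 <= 5 / 2, while (4 + 2 sqrt 6) / 3 is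
    about 2.97. *)
Lemma low_dimension_gap N alpha : (1 <= N <= 7)%N -> 0 <= alpha ->
  phase_mu N alpha <= 0 \/
    (phase_mu N alpha + 2 / 3) ^+ 2 < 4 * (phase_mu N alpha + 1 / 3).
Proof.
move=> /andP[N1 N7] a0; have [|m0] := leP (phase_mu N alpha) 0; first by left.
right; rewrite gap_factor//.
have /andP[s1 s2] := sqrt6_bounds.
have h : N%:R <= 7%:R :> R by rewrite ler_nat.
have a2 : 0 < 2 + alpha by lra.
rewrite /phase_mu ltr_pdivrMr//; nra.
Qed.

Lemma high_dimension_gap N alpha : (8 <= N)%N -> alpha_crit N < alpha ->
  (phase_mu N alpha + 2 / 3) ^+ 2 < 4 * (phase_mu N alpha + 1 / 3).
Proof.
move=> N8 ac; have c0 := alpha_crit_gt0 N8.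
have a0 : 0 < 2 + alpha by lra.
have h : 8%:R <= N%:R :> R by rewrite ler_nat.
rewrite gap_factor; last by rewrite divr_gt0//; lra.
by rewrite -critical_mu//; lra.
Qed.

Lemma planar_crossing : exists2 b : R, branch (prH 0) (prG 0) b &
  pp (prH 0) (prG 0) b = 1 / 3.
Proof.
have := @crossing_branch 2 0 isT; rewrite phase_mu2; apply=> //; last by left.
Qed.

End critical.

Theorem corollary4p2 (R : realType) :
  [/\ (* the decimals 0.789 and 0.445 stand for lambda_star 2 0 and
         pull_in_distance 2 0, up to one unit in the last decimal *)
      `|lambda_star 2 0 - 789 / 1000 : R| < 1 / 1000 /\
      (`|pull_in_distance 2 (0 : R) - (445 / 1000)%:E| < (1 / 1000)%:E)%E,
      (* item 1 *)
      forall N : nat, (1 <= N)%N ->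
        lambda_star N alpha / (lambda_star 2 0 * (1 + alpha / 2) ^+ 2)
          @[alpha --> +oo] --> (1 : R),
      (* item 2 *)
      forall alpha : R, -2 < alpha ->
        lambda_star 2 alpha = lambda_star 2 0 * (1 + alpha / 2) ^+ 2 /\
        pull_in_distance 2 alpha = pull_in_distance 2 (0 : R),
      (* item 3 *)
      forall (N : nat) (alpha : R),
        (1 <= N <= 7)%N /\ 0 <= alpha \/ (8 <= N)%N /\ alpha_crit N < alpha ->
        classical_solution alpha (lambda_star N alpha)
          (u_star alpha : 'rV[R]_N -> R) /\
        (pull_in_distance N alpha < 1)%E
    & (* item 4 *)
      forall (N : nat) (alpha : R),
        (8 <= N)%N -> 0 <= alpha <= alpha_crit N ->
        [/\ forall x : 'rV[R]_N, uball x ->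
              u_star alpha x = 1 - enorm x `^ ((2 + alpha) / 3),
            lambda_star N alpha = (2 + alpha) * (3 * N%:R + alpha - 4) / 9
          & pull_in_distance N alpha = 1%E]].
Proof.
have [b Ib pb] := @planar_crossing R.
have planar_lambda alpha : -2 < alpha ->
    lambda_star 2 alpha = (2 + alpha) ^+ 2 * zmax (0 : R).
  by move=> a2; rewrite lambda_starE// phase_mu2.
have planar_pull alpha : -2 < alpha -> pull_in_distance 2 alpha = (1 - (prH 0 b)^-1)%:E.
  move=> a2; have := @pull_in_crossing R 2 alpha isT (fun=> isT) a2 b.
  by rewrite phase_mu2 => /(_ Ib pb).
have m20 : -2 < (0 : R) by lra.
have m1 : -1 < (0 : R) by lra.
have m2 : - (1 / 2) <= (0 : R) by lra.
have m23 : - (2 / 3) <= (0 : R) by lra.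
have z0 := zmax_gt0 m2.
have lambda20 : lambda_star 2 0 = 4 * zmax (0 : R).
  by rewrite planar_lambda//; ring.
split=> [|N N1|alpha a2|N alpha h|N alpha N8 /andP[a0 ac]].
- have [b0 hb] := Ib.
  have [/andP[z1 z2] /andP[h1 h2]] := planar_bounds (prP m1) b0 pb hb.
  split.
    rewrite lambda20 (zmax_crossing m1 m23 b0 pb hb) ltr_distl.
    by apply/andP; split; lra.
  have H0 := profile_gt0 m1 (prP m1) (ltW b0).
  rewrite planar_pull// -EFinB abse_EFin lte_fin ltr_distl.
  have e1 : prH 0 b * (prH 0 b)^-1 = 1 by rewrite mulfV// gt_eqF.
  have i0 : 0 < (prH 0 b)^-1 by rewrite invr_gt0.
  move: h1 h2; rewrite ltr_pdivrMr; last by lra.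
  rewrite ltr_pdivlMr; last by lra.
  by move=> h1 h2; apply/andP; split; nra.
- apply/cvgrPdist_lt => e e0.
  have e'0 : 0 < e / 2 * zmax (0 : R) by rewrite mulr_gt0// divr_gt0.
  have [d d0 hd] := zmax_continuous e'0.
  near=> alpha.
  have a0 : 0 < alpha by near: alpha; apply: nbhs_pinfty_gt; exact: num_real.
  have ad : `|N%:R - 2| / d < alpha by near: alpha; apply: nbhs_pinfty_gt; exact: num_real.
  have a2 : -2 < alpha by lra.
  have aN : alpha < 0 -> (2 <= N)%N by move=> ?; lra.
  have s0 : 0 < 2 + alpha by lra.
  have : `|phase_mu N alpha| < d.
    rewrite /phase_mu normrM normfV (gtr0_norm s0) ltr_pdivrMr//.
    by move: ad; rewrite ltr_pdivrMr//; nra.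
  move=> /hd; rewrite lambda_starE// lambda20.
  have -> : 1 - (2 + alpha) ^+ 2 * zmax (phase_mu N alpha) /
      (4 * zmax 0 * (1 + alpha / 2) ^+ 2) = - ((zmax (phase_mu N alpha) - zmax 0) / zmax 0).
    by field; rewrite !gt_eqF//.
  rewrite normrN normrM normfV (gtr0_norm z0) => hz.
  by rewrite ltr_pdivrMr//; apply: le_lt_trans hz _; rewrite ltr_pM2r//; lra.
- by rewrite !planar_pull// lambda20 planar_lambda//; split=> //; field.
- have [N0 a0 gap] : [/\ (0 < N)%N, 0 <= alpha & phase_mu N alpha <= 0 \/
      (phase_mu N alpha + 2 / 3) ^+ 2 < 4 * (phase_mu N alpha + 1 / 3)].
    case: h => -[hN ha].
      split; [by case/andP: hN|exact: ha|exact: low_dimension_gap hN ha].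
    split; first exact: (@leq_trans 8).
      by have := alpha_crit_gt0 (R := R) hN; lra.
    by right; exact: high_dimension_gap.
  have a2 : -2 < alpha by lra.
  have aN : alpha < 0 -> (2 <= N)%N by move=> ?; lra.
  have [c Ic pc] := crossing_branch N0 aN a2 gap.
  by split; [exact: (u_star_classical N0 aN a2 Ic pc)|exact: (pull_in_lt1 N0 aN a2 Ic pc)].
- have N0 : (0 < N)%N by exact: (@leq_trans 8).
  have a2 : -2 < alpha by lra.
  have s0 : 0 < 2 + alpha by lra.
  have aN : alpha < 0 -> (2 <= N)%N by move=> ?; lra.
  have hN : 8%:R <= N%:R :> R by rewrite ler_nat.
  have mu0 : 0 < phase_mu N alpha by rewrite divr_gt0//; lra.
  have gap : 4 * (phase_mu N alpha + 1 / 3) <= (phase_mu N alpha + 2 / 3) ^+ 2.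
    by rewrite leNgt gap_factor// -critical_mu// -leNgt.
  split=> [x xB||]; last exact: pull_in_no_crossing.
    by apply: u_star_no_crossing => //; exact: uball_cuball.
  rewrite lambda_starE// zmax_no_crossing// /phase_mu; field.
  by rewrite gt_eqF.
Unshelve. all: by end_near.
Qed.
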